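(* Let $n\ge1$, $\theta=(\theta_1,\theta_2)\in\{0,1\}^2$, and let $\lambda,T\in\mathbb{R}$ be such that $Z_{n,\theta}(\lambda,T)\neq0$. For $y=(t,h)$ and $y'=(t',h')$ in $\mathbb{T}_n$ define $$H^{\lambda,\theta,T}(y,y')=\frac{T}{n}\sum_{z^n=(-1)^{\theta_2}}z^{1+h-h'}\,\frac{e^{-(\lambda+\theta_1\pi i+Tz)[t'-t]}}{1-e^{-(\lambda+\theta_1\pi i+Tz)}},$$ $$K_n^{\lambda,\theta,T}(y,y')=-\frac1n\sum_{z^n=(-1)^{\theta_2}}\frac{z^{h-h'}\,e^{-(\lambda+\theta_1\pi i+Tz)([t'-t]+\mathbf{1}_{t'=t})}}{1-e^{-(\lambda+\theta_1\pi i+Tz)}},$$ where the sums run over complex $z$. Let $\mathcal{B},\mathcal{O},\mathcal{U}$ be disjoint finite index sets and let $x_i=(t_i,h_i)$, $i\in\mathcal{B}\cup\mathcal{O}\cup\mathcal{U}$, be distinct points of $\mathbb{T}_n$. Let $\Gamma(x_i:i\in\mathcal{B}\cup\mathcal{O}\cup\mathcal{U})$ be the event that there is a bead in $\mathrm{d}x_i$ for each $i\in\mathcal{B}$, that $x_i$ is occupied for each $i\in\mathcal{O}$, and that $x_i$ is unoccupied for each $i\in\mathcal{U}$. Then $$\mathbf{P}_n^{\lambda,\theta,T}\big(\Gamma(x_i:i\in\mathcal{B}\cup\mathcal{O}\cup\mathcal{U})\big)=\Big(\det_{i,j\in\mathcal{O}\sqcup\mathcal{U}\sqcup\mathcal{B}}K^*_{i,j}\Big)\prod_{i\in\mathcal{B}}\mathrm{d}t_i,$$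 where $$K^*_{i,j}=\begin{cases}K_n^{\lambda,\theta,T}(x_i,x_j)& i\in\mathcal{O},\\ \delta_{i,j}-K_n^{\lambda,\theta,T}(x_i,x_j)& i\in\mathcal{U},\\ H^{\lambda,\theta,T}(x_i,x_j)& i\in\mathcal{B}.\end{cases}$$
   Context: Let $\mathbb{Z}_n=\mathbb{Z}/n\mathbb{Z}$ and $\mathbb{T}_n=[0,1)\times\mathbb{Z}_n$. In the exponents $h-h'$, elements of $\mathbb{Z}_n$ are represented by integers in $\{0,1,\dots,n-1\}$. For $t,t'\in[0,1)$, $[t'-t]:=t'-t+\mathbf{1}_{t'<t}$. Bead configurations. For $k\ge1$, a bead configuration with $k$ beads per string is a collection of $nk$ distinct points (beads) of $\mathbb{T}_n$, with $k$ on each string $[0,1)\times\{h\}$, such that for every $h\in\mathbb{Z}_n$, if $t_1<\dots<t_k$ are the beads on string $h$ and $t_1'<\dots<t_k'$ those on string $h+1$ (mod $n$), then either $t_1\le t_1'<t_2\le t_2'<\dots<t_k\le t_k'$ or $t_1'<t_1\le t_2'<t_2\le\dots\le t_k'<t_k$. Occupation. For each bead $(t,h)$ let $u\in[0,1)$ be the smallest number such that $(t+u\bmod1,\,h+1)$ is a bead; the points $(t+v\bmod 1,\,h+1)$ with $0\le v<u$ are occupied. Points of $\mathbb{T}_n$ not so obtained are unoccupied. The number of occupied strings at time $t$ does not depend on $t$ and is the occupation number $\ell$; such a configuration is an $(n,k,\ell)$ configuration. For $k=0$ there are no beads, and a configuration is specified by an arbitrary subset $S\subseteq\mathbb{Z}_n$: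 $(t,h)$ is occupied for all $t$ if $h\in S$ and unoccupied for all $t$ if $h\notin S$; its occupation number is $\ell=|S|$. Signed measure. $\mathbf{P}_n^{\lambda,\theta,T}$ is the signed measure of total mass one on such configurations defined as follows: for $k\ge1$, on the set of $(n,k,\ell)$ configurations, described by the array $(t_{i,h})_{1\le i\le k,\,h\in\mathbb{Z}_n}\in[0,1)^{nk}$ of ordered bead positions $t_{1,h}<\dots<t_{k,h}$ on each string $h$, it has density $$\frac{T^{nk}}{Z_{n,\theta}(\lambda,T)}\cdot\frac12(-1)^{(\theta_1+k+1)(\theta_2+n+\ell+1)}e^{-\lambda\ell}$$ with respect to Lebesgue measure; for $k=0$, each $S\subseteq\mathbb{Z}_n$ has mass given by the same expression with $k=0$ and $\ell=|S|$. The constant $Z_{n,\theta}(\lambda,T)$, assumed nonzero, is the normalising constant making the total mass equal to one. Meaning of the formula: with the points $x_i$, $i\in\mathcal{O}\cup\mathcal{U}$, and the strings $h_i$, $i\in\mathcal{B}$, fixed, the function $\det K^*$ of $(t_i)_{i\in\mathcal{B}}$ is the density with respect to $\prod_{i\in\mathcal{B}}\mathrm{d}t_i$ on $[0,1)^{\mathcal{B}}$ of the signed measure assigning to each Borel set $A\subseteq[0,1)^{\mathcal{B}}$ the integral under $\mathbf{P}_n^{\lambda,\theta,T}$ of the number of families of distinct beads $((s_i,h_i))_{i\in\mathcal{B}}$ with $(s_i)_{i\in\mathcal{B}}\in A$, times the indicator that $x_i$ is occupied for every $i\in\mathcal{O}$ and unoccupied for every $i\in\mathcal{U}$. *)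

(* Defs.v *)
From HB Require Import structures.
From mathcomp Require Import all_boot all_order all_algebra finmap.
From mathcomp Require Import all_classical all_reals all_analysis.
From mathcomp Require Import complex.
Set Implicit Arguments.
Unset Strict Implicit.
Unset Printing Implicit Defensive.
Import Order.TTheory GRing.Theory Num.Theory.
Import numFieldNormedType.Exports.
Local Open Scope classical_set_scope.
Local Open Scope ring_scope.
Local Open Scope complex_scope.

Section lebesgue_tuple.
Variable R : realType.
Local Notation RR := (measurableTypeR R).

Definition tcons m (p : RR * m.-tuple RR) : m.+1.-tuple RR :=
  [tuple of p.1 :: p.2].

Fixpoint lebesgue_tuple m : set (m.-tuple RR) -> \bar R :=
  if m is m'.+1 then
    pushforward (product_measure1 (@lebesgue_measure R) (@lebesgue_tuple m'))
      (@tcons m')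
  else \d_([tuple] : 0.-tuple RR).

Lemma measurable_tcons m : measurable_fun setT (@tcons m).
Proof. by apply: measurable_cons. Qed.

Definition tuncons m (t : m.+1.-tuple RR) : RR * m.-tuple RR :=
  (thead t, [tuple of behead t]).

Lemma tconsK m : cancel (@tcons m) (@tuncons m).
Proof. by case=> x s; rewrite /tuncons theadE; congr pair; apply: val_inj. Qed.

Lemma tunconsK m : cancel (@tuncons m) (@tcons m).
Proof. by move=> t; rewrite [RHS]tuple_eta. Qed.

Lemma measurable_tuncons m : measurable_fun setT (@tuncons m).
Proof.
by apply: measurable_fun_pair; [exact: measurable_tnth|exact: measurable_behead].
Qed.

Section step.
Variables (m : nat) (mu : {sigma_finite_measure set (m.-tuple RR) -> \bar R}).

Let step : set (m.+1.-tuple RR) -> \bar R :=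
  pushforward (product_measure1 (@lebesgue_measure R) mu) (@tcons m).

HB.instance Definition _ := Measure.copy step
  (@measure_function_pushforward__canonical__measure_function_Measure
    _ _ _ _ _ (product_measure1 (@lebesgue_measure R) mu) _ (@measurable_tcons m)).

Let step_sigma_finite : sigma_finite setT step.
Proof.
have /sigma_finiteP[F [FT ndF Foo]] := sigma_finiteT (@lebesgue_measure R).
have /sigma_finiteP[G [GT ndG Goo]] := sigma_finiteT mu.
exists (fun i => @tuncons m @^-1` (F i `*` G i)).
  apply/esym; rewrite -subTset => t _.
  have [i _ Fi] : (\bigcup_i F i) (tuncons t).1 by rewrite -FT.
  have [j _ Gj] : (\bigcup_i G i) (tuncons t).2 by rewrite -GT.
  exists (maxn i j) => //; split.
    by move: Fi; exact/subsetPset/ndF/leq_maxl.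
  by move: Gj; exact/subsetPset/ndG/leq_maxr.
move=> i; have [mF Fi] := Foo i; have [mG Gi] := Goo i.
have mFG : measurable (F i `*` G i) by exact: measurableX.
split; first by rewrite -[X in measurable X]setTI; exact: measurable_tuncons.
rewrite /step /pushforward -comp_preimage (_ : _ \o _ = id) ?preimage_id//.
  by rewrite product_measure1E// lte_mul_pinfty// ge0_fin_numE.
by apply/funext => p /=; rewrite tconsK.
Qed.

HB.instance Definition _ :=
  @Measure_isSigmaFinite.Build _ _ _ step step_sigma_finite.

Lemma lebesgue_tuple_step :
  exists nu : {sigma_finite_measure set (m.+1.-tuple RR) -> \bar R},
    nu = pushforward (product_measure1 (@lebesgue_measure R) mu) (@tcons m)
      :> (_ -> _).
Proof. by exists step. Qed.

End step.

Lemma lebesgue_tuple_sigma_finite m :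
  exists mu : {sigma_finite_measure set (m.-tuple RR) -> \bar R},
    mu = @lebesgue_tuple m :> (_ -> _).
Proof.
elim: m => [|m [mu muE]]; first by exists (dirac ([tuple] : 0.-tuple RR)).
by have [nu nuE] := lebesgue_tuple_step mu; exists nu; rewrite nuE muE.
Qed.

Section instances.
Variable m : nat.
Local Notation mu := (@lebesgue_tuple m).

Let mu0 : mu set0 = 0%E.
Proof. by have [nu <-] := lebesgue_tuple_sigma_finite m; exact: measure0. Qed.

Let mu_ge0 A : (0 <= mu A)%E.
Proof. by have [nu <-] := lebesgue_tuple_sigma_finite m; exact: measure_ge0. Qed.

Let mu_sigma_additive : semi_sigma_additive mu.
Proof.
have [nu <-] := lebesgue_tuple_sigma_finite m.
exact: measure_semi_sigma_additive.
Qed.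

HB.instance Definition _ :=
  isMeasure.Build _ _ _ mu mu0 mu_ge0 mu_sigma_additive.

Let mu_sigma_finite : sigma_finite setT mu.
Proof.
by have [nu <-] := lebesgue_tuple_sigma_finite m; exact: sigma_finiteT.
Qed.

HB.instance Definition _ :=
  @Measure_isSigmaFinite.Build _ _ _ mu mu_sigma_finite.
End instances.

End lebesgue_tuple.
Arguments lebesgue_tuple R m : clear implicits.

Section complex_valued.
Variable R : realType.

Definition cexp (w : R[i]) : R[i] :=
  (expR (complex.Re w))%:C * (cos (complex.Im w) +i* sin (complex.Im w)).

Definition cintegrable m (D : set (m.-tuple (measurableTypeR R)))
    (f : m.-tuple (measurableTypeR R) -> R[i]) : Prop :=
  (lebesgue_tuple R m).-integrable D (EFin \o (fun s => complex.Re (f s))) /\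
  (lebesgue_tuple R m).-integrable D (EFin \o (fun s => complex.Im (f s))).

Definition cintegral m (D : set (m.-tuple (measurableTypeR R)))
    (f : m.-tuple (measurableTypeR R) -> R[i]) : R[i] :=
  (\int[lebesgue_tuple R m]_(s in D) complex.Re (f s)) +i*
  (\int[lebesgue_tuple R m]_(s in D) complex.Im (f s)).

End complex_valued.

(* Z_n is 'I_n with [ordS] as h |-> h + 1, which is also right for n = 1
   (whereas 'Z_1 has two elements). *)

Section configurations.
Variables (R : realType) (n : nat).
Local Notation point := (R * 'I_n)%type.

Definition torus : set point := [set y | 0 <= y.1 < 1].

Record configuration := Configuration {
  beads : set point;
  occupied : set point
}.

Definition mod1 (t : R) : R := t - (Num.floor t)%:~R.

(* [u] is the distance from [y] to the first bead met on the next string *)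
Definition is_gap (X : set point) (y : point) (u : R) : Prop :=
  [/\ 0 <= u < 1,
      X (mod1 (y.1 + u), ordS y.2) &
      forall u', 0 <= u' < 1 -> X (mod1 (y.1 + u'), ordS y.2) -> u <= u'].

Definition occupied_by (X : set point) : set point :=
  [set p | exists y u v, [/\ X y, is_gap X y u, 0 <= v < u &
                             p = (mod1 (y.1 + v), ordS y.2)]].

Definition configuration_of_beads (X : set point) : configuration :=
  Configuration X (occupied_by X).

Definition configuration_of_strings (S : {set 'I_n}) : configuration :=
  Configuration set0 [set p | torus p /\ p.2 \in S].

Definition occupation_number_is (c : configuration) (l : nat) : Prop :=
  forall t, 0 <= t < 1 -> #|[pred h : 'I_n | `[< occupied c (t, h) >]]| = l.

Section arrays.
Variable k : nat.

(* a <= b < a <= b < ... *)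
Definition interlaced_le (a b : 'I_k -> R) : Prop :=
  (forall i, a i <= b i) /\
  (forall i j : 'I_k, j = i.+1 :> nat -> b i < a j).

(* b < a <= b < a <= ... *)
Definition interlaced_gt (a b : 'I_k -> R) : Prop :=
  (forall i, b i < a i) /\
  (forall i j : 'I_k, j = i.+1 :> nat -> a i <= b j).

Definition is_bead_array (t : 'I_n -> 'I_k -> R) : Prop :=
  [/\ forall h i, 0 <= t h i < 1,
      forall h (i j : 'I_k), (i < j)%N -> t h i < t h j &
      forall h, interlaced_le (t h) (t (ordS h)) \/
                interlaced_gt (t h) (t (ordS h))].

Definition array_beads (t : 'I_n -> 'I_k -> R) : set point :=
  [set y | exists i, y.1 = t y.2 i].

Definition array_of_tuple (s : (n * k).-tuple R) (h : 'I_n) (i : 'I_k) : R :=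
  tnth s (mxvec_index h i).

Definition configuration_of_tuple (s : (n * k).-tuple R) : configuration :=
  configuration_of_beads (array_beads (array_of_tuple s)).

Definition nkl_configurations (l : nat) :
    set ((n * k).-tuple (measurableTypeR R)) :=
  [set s | is_bead_array (array_of_tuple s) /\
           occupation_number_is (configuration_of_tuple s) l].

End arrays.
End configurations.

(* A signed measure on configurations is given by its integrals: the sum over
   S is the part without beads, and for k >= 1 beads per string the ordered
   bead positions are integrated over subsets of R^(n * k).  Its normalising
   constant is the total mass obtained from the density with Z = 1. *)

Section signed_measure.
Variables (R : realType) (n : nat) (theta : bool * bool) (lambda T : R).

Definition signed_density (Z : R) (k l : nat) : R :=
  T ^+ (n * k) / Z * 2^-1 *
  (-1) ^+ ((theta.1 + k + 1) * (theta.2 + n + l + 1)) *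
  expR (- (lambda * l%:R)).

Definition weighted_integral (Z : R) (F : configuration R n -> R) : R :=
  \sum_(S : {set 'I_n})
     signed_density Z 0 #|S| * F (configuration_of_strings R S) +
  limn (fun N : nat => \sum_(1 <= k < N) \sum_(l < n.+1)
     signed_density Z k l *
     \int[lebesgue_tuple R (n * k)]_(s in @nkl_configurations R n k l)
        F (configuration_of_tuple s)).

Definition partition_function : R := weighted_integral 1 (cst 1).

Definition bead_integral (F : configuration R n -> R) : R :=
  weighted_integral partition_function F.

(* F is integrable with respect to the total variation of the signed measure,
   so that [bead_integral F] is an absolutely convergent series of integrals *)
Definition bead_integrable (F : configuration R n -> R) : Prop :=
  (forall k l, (0 < k)%N ->
     (lebesgue_tuple R (n * k)).-integrable (@nkl_configurations R n k l)
       (fun s => (F (configuration_of_tuple s))%:E)) /\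
  (\sum_(1 <= k <oo) \sum_(l < n.+1)
     `|signed_density partition_function k l|%:E *
     \int[lebesgue_tuple R (n * k)]_(s in @nkl_configurations R n k l)
        `|F (configuration_of_tuple s)|%:E < +oo)%E.

End signed_measure.

Section kernels.
Variables (R : realType) (n : nat) (theta : bool * bool) (lambda T : R).
Local Notation point := (R * 'I_n)%type.

Definition twisted_roots : set R[i] := [set z | z ^+ n = (-1) ^+ theta.2].

Definition cyclic_dist (t t' : R) : R := t' - t + (t' < t)%R%:R.

Definition exponent (z : R[i]) : R[i] :=
  (lambda +i* (theta.1%:R * pi)) + T%:C * z.

(* the exponent of z is a difference of two integers, each in {0, ..., n-1};
   it is not reduced mod n *)
Definition Hker (y y' : point) : R[i] :=
  (T / n%:R)%:C * \sum_(z \in twisted_roots)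
    z ^ (1 + (y.2 : nat)%:Z - (y'.2 : nat)%:Z) *
    (cexp (- (exponent z * (cyclic_dist y.1 y'.1)%:C)) / (1 - cexp (- exponent z))).

Definition Kker (y y' : point) : R[i] :=
  - (n%:R^-1)%:C * \sum_(z \in twisted_roots)
    (z ^ ((y.2 : nat)%:Z - (y'.2 : nat)%:Z) *
     cexp (- (exponent z * (cyclic_dist y.1 y'.1 + (y'.1 == y.1)%:R)%:C)) /
     (1 - cexp (- exponent z))).

Definition Kstar (O U B : finType) (x : O + U + B -> point) (i j : O + U + B) :
    R[i] :=
  match i with
  | inl (inl _) => Kker (x i) (x j)
  | inl (inr _) => (i == j)%:R - Kker (x i) (x j)
  | inr _ => Hker (x i) (x j)
  end.

Definition det_Kstar (O U B : finType) (x : O + U + B -> point) : R[i] :=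
  \det (\matrix_(i < #|{: O + U + B}|, j < #|{: O + U + B}|)
          Kstar x (enum_val i) (enum_val j)).

End kernels.

(* The points x indexed by O + U and the strings h are fixed; the times of the
   points indexed by B form a tuple s, the variable of the density. *)

Section event.
Variables (R : realType) (n : nat) (O U B : finType).
Variables (x : O + U -> R * 'I_n) (h : B -> 'I_n).

Definition bead_points (s : #|B|.-tuple R) (b : B) : R * 'I_n :=
  (tnth s (enum_rank b), h b).

Definition all_points (s : #|B|.-tuple R) (i : O + U + B) : R * 'I_n :=
  match i with
  | inl j => x j
  | inr b => bead_points s b
  end.

Definition bead_families (A : set (#|B|.-tuple R)) (c : configuration R n) :
    set (#|B|.-tuple R) :=
  [set s | [/\ A s, forall b, beads c (bead_points s b) &
               injective (bead_points s)]].

Definition occupation_event (c : configuration R n) : Prop :=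
  (forall o, occupied c (x (inl o))) /\ (forall u, ~ occupied c (x (inr u))).

Definition event_count (A : set (#|B|.-tuple R)) (c : configuration R n) : R :=
  #|` fset_set (bead_families A c)|%:R * `[< occupation_event c >]%:R.

End event.

Definition unit_cube (R : realType) m : set (m.-tuple (measurableTypeR R)) :=
  [set s | forall i, 0 <= tnth s i < 1].

(* Main.v *)
(* Read time as the direction of evolution and the holes (unoccupied strings) as
   free fermions: a bead moves a hole from string h+1 to string h, so that
   bead configurations on N = nk beads are closed words of hole moves.  Summing
   over the words turns the weight into T^N/N! times the trace of the N-th power
   of a bead operator on antisymmetric tensors; observing beads or occupations
   at given times inserts one-site operators.  The series over N sums to a trace
   of exponentials in Fock space, which is a determinant: with U(t) = exp(tT M),
   M the twisted shift, the trace is det(q + U(1)) times a determinant of the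
   size of the number of insertions, whose entries come from the resolvent
   (q + U(1))^-1.  Diagonalising M by the roots of z^n = (-1)^theta2 gives the
   kernels H and K, up to a gauge factor and the tie-breaking at equal times. *)
Require Import Defs.
From mathcomp Require Import all_boot all_order all_algebra finmap.
From mathcomp Require Import fingroup perm separable.
From mathcomp Require Import all_classical all_reals all_analysis.
From mathcomp Require Import measurable_realfun.
From mathcomp Require Import ring lra zify.
From mathcomp Require Import complex.
Import Order.TTheory GRing.Theory Num.Theory.
Import numFieldNormedType.Exports.
Set Implicit Arguments.
Unset Strict Implicit.
Unset Printing Implicit Defensive.
Local Open Scope classical_set_scope.
Local Open Scope ring_scope.
Local Open Scope complex_scope.


(** The sign of the density is what permits a fermionic trace. For [l < n] it splits into a
    constant, a weight per occupied string and, for each bead on the last string, the twist times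
    the sign of the cyclic rotation of the [n - l] holes. Antisymmetric tensors produce this
    rotation sign when a hole crosses the cut between strings [n - 1] and [0]. Time integrals are
    not iterated over simplices. In an eigenbasis of the bead operator a path collects the integral
    [x] of its eigenvalue and is weighted by [phi x]. One more bead, at any time and on any string,
    multiplies [phi x] by [x]. So [r] free beads with unordered times give [x ^ r], and the weights
    [T^r / r!] give [exp (T x)], which factors into propagators. On antisymmetric tensors the
    operator that adds a one-site term to the identity is a tensor power. Beads and unoccupied
    observations lack the identity term; they are reached because trace and determinant are both
    affine in each insertion. Ties are the remaining obstacle: those involving a bead form a null
    set, while tied observations leave the occupation unchanged and account for the terms
    [delta_ij]. *)

Lemma det_mxsub_bij (K : comPzRingType) (a b : nat) (g : 'I_a -> 'I_b)
    (A : 'M[K]_b) : bijective g -> \det (mxsub g g A) = \det A.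
Proof.
move=> bg; have eab : a = b by rewrite -(card_ord a) -(card_ord b) (bij_eq_card bg).
case: b / eab g bg A => g bg A.
have [s sE] : exists s : 'S_a, g =1 s.
  by exists (perm (bij_inj bg)) => i; rewrite permE.
have -> : mxsub g g A = mxsub s s A by exact: eq_mxsub.
rewrite mxsubrc -col_permEsub -row_permEsub.
by rewrite col_permE row_permE !det_mulmx !det_perm odd_permV mulrCA -signr_addb addbb mulr1.
Qed.

(** * Determinants as sums of principal minors *)

Section ExtendedMinors.
Variables (K : comPzRingType) (n : nat).

(** Listing the indices of [S] first makes the matrix block upper triangular, with the minor of [X]
    and the scalar [q] as diagonal blocks. *)
Lemma det_id_rows (q : K) (X : 'M[K]_n) (S : {set 'I_n}) :
  \det (\matrix_(i, j) if i \in S then X i j else q *+ (i == j)) =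
  q ^+ #|~: S| * \det (mxsub (@enum_val _ (mem S)) (@enum_val _ (mem S)) X).
Proof.
pose g (i : 'I_(#|S| + #|~: S|)) : 'I_n :=
  match fintype.split i with
  | inl a => enum_val a
  | inr b => enum_val b
  end.
have bg : bijective g.
  apply: inj_card_bij; last by rewrite !card_ord cardsC card_ord.
  move=> i j; rewrite /g => E; apply: (can_inj (@splitK _ _)); move: E.
  case: (fintype.split i) => a; case: (fintype.split j) => b /= E.
  - by rewrite (enum_val_inj E).
  - by have := enum_valP b; rewrite -E inE enum_valP.
  - by have := enum_valP a; rewrite E inE enum_valP.
  - by rewrite (enum_val_inj E).
rewrite -(det_mxsub_bij _ bg); set Y := mxsub _ _ _.
rewrite -[Y]submxK.
have -> : dlsubmx Y = 0.
  apply/matrixP => i j; rewrite !mxE /g.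
  rewrite (unsplitK (inr i)) (unsplitK (inl j)).
  have := enum_valP i; rewrite inE => /negPf ->.
  case: eqP => // E; have := enum_valP i; rewrite E inE.
  by rewrite enum_valP.
rewrite det_ublock mulrC; congr (_ * _); last first.
  congr (\det _); apply/matrixP => i j; rewrite !mxE /g.
  by rewrite (unsplitK (inl i)) (unsplitK (inl j)) enum_valP.
rewrite -det_scalar; congr (\det _); apply/matrixP => i j; rewrite !mxE /g.
rewrite (unsplitK (inr i)) (unsplitK (inr j)).
have := enum_valP i; rewrite inE => /negPf ->.
by rewrite (inj_eq enum_val_inj).
Qed.

(** Multilinearity in the rows sums over the set [S] of rows taken from [X]. Read as a trace over
    Fock space: [S] is the set of sites holding a fermion, the minors of size [m] add up to the
    trace of the [m]-th exterior power of [X], and [q] weighs the sites without fermion. *)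
Lemma det_scalar_add (q : K) (X : 'M[K]_n) :
  \det (q%:M + X) = \sum_(S : {set 'I_n}) q ^+ #|~: S| *
    \det (mxsub (@enum_val _ (mem S)) (@enum_val _ (mem S)) X).
Proof.
under [RHS]eq_bigr do rewrite -det_id_rows.
rewrite /determinant exchange_big /=; apply: eq_bigr => s _.
rewrite -mulr_sumr; congr (_ * _).
under eq_bigr do rewrite !mxE addrC.
rewrite bigA_distr; apply: eq_big => [S|S _]; first by rewrite inE.
apply: eq_bigr => i _.
by rewrite mxE; case: ifP.
Qed.
End ExtendedMinors.

(** * Kernels on finite sets and tensor powers *)

Section Kernels.
Variables (K : comPzRingType) (I : finType).
Implicit Types A B C : I -> I -> K.

Definition kmul A B (i j : I) : K := \sum_k A i k * B k j.
Definition kid (i j : I) : K := (i == j)%:R.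
Definition kaffine (a b : K) A (i j : I) : K := a * kid i j + b * A i j.
Definition kdiag (d : I -> K) (i j : I) : K := d i * kid i j.

Lemma kmulA A B C i j : kmul A (kmul B C) i j = kmul (kmul A B) C i j.
Proof.
rewrite /kmul; under eq_bigr do rewrite mulr_sumr.
rewrite exchange_big; apply: eq_bigr => l _ /=; rewrite mulr_suml.
by apply: eq_bigr => k _; rewrite mulrA.
Qed.

Lemma eq_kmul A A' B B' : A =2 A' -> B =2 B' -> kmul A B =2 kmul A' B'.
Proof. by move=> eA eB i j; apply: eq_bigr => k _; rewrite eA eB. Qed.

Lemma kmul_diag_l d B i j : kmul (kdiag d) B i j = d i * B i j.
Proof.
rewrite /kmul (bigD1 i) //= big1 => [|k /negPf ki].
  by rewrite /kdiag /kid eqxx mulr1 addr0.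
by rewrite /kdiag /kid eq_sym ki mulr0 mul0r.
Qed.

Lemma kmul_diag_r d B i j : kmul B (kdiag d) i j = B i j * d j.
Proof.
rewrite /kmul (bigD1 j) //= big1 => [|k /negPf kj].
  by rewrite /kdiag /kid eqxx mulr1 addr0.
by rewrite /kdiag /kid kj !mulr0.
Qed.

Lemma kmul1k B : kmul kid B =2 B.
Proof.
move=> i j; rewrite -[RHS]mul1r -(kmul_diag_l (fun=> 1)).
by apply: eq_kmul => // k l; rewrite /kdiag mul1r.
Qed.

Lemma kmulk1 B : kmul B kid =2 B.
Proof.
move=> i j; rewrite -[RHS]mulr1 -(kmul_diag_r (fun=> 1)).
by apply: eq_kmul => // k l; rewrite /kdiag mul1r.
Qed.

Lemma kmul_affine_l a b A B i j :
  kmul (kaffine a b A) B i j = a * B i j + b * kmul A B i j.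
Proof.
rewrite -{1}(kmul1k B i j) /kmul !mulr_sumr -big_split /=.
by apply: eq_bigr => k _; rewrite mulrDl !mulrA.
Qed.

Lemma kmul_affine_r a b A B i j :
  kmul B (kaffine a b A) i j = a * B i j + b * kmul B A i j.
Proof.
rewrite -{1}(kmulk1 B i j) /kmul !mulr_sumr -big_split /=.
by apply: eq_bigr => k _; rewrite mulrDr !(mulrCA (B i k)).
Qed.

Lemma kmul_linear_r a A B C D i j : (forall k l, D k l = a * B k l + C k l) ->
  kmul A D i j = a * kmul A B i j + kmul A C i j.
Proof.
move=> DE; rewrite /kmul mulr_sumr -big_split; apply: eq_bigr => k _ /=.
by rewrite DE mulrDr mulrCA.
Qed.

End Kernels.

Section Tensors.
Variables (K : comPzRingType) (n m : nat).
Local Notation I := {ffun 'I_m -> 'I_n}.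
Implicit Types (X Y : 'M[K]_n).

Definition tens (X : 'I_m -> 'M[K]_n) (f g : I) : K := \prod_i X i (f i) (g i).
Definition tpow X : I -> I -> K := tens (fun=> X).
(** The derivation of the tensor power induced by [X], that is the derivative at [s = 0] of the
    tensor power of [1 + s X]: the second quantisation of a one-particle operator. *)
Definition dtpow X (f g : I) : K :=
  \sum_i tens (fun j => if j == i then X else 1%:M) f g.
(* the antisymmetriser of the m-th tensor power, times m! *)
Definition asym (f g : I) : K := \det (\matrix_(i, j) (f i == g j)%:R).

Lemma tensM (X Y : 'I_m -> 'M[K]_n) f g :
  kmul (tens X) (tens Y) f g = tens (fun i => X i *m Y i) f g.
Proof.
rewrite /kmul /tens; under [RHS]eq_bigr do rewrite mxE.
by rewrite bigA_distr_bigA; apply: eq_bigr => k _; rewrite -big_split.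
Qed.

Lemma tens1 f g : tens (fun=> 1%:M) f g = kid K f g.
Proof.
rewrite /tens /kid; case: (f =P g) => [->|/eqP fg].
  by rewrite big1 // => i _; rewrite mxE eqxx.
have [i /negPf fgi] : exists i, f i != g i.
  by apply/existsP; apply: contraNT fg; rewrite negb_exists => /forallP fg;
     apply/eqP/ffunP => i; apply/eqP; rewrite -[_ == _]negbK fg.
by rewrite (bigD1 i) //= mxE fgi mul0r.
Qed.

(** The antisymmetriser is a signed sum of permutation operators; composed with a tensor power it
    becomes the Leibniz expansion of a determinant. *)
Lemma asym_tpow X f g : kmul asym (tpow X) f g = \det (mxsub f g X).
Proof.
rewrite /kmul -det_tr /determinant.
under eq_bigr => k _ do rewrite /asym -det_tr /determinant mulr_suml.
rewrite exchange_big /=; apply: eq_bigr => s _.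
under [X in _ = _ * X]eq_bigr do rewrite !mxE.
under eq_bigr do rewrite -mulrA.
rewrite -mulr_sumr; congr (_ * _).
pose F (i : 'I_m) := f (s i).
transitivity (kmul (tens (fun=> 1%:M)) (tpow X) [ffun i => F i] g).
  apply: eq_bigr => k _; congr (_ * _); apply: eq_bigr => i _.
  by rewrite !mxE ffunE.
rewrite (eq_kmul (B' := tpow X) tens1) // kmul1k.
by apply: eq_bigr => i _; rewrite ffunE.
Qed.

Lemma tpow_asym X f g : kmul (tpow X) asym f g = \det (mxsub f g X).
Proof.
rewrite /kmul /determinant.
under eq_bigr => k _ do rewrite /asym /determinant mulr_sumr.
rewrite exchange_big /=; apply: eq_bigr => s _.
under [X in _ = _ * X]eq_bigr do rewrite !mxE.
under eq_bigr do rewrite mulrCA.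
rewrite -mulr_sumr; congr (_ * _).
transitivity (kmul (tpow X) (tens (fun=> 1%:M)) f [ffun i => g (s i)]).
  apply: eq_bigr => k _; congr (_ * _); apply: eq_bigr => i _.
  by rewrite !mxE ffunE.
rewrite (eq_kmul (A' := tpow X) (fun _ _ => erefl) tens1) kmulk1.
by apply: eq_bigr => i _; rewrite ffunE.
Qed.

Lemma asym_tpowC X : kmul asym (tpow X) =2 kmul (tpow X) asym.
Proof. by move=> f g; rewrite asym_tpow tpow_asym. Qed.

Lemma asym_perm_sum (f g : I) :
  asym f g = \sum_(s : 'S_m) (-1) ^+ s * kid K f [ffun i => g (s i)].
Proof.
apply: eq_bigr => s _; congr (_ * _); rewrite -tens1.
by apply: eq_bigr => i _; rewrite !mxE ffunE.
Qed.

(** Permuting the tensor factors on either side only relabels the factor on which [X] acts. *)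
Lemma asym_dtpowC X : kmul asym (dtpow X) =2 kmul (dtpow X) asym.
Proof.
move=> f g; rewrite /kmul.
transitivity (\sum_(s : 'S_m) (-1) ^+ s * dtpow X [ffun i => f (s^-1 i)%g] g).
  under eq_bigr do rewrite asym_perm_sum mulr_suml.
  rewrite exchange_big /=; apply: eq_bigr => s _.
  under eq_bigr do rewrite -mulrA.
  rewrite -mulr_sumr; congr (_ * _).
  rewrite -[RHS]kmul1k; apply: eq_bigr => k _; congr ((nat_of_bool _)%:R * _).
  apply/eqP/eqP => [->|<-]; apply/ffunP => i; rewrite !ffunE.
    by rewrite permKV.
  by rewrite permK.
transitivity (\sum_(s : 'S_m) (-1) ^+ s * dtpow X f [ffun i => g (s i)%g]).
  apply: eq_bigr => s _; congr (_ * _); rewrite /dtpow.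
  rewrite (reindex_inj (@perm_inj _ s)) /=; apply: eq_bigr => i _.
  rewrite /tens (reindex_inj (@perm_inj _ s)) /=; apply: eq_bigr => j _.
  by rewrite !ffunE permK (inj_eq perm_inj).
symmetry; under eq_bigr do rewrite asym_perm_sum mulr_sumr.
rewrite exchange_big /=; apply: eq_bigr => s _.
under eq_bigr do rewrite mulrCA.
by rewrite -mulr_sumr -/(kmul (dtpow X) (@kid K _) f _) kmulk1.
Qed.

Definition upd (f : I) (i : 'I_m) (b : 'I_n) : I :=
  [ffun j => if j == i then b else f j].

Lemma dtpow_delta (c : K) (a b : 'I_n) (B : I -> I -> K) f g :
  kmul (dtpow (c *: delta_mx a b)) B f g =
  \sum_(i | f i == a) c * B (upd f i b) g.
Proof.
rewrite /kmul; under eq_bigr do rewrite mulr_suml.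
rewrite exchange_big /= [RHS]big_mkcond; apply: eq_bigr => i _.
rewrite (bigD1 (upd f i b)) //= big1 => [|k kf]; last first.
  have [j /negPf kj] : exists j, k j != upd f i b j.
    by apply/existsP; apply: contraNT kf; rewrite negb_exists => /forallP kf;
       apply/eqP/ffunP => j; apply/eqP; rewrite -[_ == _]negbK kf.
  rewrite /tens (bigD1 j) //=; move: kj; rewrite ffunE.
  by case: (j =P i) => [->|_] kj; rewrite !mxE ?kj ?(eq_sym (f j)) ?kj ?andbF ?mulr0 ?mul0r.
rewrite addr0 /tens (bigD1 i) //= eqxx !mxE ffunE !eqxx andbT big1.
  by case: ifP => _; rewrite ?mulr1 // mulr0 !mul0r.
by move=> j /negPf ji; rewrite ji !mxE ffunE ji eqxx.
Qed.

Lemma asym_noninj (f g : I) : ~~ injectiveb f -> asym f g = 0.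
Proof.
case/injectivePn=> i [j ij fij]; apply: (determinant_alternate ij) => k.
by rewrite !mxE fij.
Qed.

(** At most one entry of an injective [f] equals [a], so adding [c] times a matrix unit changes at
    most one row of the determinant and the expansion stops at first order. This turns an insertion
    into a tensor power, whose traces are determinants. *)
Lemma asym_tpow_delta (c : K) (a b : 'I_n) (f g : I) :
  kmul asym (tpow (1%:M + c *: delta_mx a b)) f g =
  kmul asym (kaffine 1 1 (dtpow (c *: delta_mx a b))) f g.
Proof.
have [/injectiveP injf|ninj] := boolP (injectiveb f); last first.
  by rewrite /kmul !big1 // => k _; rewrite (asym_noninj _ ninj) mul0r.
rewrite asym_tpow kmul_affine_r !mul1r asym_dtpowC dtpow_delta.
case: (pickP (fun i => f i == a)) => [i0 /eqP fi0|nofa]; last first.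
  rewrite big_pred0 ?addr0 //; congr (\det _); apply/matrixP => i j.
  by rewrite !mxE nofa mulr0 addr0.
rewrite (big_pred1 i0) => [|i]; last by rewrite -fi0 (inj_eq injf).
have El i : (lift i0 i == i0) = false by rewrite eq_sym (negPf (neq_lift _ _)).
have Ea i : (f (lift i0 i) == a) = false by rewrite -fi0 (inj_eq injf) El.
rewrite -[X in _ = X + _]mul1r /asym; apply: (@determinant_multilinear _ _ _ _ _ i0).
- apply/rowP => j; rewrite !mxE ffunE eqxx fi0 eqxx /= mul1r.
  by rewrite (eq_sym (g j)).
- by apply/matrixP => i j; rewrite !mxE Ea mulr0 addr0.
- by apply/matrixP => i j; rewrite !mxE ffunE El Ea mulr0 addr0.
Qed.
End Tensors.

(* [inl (inl h)], [inl (inr h)] and [inr h]: string [h] is observed occupied,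
   observed unoccupied, or carries a bead *)
Definition event n : Type := ('I_n + 'I_n + 'I_n)%type.

(** * Words of events and the moves of holes *)

Section Events.
Variable n : nat.
Implicit Types (c : 'I_n -> int) (e : event n) (L : seq (event n)).

Definition advance c e : 'I_n -> int :=
  if e is inr h then fun g => c g + (g == ordS h)%:Z - (g == h)%:Z else c.

(* [c] is the occupation; [advance c e h = 0] asks that string [h] is left
   empty by the bead, which for [n = 1] is the emptiness of the only string *)
Definition admissible c e : bool :=
  match e with
  | inl (inl h) => c h == 1
  | inl (inr h) => c h == 0
  | inr h => (c (ordS h) == 0) && (advance c e h == 0)
  end.

Fixpoint admissible_path c L : bool :=
  if L is e :: L' then admissible c e && admissible_path (advance c e) L'
  else true.

Definition occupation_after c L := foldl advance c L.

(** A bead on the last string moves a hole from string [0] to string [n - 1], across the cut of the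
    cyclic order. *)
Definition wraps L : nat :=
  count (fun e => if e is inr h then h.+1 == n else false) L.

Definition occupation_of (S : {set 'I_n}) (h : 'I_n) : int := (h \notin S)%:Z.

Definition path_closed c L : bool :=
  admissible_path c L && [forall h, occupation_after c L h == c h].

Section Weight.
Variable K : comPzRingType.

(** [S] is the set of holes at time [0], and [q] weighs the occupied strings. A hole that crosses
    the cut turns from the first into the last of the [#|S|] holes: this costs the sign
    [(-1)^(#|S| - 1)] of a cyclic rotation, besides the boundary twist [eps]. *)
Definition config_weight (q eps : K) L : K :=
  \sum_(S : {set 'I_n}) q ^+ #|~: S| *
    (if path_closed (occupation_of S) L
     then ((-1) ^+ #|S|.-1 * eps) ^+ wraps L else 0).
End Weight.
End Events.

Lemma rotation_perm (K : pzRingType) (m : nat) :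
  exists2 s : 'S_m, forall i, s i = ordS i & (-1) ^+ s = (-1) ^+ m.-1 :> K.
Proof.
case: m => [|m]; first by exists 1%g => [[]//|]; rewrite odd_perm1.
(* The rotation sends the last index to [0] and keeps the order of the others, hence is a lift of
   the identity. *)
exists (lift_perm ord_max ord0 1%g) => [i|]; last first.
  by rewrite odd_lift_perm odd_perm1 /= addbF addbF signr_odd.
have [im|im] := ltnP i m; last first.
  have -> : i = ord_max by apply/ord_inj/eqP; rewrite eqn_leq im -ltnS ltn_ord.
  by rewrite lift_perm_id; apply: val_inj; rewrite /= modnn.
have -> : i = lift ord_max (Ordinal im).
  by apply: val_inj; rewrite /= /bump leqNgt im.
rewrite lift_perm_lift perm1; apply: val_inj.
by rewrite /= /bump /= leqNgt im /= modn_small.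
Qed.

Section EventOperators.
Variables (K : comPzRingType) (n m : nat) (eps : K).
Local Notation I := {ffun 'I_m -> 'I_n}.
Implicit Types (c : 'I_n -> int) (e : event n) (L : seq (event n)) (f g : I).

Definition twist (h : 'I_n) : K := if h.+1 == n then eps else 1.

(** Operators act on holes. With [N_h] the derivation induced by [delta_mx h h], which counts the
    holes on string [h], unoccupied is [N_h] and occupied is [1 - N_h]; hence the coefficient [-1]
    here and the constant [1] in [ev_const]. The row index is the position before the event, the
    column index the position after it. *)
Definition ev_mx e : 'M[K]_n :=
  match e with
  | inl (inl h) => -1 *: delta_mx h h
  | inl (inr h) => 1 *: delta_mx h h
  | inr h => twist h *: delta_mx (ordS h) h
  end.

Definition ev_const e : K := if e is inl (inl _) then 1 else 0.

Definition ev_op e : I -> I -> K :=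
  kaffine (ev_const e) 1 (@dtpow K n m (ev_mx e)).

Definition ev_prod L : I -> I -> K :=
  foldr (fun e => kmul (ev_op e)) (@kid K _) L.

Lemma asym_ev_op e : kmul (@asym K n m) (ev_op e) =2 kmul (ev_op e) (@asym K n m).
Proof.
by move=> f g; rewrite kmul_affine_l kmul_affine_r asym_dtpowC.
Qed.

Lemma asym_ev_prod_cons e L f g :
  kmul (@asym K n m) (ev_prod (e :: L)) f g =
  kmul (ev_op e) (kmul (@asym K n m) (ev_prod L)) f g.
Proof.
by rewrite /= !kmulA; apply: eq_kmul => // i j; rewrite asym_ev_op.
Qed.

(** Increasing tuples are canonical representatives of sets of holes, one for each basis vector of
    the antisymmetric tensors. *)
Definition increasing f := forall i j : 'I_m, (i < j)%N -> (f i < f j)%N.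

Definition occupation_off f (h : 'I_n) : int := (h \notin codom f)%:Z.

Lemma increasing_inj f : increasing f -> injective f.
Proof.
move=> incf i j fij; case: (ltngtP (i : nat) (j : nat)) => [ij|ji|/ord_inj //].
  by move: (incf _ _ ij); rewrite fij ltnn.
by move: (incf _ _ ji); rewrite fij ltnn.
Qed.

Lemma increasing_codom f g : increasing f -> increasing g ->
  codom f =i codom g -> f = g.
Proof.
move=> incf incg fg; apply/ffunP => i.
have sorted_codom k : increasing k -> sorted ltn (map val (codom k)).
  move=> inck; rewrite codomE -map_comp sorted_map.
  have : sorted ltn (map val (enum 'I_m)) by rewrite val_enum_ord iota_ltn_sorted.
  by rewrite sorted_map; apply: sub_sorted => a b; apply: inck.
have /(inj_map val_inj) : map val (codom f) = map val (codom g).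
  apply: (irr_sorted_eq ltn_trans ltnn) => [||x]; [exact: sorted_codom..|].
  by apply/mapP/mapP => -[y yf ->]; exists y; rewrite // ?fg // -fg.
by rewrite !codomE => /eq_in_map; apply; rewrite mem_enum.
Qed.

Lemma asym_noninj_row f g (B : I -> I -> K) :
  ~~ injectiveb f -> kmul (@asym K n m) B f g = 0.
Proof.
by move=> ninj; rewrite /kmul big1 // => k _; rewrite asym_noninj // mul0r.
Qed.

Lemma asym_perm (s : 'S_m) f g :
  asym K [ffun i => f (s i)] g = (-1) ^+ s * asym K f g.
Proof.
rewrite /asym -det_perm -det_mulmx -row_permE; congr (\det _).
by apply/matrixP => i j; rewrite !mxE ffunE.
Qed.

(** Away from the cut, a hole stepping from [h + 1] to the free string [h] keeps its rank, and the
    tuple stays increasing. At the cut the hole comes from string [0], so it had rank [0], and it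
    becomes the last one; sorting the tuple again is a rotation. The case [h = ordS h] is [n = 1],
    where the hole moves onto its own string. *)
Lemma bead_move f (h : 'I_n) i0 : increasing f -> f i0 = ordS h ->
    (h = ordS h \/ h \notin codom f) ->
  exists f', [/\ increasing f',
    forall k : 'I_n, occupation_off f' k = advance (occupation_off f) (inr h) k &
    forall (B : I -> I -> K) g, twist h * kmul (@asym K n m) B (upd f i0 h) g =
      ((-1) ^+ m.-1 * eps) ^+ (h.+1 == n) * kmul (@asym K n m) B f' g].
Proof.
move=> incf fi0 hcase; have injf := increasing_inj incf.
have occ_upd (g : 'I_n) : occupation_off (upd f i0 h) g = advance (occupation_off f) (inr h) g.
  rewrite /= /occupation_off.
  have memu : (g \in codom (upd f i0 h)) = (g == h) || (g != ordS h) && (g \in codom f).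
    apply/codomP/idP => [[j ->]|].
      rewrite ffunE; case: (j =P i0) => [_|/eqP ji]; first by rewrite eqxx.
      by rewrite codom_f andbT -fi0 (inj_eq injf) ji orbT.
    case/orP => [/eqP ->|/andP[gS /codomP[j gj]]].
      by exists i0; rewrite ffunE eqxx.
    exists j; rewrite ffunE; case: (j =P i0) => // ji.
    by move: gS; rewrite gj ji fi0 eqxx.
  rewrite memu negb_or negb_and negbK.
  have memS : ordS h \in codom f by rewrite -fi0 codom_f.
  case: hcase => [hS|hnf].
    rewrite -hS in memS *; case: (g =P h) => [->|/= _]; last by rewrite addr0 subr0.
    by rewrite /= memS /= addrK.
  case: (g =P h) => [->|/= _].
    have /negPf -> : h != ordS h by apply: contraNneq hnf => ->.
    by rewrite hnf.
  case: (g =P ordS h) => [->|/= _]; first by rewrite memS.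
  by rewrite addr0 subr0.
have [hn|hn] := eqVneq h.+1 n; last first.
  have Sh : ordS h = h.+1 :> nat.
    by rewrite /= modn_small // ltn_neqAle hn ltn_ord.
  have hnf : h \notin codom f.
    by case: hcase => // /(congr1 val) /= E; move: Sh; rewrite /= -E => /n_Sn.
  exists (upd f i0 h); split=> [i j ij|//|B g]; last first.
    by rewrite /twist (negPf hn) expr0.
  have fne k : f k != h by apply: contraNneq hnf => <-; rewrite codom_f.
  rewrite !ffunE; case: (i =P i0) => [ii|_]; case: (j =P i0) => [jj|_].
  - by move: ij; rewrite ii jj ltnn.
  - by rewrite (leq_trans _ (ltnW (incf _ _ ij))) // ii fi0 Sh.
  - have := incf _ _ ij; rewrite jj fi0 Sh ltnS leq_eqVlt.
    by have /negPf := fne i; rewrite -val_eqE => ->.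
  - exact: incf.
have S0 : ordS h = 0%N :> nat by rewrite /= hn modnn.
have [s sS sgn_s] := rotation_perm K m.
have i00 : i0 = 0%N :> nat.
  apply/eqP; rewrite eqn_leq leq0n andbT leqNgt; apply/negP => i0p.
  have m0 : (0 < m)%N by apply: leq_trans (ltn_ord i0).
  by have := incf (Ordinal m0) i0 i0p; rewrite fi0 S0.
have s_lt (i j : 'I_m) : (i < j)%N -> s i = i.+1 :> nat.
  by move=> ij; rewrite sS /= modn_small // (leq_ltn_trans ij).
(* The rotation drops the first hole and appends the last string [h = n - 1] at the end. *)
exists [ffun i => upd f i0 h (s i)]; split.
- move=> i j ij.
  have sii : s i != i0 by rewrite -val_eqE /= (s_lt _ _ ij) i00.
  rewrite !ffunE (negPf sii); case: (s j =P i0) => [_|sj].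
    rewrite ltn_neqAle -ltnS hn ltn_ord andbT val_eqE.
    case: hcase => [hS|hnf]; last by apply: contraNneq hnf => <-; rewrite codom_f.
    by rewrite hS -fi0 (inj_eq injf).
  have [jm|jm] := ltnP j.+1 m; last first.
    have jE : j.+1 = m by apply/eqP; rewrite eqn_leq jm ltn_ord.
    exfalso; apply: sj; apply: ord_inj; rewrite sS i00 /=.
    by rewrite jE modnn.
  apply: incf; rewrite (s_lt _ _ ij) sS /= modn_small //.
- move=> g; rewrite -occ_upd /occupation_off; congr ((~~ _)%:Z).
  apply/codomP/codomP => -[j ->]; first by exists (s j); rewrite [LHS]ffunE.
  by exists (s^-1 j)%g; rewrite [RHS]ffunE permKV.
- move=> B g; rewrite expr1 /twist hn eqxx (mulrC (_ ^+ _)) -mulrA; congr (_ * _).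
  rewrite /kmul mulr_sumr; apply: eq_bigr => k _; rewrite mulrA asym_perm mulrA.
  by rewrite sgn_s -exprD addnn -mul2n exprM sqrrN expr1n expr1n mul1r.
Qed.

Lemma observe_codom x f h (B : I -> I -> K) g : injective f ->
  kmul (@dtpow K n m (x *: delta_mx h h)) B f g = (h \in codom f)%:R * (x * B f g).
Proof.
move=> injf; rewrite dtpow_delta.
have [/codomP[i0 hE]|hf] := boolP (h \in codom f); last first.
  rewrite big_pred0 ?mul0r // => i; apply/negP => /eqP E.
  by move: hf; rewrite -E codom_f.
rewrite (big_pred1 i0) => [|i]; last by rewrite hE (inj_eq injf).
rewrite mul1r; congr (_ * B _ _); apply/ffunP => j; rewrite ffunE; case: (j =P i0) => // ->.
by rewrite hE.
Qed.

(** The antisymmetriser commutes with the event operators, so the first event may act on the row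
    index [f]. A bead that would move a hole onto another hole repeats an entry and is
    antisymmetrised to zero; a failed observation has coefficient zero. Otherwise a single
    increasing tuple results, with one sign per wrap. *)
Lemma ev_prod_path L f c : increasing f -> c =1 occupation_off f ->
  if admissible_path c L then
    exists f', [/\ increasing f', occupation_after c L =1 occupation_off f' &
      forall g, kmul (@asym K n m) (ev_prod L) f g =
        ((-1) ^+ m.-1 * eps) ^+ wraps L * asym K f' g]
  else forall g, kmul (@asym K n m) (ev_prod L) f g = 0.
Proof.
elim: L f c => [|e L IH] f c incf cf; rewrite [admissible_path _ _]/=.
  by exists f; split => // g; rewrite expr0 mul1r kmulk1.
have injf := increasing_inj incf.
case: e => [[h|h]|h].
- rewrite [admissible _ _]/= cf /occupation_off.
  have := IH _ _ incf cf.
  have E g : kmul (@asym K n m) (ev_prod (inl (inl h) :: L)) f g =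
      (h \notin codom f)%:R * kmul (@asym K n m) (ev_prod L) f g.
    rewrite asym_ev_prod_cons kmul_affine_l observe_codom // mul1r.
    by case: (h \in _); rewrite ?mul1r ?mulN1r ?subrr ?mul0r ?addr0.
  have [hf|hf] /= := boolP (h \in codom f).
    by move=> _ g; rewrite E hf mul0r.
  case: ifP => _ => [[f' [? ? Ef']]|Ef'].
    by exists f'; split => // g; rewrite E hf mul1r Ef'.
  by move=> g; rewrite E Ef' mulr0.
- rewrite [admissible _ _]/= cf /occupation_off.
  have := IH _ _ incf cf.
  have E g : kmul (@asym K n m) (ev_prod (inl (inr h) :: L)) f g =
      (h \in codom f)%:R * kmul (@asym K n m) (ev_prod L) f g.
    rewrite asym_ev_prod_cons kmul_affine_l observe_codom // mul0r add0r.
    by rewrite !mul1r.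
  have [hf|hf] /= := boolP (h \in codom f); last first.
    by move=> _ g; rewrite E (negPf hf) mul0r.
  case: ifP => _ => [[f' [? ? Ef']]|Ef'].
    by exists f'; split => // g; rewrite E hf mul1r Ef'.
  by move=> g; rewrite E Ef' mulr0.
have E g : kmul (@asym K n m) (ev_prod (inr h :: L)) f g =
    \sum_(i | f i == ordS h) twist h * kmul (@asym K n m) (ev_prod L) (upd f i h) g.
  by rewrite asym_ev_prod_cons kmul_affine_l dtpow_delta mul0r add0r mul1r.
have [/codomP[i0 hE]|hf] := boolP (ordS h \in codom f); last first.
  rewrite [admissible _ _]/= cf /occupation_off hf /= => g.
  rewrite E big_pred0 // => i; apply/negP => /eqP Ei.
  by move: hf; rewrite -Ei codom_f.
have {}E g : kmul (@asym K n m) (ev_prod (inr h :: L)) f g =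
    twist h * kmul (@asym K n m) (ev_prod L) (upd f i0 h) g.
  by rewrite E (big_pred1 i0) // => i; rewrite hE (inj_eq injf).
have adm : admissible c (inr h) = (h == ordS h) || (h \notin codom f).
  have hS : ordS h \in codom f by rewrite hE codom_f.
  rewrite /= !cf /occupation_off hS /= (eqxx h).
  case: (h =P ordS h) => [hS'|_]; last by case: (h \in codom f).
  by rewrite {1}hS' hS.
rewrite adm; case: ifP => [/andP[/orP hcase pathL]|].
  have hcase' : h = ordS h \/ h \notin codom f by case: hcase => [/eqP|]; [left|right].
  have [f1 [incf1 occ1 E1]] := bead_move incf (esym hE) hcase'.
  have {}occ1 : advance c (inr h) =1 occupation_off f1.
    by move=> g; rewrite occ1 /= cf.
  have := IH _ _ incf1 occ1; rewrite pathL => -[f' [incf' occ' Ef']].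
  exists f'; split => // g.
  by rewrite E E1 Ef' mulrA -exprD.
move/negbT; rewrite negb_and => /orP[ncase|npath] g.
  move: ncase; rewrite negb_or negbK => /andP[hS hf].
  rewrite E asym_noninj_row ?mulr0 //; apply/injectivePn.
  have /codomP[j hj] := hf; have ji : j != i0.
    by apply: contraNneq hS => ji; rewrite hE hj ji.
  by exists j, i0 => //; rewrite !ffunE eqxx (negPf ji).
have [hcase|ncase] := boolP ((h == ordS h) || (h \notin codom f)); last first.
  rewrite E asym_noninj_row ?mulr0 //; apply/injectivePn.
  move: ncase; rewrite negb_or negbK => /andP[hS hf].
  have /codomP[j hj] := hf; have ji : j != i0.
    by apply: contraNneq hS => ji; rewrite hE hj ji.
  by exists j, i0 => //; rewrite !ffunE eqxx (negPf ji).
have hcase' : h = ordS h \/ h \notin codom f by case/orP: hcase => [/eqP|]; [left|right].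
have [f1 [incf1 occ1 E1]] := bead_move incf (esym hE) hcase'.
have {}occ1 : advance c (inr h) =1 occupation_off f1.
  by move=> k; rewrite occ1 /= cf.
have := IH _ _ incf1 occ1; rewrite (negPf npath) => E2.
by rewrite E E1 E2 mulr0.
Qed.

Lemma asym_increasing f g : increasing f -> increasing g ->
  asym K f g = (f == g)%:R.
Proof.
move=> incf incg; have [<-|fg] := eqVneq f g.
  rewrite -[RHS](det1 K m); congr (\det _); apply/matrixP => i j.
  by rewrite !mxE (inj_eq (increasing_inj incf)).
have [i fi] : exists i, f i \notin codom g.
  apply/existsP; apply: contraNT fg; rewrite negb_exists => /forallP fg.
  apply/eqP/increasing_codom => //.
  have cc : #|codom f| = #|codom g| by rewrite !card_codom //; apply: increasing_inj.
  apply/(subset_cardP cc)/fintype.subsetP => _ /codomP[i ->].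
  by rewrite -[_ \in _]negbK fg.
rewrite /asym (expand_det_row _ i) big1 // => j _; rewrite !mxE.
case: eqP => [E|_]; last by rewrite mul0r.
by move: fi; rewrite E codom_f.
Qed.

Lemma occupation_off_inj f g : increasing f -> increasing g ->
  occupation_off f =1 occupation_off g -> f = g.
Proof.
move=> incf incg fg; apply: increasing_codom => // h.
by move: (fg h); rewrite /occupation_off; do 2!case: (_ \in _).
Qed.

Lemma ev_prod_closed L f c : increasing f -> c =1 occupation_off f ->
  kmul (@asym K n m) (ev_prod L) f f =
  if path_closed c L then ((-1) ^+ m.-1 * eps) ^+ wraps L else 0.
Proof.
move=> incf cf; rewrite /path_closed; have := ev_prod_path L incf cf.
case: ifP => /= _; last exact.
move=> [f' [incf' occ' ->]]; rewrite asym_increasing //.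
have -> : (f' == f) = [forall h, occupation_after c L h == c h].
  apply/eqP/forallP => [f'f h|eqf]; first by rewrite occ' cf f'f.
  by apply: occupation_off_inj => // h; rewrite -occ' -cf; apply/eqP.
by case: ifP; rewrite ?mulr1 ?mulr0.
Qed.
End EventOperators.

Section Configurations.
Variables (K : comPzRingType) (n : nat) (q eps : K).

Definition enum_fun (S : {set 'I_n}) : {ffun 'I_#|S| -> 'I_n} :=
  [ffun i => @enum_val _ (mem S) i].

Lemma enum_fun_increasing S : increasing (enum_fun S).
Proof.
move=> i j ij; rewrite !ffunE.
have sS : sorted ltn (map val (enum S)).
  have -> : enum S = [seq x <- enum 'I_n | x \in S] by rewrite enumT.
  rewrite sorted_map sorted_filter //; first by move=> a b c; apply: ltn_trans.
  by rewrite -sorted_map val_enum_ord iota_ltn_sorted.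
have nthE (k : 'I_#|S|) : enum_val k = nth 0%N (map val (enum S)) k :> nat.
  by rewrite (enum_val_nth (enum_val k)) (nth_map (enum_val k)) // -cardE.
by rewrite !nthE; apply: (sorted_ltn_nth ltn_trans); rewrite ?inE ?size_map -?cardE.
Qed.

(** The increasing enumerations of the sets [S] label a basis of Fock space, and a word returning to
    its initial occupation is a non-zero diagonal entry of the product of its operators. *)
Lemma config_weight_trace (L : seq (event n)) :
  config_weight q eps L = \sum_(S : {set 'I_n}) q ^+ #|~: S| *
    kmul (@asym K n #|S|) (ev_prod eps L) (enum_fun S) (enum_fun S).
Proof.
apply: eq_bigr => S _; congr (_ * _).
rewrite (ev_prod_closed _ _ (@enum_fun_increasing S) (c := occupation_of S)) //.
move=> h; congr ((~~ _)%:Z); apply/idP/codomP => [hS|[i ->]].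
  by exists (enum_rank_in hS h); rewrite ffunE enum_rankK_in.
by rewrite ffunE enum_valP.
Qed.
End Configurations.

(** * Integrals of real and complex functions *)

Section HasIntegral.
Context d (S : measurableType d) (R : realType).
Variable mu : {measure set S -> \bar R}.
Implicit Types (D : set S) (f g : S -> R) (a b : R).

(** Integrability travels with the value, because additivity of the real-valued integral relies on
    it. *)
Definition has_integral D f a : Prop :=
  mu.-integrable D (EFin \o f) /\ \int[mu]_(t in D) f t = a.

Lemma has_integral_eq D f g a :
  {in D, f =1 g} -> has_integral D f a -> has_integral D g a.
Proof.
move=> fg [intf <-]; split; last by apply: eq_Rintegral => t tD; rewrite fg.
apply/integrableP; have /integrableP[mf foo] := intf; split.
  by apply: eq_measurable_fun mf => t tD /=; rewrite fg.
apply: le_lt_trans foo; rewrite le_eqVlt; apply/orP; left; apply/eqP.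
by apply: eq_integral => t tD /=; rewrite fg.
Qed.

Lemma has_integralD D f g a b : measurable D ->
  has_integral D f a -> has_integral D g b ->
  has_integral D (fun t => f t + g t) (a + b).
Proof.
move=> mD [intf <-] [intg <-]; split; last by rewrite RintegralD.
have -> : EFin \o (fun t => f t + g t) = (EFin \o f) \+ (EFin \o g) by [].
exact: integrableD.
Qed.

Lemma has_integralZ D f a b : measurable D ->
  has_integral D f a -> has_integral D (fun t => b * f t) (b * a).
Proof.
move=> mD [intf <-]; split; last by rewrite RintegralZl.
have -> : EFin \o (fun t => b * f t) = (fun t => b%:E * (EFin \o f) t)%E by [].
exact: integrableZl.
Qed.

Lemma has_integral0 D : has_integral D (fun=> 0) 0.
Proof.
split; last by rewrite /Rintegral integral0.
exact: integrable0.
Qed.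

Lemma has_integral_sum D (I : Type) (s : seq I) (f : I -> S -> R) (a : I -> R) :
  measurable D -> (forall i, has_integral D (f i) (a i)) ->
  has_integral D (fun t => \sum_(i <- s) f i t) (\sum_(i <- s) a i).
Proof.
move=> mD fa; elim: s => [|i s IH].
  rewrite big_nil; apply: has_integral_eq (has_integral0 D) => t _.
  by rewrite big_nil.
rewrite big_cons; apply: has_integral_eq (has_integralD mD (fa i) IH) => t _.
by rewrite big_cons.
Qed.

Lemma has_integral_setU D E f a b : measurable D -> measurable E ->
  [disjoint D & E] -> has_integral D f a -> has_integral E f b ->
  has_integral (D `|` E) f (a + b).
Proof.
move=> mD mE DE [fD <-] [fE <-].
have intU : mu.-integrable (D `|` E) (EFin \o f).
  apply/integrableP; have /integrableP[mfD Doo] := fD; have /integrableP[mfE Eoo] := fE.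
  have mfU := proj2 (measurable_funU _ mD mE) (conj mfD mfE).
  split => //; rewrite ge0_integral_setU //; first by rewrite lte_add_pinfty.
  exact: measurableT_comp.
by split => //; rewrite Rintegral_setU.
Qed.
End HasIntegral.

Section ComplexIntegral.
Context d (S : measurableType d) (R : realType).
Variable mu : {measure set S -> \bar R}.
Local Notation C := R[i].
Implicit Types (D : set S) (u v : S -> C) (a b c : C).

Definition has_cintegral D u c : Prop :=
  has_integral mu D (fun t => complex.Re (u t)) (complex.Re c) /\
  has_integral mu D (fun t => complex.Im (u t)) (complex.Im c).

Lemma has_cintegral_eq D u v c :
  {in D, u =1 v} -> has_cintegral D u c -> has_cintegral D v c.
Proof. by move=> uv [ur ui]; split; [move: ur|move: ui]; apply: has_integral_eq => t tD; rewrite uv. Qed.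

Lemma has_cintegralZ D u a c : measurable D ->
  has_cintegral D u a -> has_cintegral D (fun t => c * u t) (c * a).
Proof.
move=> mD [ur ui].
have reM (z x : C) : complex.Re (z * x) = complex.Re z * complex.Re x + - complex.Im z * complex.Im x.
  by case: z x => [? ?] [? ?] /=; rewrite mulNr.
have imM (z x : C) : complex.Im (z * x) = complex.Re z * complex.Im x + complex.Im z * complex.Re x.
  by case: z x => [? ?] [? ?].
split; rewrite ?reM ?imM.
  apply: has_integral_eq (has_integralD mD (has_integralZ _ mD ur) (has_integralZ _ mD ui)).
  by move=> t _; rewrite reM.
apply: has_integral_eq (has_integralD mD (has_integralZ _ mD ui) (has_integralZ _ mD ur)).
by move=> t _; rewrite imM.
Qed.

Lemma has_cintegral_sum D (I : Type) (s : seq I) (u : I -> S -> C) (c : I -> C) :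
  measurable D -> (forall i, has_cintegral D (u i) (c i)) ->
  has_cintegral D (fun t => \sum_(i <- s) u i t) (\sum_(i <- s) c i).
Proof.
move=> mD uc; split; rewrite raddf_sum.
  apply: has_integral_eq (has_integral_sum s mD (fun i => proj1 (uc i))).
  by move=> t _; rewrite raddf_sum.
apply: has_integral_eq (has_integral_sum s mD (fun i => proj2 (uc i))).
by move=> t _; rewrite raddf_sum.
Qed.

Lemma has_cintegral_setU D E u a b : measurable D -> measurable E ->
  [disjoint D & E] -> has_cintegral D u a -> has_cintegral E u b ->
  has_cintegral (D `|` E) u (a + b).
Proof.
by move=> mD mE DE [? ?] [? ?]; split; rewrite raddfD; exact: has_integral_setU.
Qed.

Lemma has_cintegral_cst D c : measurable D -> (mu D < +oo)%E ->
  has_cintegral D (fun=> c) ((fine (mu D))%:C * c).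
Proof.
move=> mD Doo.
have cst (k : R) : has_integral mu D (fun=> k) (fine (mu D) * k).
  split; last by rewrite Rintegral_cst // mulrC.
  by apply: measurable_bounded_integrable => //; exact: bounded_cst.
by case: c => x y; split; rewrite /= mul0r ?subr0 ?addr0; exact: cst.
Qed.
End ComplexIntegral.

Lemma has_cintegral_itv_cst (R : realType) (tau b : R) (u : R -> R[i]) c : tau <= b ->
{in `[tau, b[%classic, u =1 fun=> c} ->
has_cintegral (@lebesgue_measure R) `[tau, b[ u ((b - tau)%:C * c).
Proof.
move=> taub uc; apply: (@has_cintegral_eq _ _ _ _ _ (fun=> c)).
by move=> t tD; rewrite uc.
have muE : lebesgue_measure (`[tau, b[%classic : set R) = (b - tau)%:E.
rewrite lebesgue_measure_itv /= lte_fin.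
move: taub; rewrite le_eqVlt => /predU1P[->|->]; last by [].
by rewrite ltxx subrr.
have -> : b - tau = fine (lebesgue_measure (`[tau, b[%classic : set R)) by rewrite muE.
apply: has_cintegral_cst; first exact: measurable_itv.
by rewrite [X in (X < _)%E]muE ltry.
Qed.

(** * Timed lists and evolution along paths *)

Section TimedLists.
Variables (R : realType) (E : Type).
Implicit Types (p : R * E) (L : seq (R * E)).

Fixpoint insert_timed p L : seq (R * E) :=
  if L is p' :: L' then
    if p.1 < p'.1 then p :: L else p' :: insert_timed p L'
  else [:: p].

Definition insert_all L s := foldl (fun L p => insert_timed p L) L s.

Fixpoint timed_from (t : R) L : bool :=
  if L is p :: L' then (t <= p.1) && timed_from p.1 L' else t <= 1.

Lemma timed_from_le1 t L : timed_from t L -> t <= 1.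
Proof.
by elim: L t => [//|p L IH] t /= /andP[tp /IH]; exact: le_trans.
Qed.

End TimedLists.

Section Evolution.
Variables (R : realType) (E : Type) (I : finType).
Local Notation C := R[i].
Variables (alpha : I -> C) (A : E -> I -> I -> C).
Implicit Types (phi psi : C -> C) (t tau : R) (e : C) (L : seq (R * E)).

(* Sum over all paths in [I] of the product of the matrix entries met at the
   times of [L], times the value of [phi] at the integral of [alpha] along the
   path, shifted by [e]. *)
Fixpoint evolve phi tau e L (i j : I) : C :=
  if L is (t, a) :: L' then
    \sum_k A a i k * evolve phi t (e + (t - tau)%:C * alpha i) L' k j
  else phi (e + (1 - tau)%:C * alpha i) * (i == j)%:R.

Lemma eq_evolve phi psi tau e L i j :
  phi =1 psi -> evolve phi tau e L i j = evolve psi tau e L i j.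
Proof.
move=> eqp; elim: L tau e i => [|[t a] L IH] tau e i /=; first by rewrite eqp.
by apply: eq_bigr => k _; rewrite IH.
Qed.

Lemma evolve_linear phi psi (c : C) tau e L i j :
  evolve (fun x => c * phi x + psi x) tau e L i j =
  c * evolve phi tau e L i j + evolve psi tau e L i j.
Proof.
elim: L tau e i => [|[t a] L IH] tau e i /=; first by rewrite mulrDl mulrA.
rewrite mulr_sumr -big_split; apply: eq_bigr => k _ /=.
by rewrite IH mulrDr mulrCA.
Qed.

Lemma evolve_shift phi t tau e L i j :
  evolve phi t (e + (t - tau)%:C * alpha i) L i j = evolve phi tau e L i j.
Proof.
have shift (t1 : R) : e + (t - tau)%:C * alpha i + (t1 - t)%:C * alpha i =
    e + (t1 - tau)%:C * alpha i.
  by rewrite -addrA -mulrDl -rmorphD /=; congr (_ + _%:C * _); ring.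
by case: L => [|[t1 a] L] /=; rewrite shift.
Qed.

Lemma evolve_cst1 tau e L i j :
  evolve (fun=> 1) tau e L i j = foldr (fun p => kmul (A p.2)) (@kid C I) L i j.
Proof.
elim: L tau e i => [|[t a] L IH] tau e i /=; first by rewrite mul1r.
by apply: eq_bigr => k _; rewrite IH.
Qed.

(** When [phi] turns sums into products, the path sum factors into diagonal propagators between
    consecutive events. Powers do not have this property, the exponential does. *)
Fixpoint evolve_mult phi tau L : I -> I -> C :=
  if L is (t, a) :: L' then
    kmul (kdiag (fun i => phi ((t - tau)%:C * alpha i)))
      (kmul (A a) (evolve_mult phi t L'))
  else kdiag (fun i => phi ((1 - tau)%:C * alpha i)).

Lemma evolve_multE phi tau e L i j : {morph phi : x y / x + y >-> x * y} ->
  evolve phi tau e L i j = phi e * evolve_mult phi tau L i j.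
Proof.
move=> phiD; elim: L tau e i => [|[t a] L IH] tau e i /=.
  by rewrite phiD /kdiag /kid mulrA.
rewrite kmul_diag_l mulrA -phiD mulr_sumr; apply: eq_bigr => k _.
by rewrite IH mulrCA.
Qed.

Variable beads : seq E.
Hypothesis beads_diag :
  forall i k, \sum_(b <- beads) A b i k = alpha i * (i == k)%:R.

Lemma evolve_bead phi t tau e L i j :
  \sum_(b <- beads) evolve phi tau e ((t, b) :: L) i j =
  alpha i * evolve phi tau e L i j.
Proof.
rewrite /= exchange_big /= (bigD1 i) //= [X in _ + X]big1 => [|k ki].
  by rewrite -mulr_suml beads_diag eqxx mulr1 addr0 evolve_shift.
by rewrite -mulr_suml beads_diag eq_sym (negPf ki) mulr0 mul0r.
Qed.

(* The operator inserted at a bead commutes with the evolution, so the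
   integrand does not depend on [t] between two consecutive events. *)
Lemma evolve_insert phi tau e L i j : timed_from tau L ->
  has_cintegral (@lebesgue_measure R) `[tau, 1[
    (fun t => \sum_(b <- beads) evolve phi tau e (insert_timed (t, b) L) i j)
    (evolve (fun x => (x - e) * phi x) tau e L i j).
Proof.
elim: L tau e i => [|[t1 a] L IH] tau e i.
  move=> tau1.
  have -> : evolve (fun x => (x - e) * phi x) tau e [::] i j =
      (1 - tau)%:C * (alpha i * evolve phi tau e [::] i j).
    by rewrite /= addrAC subrr add0r !mulrA.
  by apply: has_cintegral_itv_cst => // t _; exact: (evolve_bead phi t tau e [::]).
move=> /= /andP[taut1 from1]; have t11 := timed_from_le1 from1.
rewrite (@itv_bndbnd_setU _ _ _ (BLeft t1)) ?bnd_simp //.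
(* [e'] is the integral of [alpha] reached at time [t1]. The factor [x - e] splits into [e' - e] and
   [x - e'], the shares of a new bead placed before and after [t1]. *)
pose e' := e + (t1 - tau)%:C * alpha i.
have -> : \sum_k A a i k * evolve (fun x => (x - e) * phi x) t1 e' L k j =
    (t1 - tau)%:C * (alpha i * evolve phi tau e ((t1, a) :: L) i j) +
    \sum_k A a i k * evolve (fun x => (x - e') * phi x) t1 e' L k j.
  rewrite /= !mulr_sumr -big_split; apply: eq_bigr => k _ /=.
  rewrite -/e' (@eq_evolve _ (fun x => (e' - e) * phi x + (x - e') * phi x)).
    by rewrite evolve_linear mulrDr /e' (addrC e) addrK; congr (_ + _); ring.
  by move=> x /=; ring.
apply: has_cintegral_setU; [exact: measurable_itv|exact: measurable_itv|..].
- by apply/disj_setPS => t /= []; rewrite !in_itv /= => /andP[_ /lt_geF ->].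
- apply: has_cintegral_itv_cst => // t; rewrite inE /= in_itv /= => /andP[_ tt1].
  transitivity (\sum_(b <- beads) evolve phi tau e ((t, b) :: (t1, a) :: L) i j).
    by apply: eq_bigr => b _; rewrite /= tt1.
  exact: evolve_bead.
- have eqI : {in `[t1, 1[%classic, (fun t => \sum_k A a i k *
        \sum_(b <- beads) evolve phi t1 e' (insert_timed (t, b) L) k j) =1
      (fun t => \sum_(b <- beads) evolve phi tau e (insert_timed (t, b) ((t1, a) :: L)) i j)}.
    move=> t; rewrite inE /= in_itv /= => /andP[/le_gtF t1t _].
    under [RHS]eq_bigr do rewrite t1t /=.
    by rewrite exchange_big /=; apply: eq_bigr => k _; rewrite mulr_sumr.
  apply: (@has_cintegral_eq _ (measurableTypeR R) R _ _ _ _ _ eqI).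
  apply: has_cintegral_sum => [|k]; first exact: measurable_itv.
  apply: has_cintegralZ; first exact: measurable_itv.
  exact: IH.
Qed.
End Evolution.

(** * Traces with insertions as determinants *)

Section InsertionDeterminant.
Variables (R : realType) (K : fieldType) (n : nat).
Variable U : R -> 'M[K]_n.
Hypothesis UD : forall s t, U (s + t) = U s *m U t.
Hypothesis U0 : U 0 = 1%:M.

(* [Insertion a c i j] stands for the operator [a + c e_i e_j^T] *)
Record insertion := Insertion {
  ins_const : K; ins_coef : K; ins_row : 'I_n; ins_col : 'I_n }.
Implicit Types (L : seq (R * insertion)) (p : R * insertion).

Definition ins_mx p : 'M[K]_n :=
  ins_coef p.2 *: delta_mx (ins_row p.2) (ins_col p.2).

Fixpoint chain_mx t L : 'M[K]_n :=
  if L is p :: L' then U (p.1 - t) *m (1%:M + ins_mx p) *m chain_mx p.1 L'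
  else U (1 - t).

Section Order.
Variable L : seq (R * insertion).
Local Notation N := (size L).
Implicit Types (i j : 'I_N).
Local Notation p_ i := (tnth (in_tuple L) i).

Definition prop_mx i j : K :=
  ins_coef (p_ j).2 *
  U ((p_ j).1 - (p_ i).1) (ins_col (p_ i).2) (ins_row (p_ j).2).

Definition loop_mx (q : K) i j : K :=
  ins_coef (p_ j).2 *
  (U (1 - (p_ i).1) *m invmx (q%:M + U 1) *m U (p_ j).1)
    (ins_col (p_ i).2) (ins_row (p_ j).2).

Definition green_mx (q : K) : 'M[K]_N :=
  \matrix_(i, j) (loop_mx q i j - (i < j)%:R * prop_mx i j).

Definition insertion_mx (q : K) : 'M[K]_N :=
  \matrix_(i, j) (ins_const (p_ j).2 * (i == j)%:R + green_mx q i j).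
End Order.

(** A Dyson expansion: either no insertion acts, or [j] is the first one that does, preceded by free
    propagation and followed by the full chain. *)
Lemma chain_mx_sum t L :
  chain_mx t L = U (1 - t) + \sum_(j < size L)
    U ((tnth (in_tuple L) j).1 - t) *m ins_mx (tnth (in_tuple L) j) *m
    chain_mx (tnth (in_tuple L) j).1 (drop j.+1 L).
Proof.
elim: L t => [|p L IH] t /=; first by rewrite big_ord0 addr0.
rewrite big_ord_recl /= drop0 {2}/tnth /= mulmxDr mulmx1 mulmxDl.
rewrite {1}IH mulmxDr -UD addrC !addrA; congr (_ + _).
  by rewrite addrC; congr (U _ + _); ring.
rewrite mulmx_sumr; apply: eq_bigr => j _.
have -> : tnth (in_tuple (p :: L)) (lift ord0 j) = tnth (in_tuple L) j.
  by rewrite !(tnth_nth p).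
by rewrite !mulmxA -UD; congr (U _ *m _ *m _); ring.
Qed.


Lemma mul_delta_mx_mul m1 m2 (c : K) (X : 'M[K]_(m1, n)) (Y : 'M[K]_(n, m2)) r k a b :
  (X *m (c *: delta_mx r k) *m Y) a b = c * X a r * Y k b.
Proof.
rewrite -scalemxAr -scalemxAl mxE -mulrA; congr (_ * _).
have XE l : (X *m delta_mx r k) a l = X a r * (l == k)%:R.
  rewrite mxE (bigD1 r) //= big1 => [|m /negPf mr]; last by rewrite mxE mr mulr0.
  by rewrite mxE eqxx addr0.
rewrite mxE (bigD1 k) //= big1 => [|l /negPf lk]; last by rewrite XE lk mulr0 mul0r.
by rewrite XE eqxx mulr1 addr0.
Qed.

Lemma chain_mx_drop L (i : 'I_(size L)) t :
  chain_mx t (drop i.+1 L) = U (1 - t) + \sum_(j < size L | (i < j)%N)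
    U ((tnth (in_tuple L) j).1 - t) *m ins_mx (tnth (in_tuple L) j) *m
    chain_mx (tnth (in_tuple L) j).1 (drop j.+1 L).
Proof.
pose d := tnth (in_tuple L) i; rewrite chain_mx_sum; congr (_ + _).
pose G L' j := U ((nth d L' j).1 - t) *m ins_mx (nth d L' j) *m
  chain_mx (nth d L' j).1 (drop j.+1 L').
transitivity (\sum_(0 <= j < size (drop i.+1 L)) G (drop i.+1 L) j).
  by rewrite big_mkord; apply: eq_bigr => j _; rewrite /G !(tnth_nth d).
transitivity (\sum_(0 <= j < size L | (i < j)%N) G L j); last first.
  by rewrite big_mkord; apply: eq_bigr => j _; rewrite /G !(tnth_nth d).
transitivity (\sum_(i.+1 <= j < size L) G L j); last first.
  by rewrite (@big_nat_widenl _ _ _ i.+1 0).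
rewrite size_drop.
rewrite -[X in _ = \big[_/_]_(X <= _ < _) _]add0n big_addn; apply: eq_bigr => j _.
by rewrite /G nth_drop drop_drop addnC addSn.
Qed.

(** Two eliminations in one block matrix. The Dyson equations read [D E = F] with [D] unitriangular,
    and the chain is [U 1 + B E]. Clearing the block [- F] with [E] leaves [q] plus the chain;
    clearing [B] with the inverse of [A] leaves [det A] times the determinant of the Schur
    complement, which is the matrix of insertions. *)
Lemma det_chain q L : q%:M + U 1 \in unitmx ->
    all (fun p => ins_const p.2 == 1) L ->
  \det (q%:M + chain_mx 0 L) = \det (q%:M + U 1) * \det (insertion_mx L q).
Proof.
move=> unitA allL; pose p_ i := tnth (in_tuple L) i.
pose A := q%:M + U 1.
pose B : 'M[K]_(n, size L) :=
  \matrix_(a, j) (ins_coef (p_ j).2 * U (p_ j).1 a (ins_row (p_ j).2)).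
pose D : 'M[K]_(size L) := \matrix_(i, j) ((i == j)%:R - (i < j)%:R * prop_mx i j).
pose F : 'M[K]_(size L, n) := \matrix_(i, b) U (1 - (p_ i).1) (ins_col (p_ i).2) b.
pose E : 'M[K]_(size L, n) :=
  \matrix_(i, b) chain_mx (p_ i).1 (drop i.+1 L) (ins_col (p_ i).2) b.
have chainE : chain_mx 0 L = U 1 + B *m E.
  rewrite chain_mx_sum subr0; congr (_ + _); apply/matrixP => a b.
  rewrite summxE mxE; apply: eq_bigr => j _.
  by rewrite mul_delta_mx_mul subr0 !mxE.
have DE : D *m E = F.
  apply/matrixP => i b; rewrite !mxE.
  under eq_bigr do rewrite !mxE mulrBl.
  rewrite sumrB (bigD1 i) //= eqxx mul1r [X in _ + X - _]big1 ?addr0; last first.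
    by move=> j /negPf; rewrite eq_sym => ->; rewrite mul0r.
  rewrite chain_mx_drop mxE summxE -addrA -[RHS]addr0; congr (_ + _).
  apply/eqP; rewrite subr_eq0 big_mkcond; apply/eqP; apply: eq_bigr => j _.
  case: ifP => ij; last by rewrite !mul0r.
  by rewrite mul_delta_mx_mul mul1r /prop_mx.
have detD : \det D = 1.
  rewrite -det_tr det_trig; last first.
    apply/is_trig_mxP => i j ij; rewrite !mxE eq_sym -val_eqE (ltn_eqF ij).
    by rewrite ltnNge (ltnW ij) mul0r subrr.
  by rewrite big1 // => i _; rewrite !mxE eqxx ltnn mul0r subr0.
pose blk := block_mx A B (- F) D.
have blk1 : \det blk = \det (q%:M + chain_mx 0 L).
  transitivity (\det (blk *m block_mx 1%:M 0 E 1%:M)).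
    by rewrite det_mulmx det_lblock !det1 !mulr1.
  rewrite mulmx_block !mulmx1 !mulmx0 !add0r DE addNr det_ublock detD mulr1.
  by rewrite chainE addrA.
have blk2 : \det blk = \det A * \det (D + F *m (invmx A *m B)).
  transitivity (\det (blk *m block_mx 1%:M (- (invmx A *m B)) 0 1%:M)).
    by rewrite det_mulmx det_ublock !det1 !mulr1.
  rewrite mulmx_block !mulmx1 !mulmx0 !addr0 !mulmxN mulNmx opprK.
  by rewrite mulmxA mulmxV // mul1mx addNr det_lblock addrC.
rewrite -blk1 blk2; congr (_ * \det _); apply/matrixP => i j.
have loopE : (F *m (invmx A *m B)) i j = loop_mx q i j.
  rewrite /loop_mx mulmxA !mxE mulr_sumr; apply: eq_bigr => k _.
  rewrite !mxE mulrCA; congr (_ * (_ * _)); apply: eq_bigr => l _.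
  by rewrite !mxE.
have constE : ins_const (p_ j).2 = 1.
  by apply/eqP; exact: (@all_tnthP _ _ _ (in_tuple L) allL j).
rewrite mxE [X in X + _ = _]mxE loopE mxE [X in _ = _ + X]mxE constE.
by rewrite mul1r addrAC addrA.
Qed.

Section Nth.
Variable d : R * insertion.

(** Indexing by naturals with a default gives a matrix type that is independent of the list, so that
    matrices for modified lists can be added and compared. *)
Definition insertion_entry L (q : K) (i j : nat) : K :=
  let pi := nth d L i in let pj := nth d L j in
  ins_const pj.2 * (i == j)%:R + ins_coef pj.2 *
    ((U (1 - pi.1) *m invmx (q%:M + U 1) *m U pj.1) (ins_col pi.2) (ins_row pj.2)
     - (i < j)%:R * U (pj.1 - pi.1) (ins_col pi.2) (ins_row pj.2)).

Definition insertion_nth_mx N L q : 'M[K]_N :=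
  \matrix_(i, j) insertion_entry L q i j.

Lemma insertion_mx_nth L q :
  insertion_mx L q = insertion_nth_mx (size L) L q.
Proof.
apply/matrixP => i j; rewrite !mxE /insertion_entry /loop_mx /prop_mx !(tnth_nth d).
by congr (_ + _); rewrite mulrBr; congr (_ - _); rewrite mulrCA.
Qed.

(** The pair [(a, c)] enters a single column, linearly, and [(a, c) = (a - 1) (1, 0) + (1, c)]. *)
Lemma det_insertion_affine N L1 L2 t (a c : K) (i k : 'I_n) q :
    (size L1 < N)%N ->
  let L x y := L1 ++ (t, Insertion x y i k) :: L2 in
  \det (insertion_nth_mx N (L a c) q) =
  (a - 1) * \det (insertion_nth_mx N (L 1 0) q) +
  1 * \det (insertion_nth_mx N (L 1 c) q).
Proof.
move=> ltN L; pose i0 := Ordinal ltN.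
have nthE x y j : nth d (L x y) j =
    if (j < size L1)%N then nth d L1 j else
    if j == size L1 then (t, Insertion x y i k) else nth d L2 (j - (size L1).+1).
  rewrite nth_cat; case: ltnP => // le1; case: eqP => [->|/eqP ne].
    by rewrite subnn.
  by rewrite subnS; move: le1 ne; case: ltngtP => // lt1 _ _; rewrite -(subnSK lt1).
have timeE x y x' y' j : [/\ (nth d (L x y) j).1 = (nth d (L x' y') j).1,
    ins_col (nth d (L x y) j).2 = ins_col (nth d (L x' y') j).2 &
    ins_row (nth d (L x y) j).2 = ins_row (nth d (L x' y') j).2].
  by rewrite !nthE; case: ifP => // _; case: ifP.
have offE x y x' y' j : j != i0 :> nat ->
    nth d (L x y) j = nth d (L x' y') j.
  by rewrite !nthE => /negPf ->.
have atE x y : nth d (L x y) i0 = (t, Insertion x y i k).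
  by rewrite nthE ltnn eqxx.
rewrite -!(det_tr (insertion_nth_mx _ _ _)).
apply: (@determinant_multilinear _ _ _ _ _ i0).
- apply/rowP => j; rewrite !mxE /insertion_entry !atE /=.
  have [-> -> _] := timeE a c 1 c j.
  by ring.
- apply/matrixP => l j; rewrite !mxE /insertion_entry.
  have [-> -> _] := timeE a c 1 0 j.
  by rewrite (offE a c 1 0) // val_eqE eq_sym neq_lift.
- apply/matrixP => l j; rewrite !mxE /insertion_entry.
  have [-> -> _] := timeE a c 1 c j.
  by rewrite (offE a c 1 c) // val_eqE eq_sym neq_lift.
Qed.
End Nth.

Fixpoint fock_chain m t L : {ffun 'I_m -> 'I_n} -> {ffun 'I_m -> 'I_n} -> K :=
  if L is p :: L' then
    kmul (@tpow _ _ m (U (p.1 - t)))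
      (kmul (kaffine (ins_const p.2) 1 (@dtpow _ _ m (ins_mx p)))
        (fock_chain p.1 L'))
  else @tpow _ _ m (U (1 - t)).

Definition fock_trace q L : K := \sum_(S : {set 'I_n}) q ^+ #|~: S| *
  kmul (@asym K n #|S|) (@fock_chain #|S| 0 L)
    (enum_fun S) (enum_fun S).

Lemma asym_tpowM m (X Y : 'M[K]_n) f g :
  kmul (tpow X) (kmul (@asym K n m) (tpow Y)) f g =
  kmul (@asym K n m) (tpow (X *m Y)) f g.
Proof.
rewrite -(eq_kmul (fun _ _ => erefl) (@tensM _ _ _ (fun=> X) (fun=> Y))).
by rewrite !kmulA; apply: eq_kmul => // i j; rewrite asym_tpowC.
Qed.

(** With constants [1] every inserted operator agrees on antisymmetric tensors with the tensor power
    of [1 + c E], so the whole chain is the tensor power of one product of matrices. *)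
Lemma asym_fock_chain m t L f g : all (fun p => ins_const p.2 == 1) L ->
  kmul (@asym K n m) (@fock_chain m t L) f g =
  kmul (@asym K n m) (tpow (chain_mx t L)) f g.
Proof.
elim: L t f g => [//|p L IH] t f g /= /andP[/eqP -> allL].
rewrite kmulA -(eq_kmul (fun i j => esym (asym_tpowC _ i j)) (fun _ _ => erefl)).
rewrite -kmulA -mulmxA -asym_tpowM; apply: eq_kmul => // {}f {}g.
rewrite kmulA -(eq_kmul (asym_tpow_delta _ _ _) (fun _ _ => erefl)).
rewrite (eq_kmul (asym_tpowC _) (fun _ _ => erefl)) -kmulA -asym_tpowM.
by apply: eq_kmul => // ? ?; exact: IH.
Qed.

Lemma fock_trace_affine q L1 L2 t (a c : K) (i k : 'I_n) :
  let L x y := L1 ++ (t, Insertion x y i k) :: L2 in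
  fock_trace q (L a c) = (a - 1) * fock_trace q (L 1 0) + 1 * fock_trace q (L 1 c).
Proof.
move=> L; rewrite mul1r /fock_trace mulr_sumr -big_split; apply: eq_bigr => S _ /=.
rewrite mulrCA -mulrDr; congr (_ * _).
suff aff (f g : {ffun 'I_#|S| -> 'I_n}) t0 : fock_chain t0 (L a c) f g =
    (a - 1) * fock_chain t0 (L 1 0) f g + fock_chain t0 (L 1 c) f g.
  by apply: kmul_linear_r => f g; exact: aff.
rewrite /L {L}; elim: L1 f g t0 => [|p L1 IH] f g t0 /=; last first.
  by do 2!(apply: kmul_linear_r => {}f {}g); exact: IH.
apply: kmul_linear_r => {}f {}g; rewrite !kmul_affine_l !mul1r.
have -> : kmul (dtpow (ins_mx (t, Insertion 1 0 i k))) (fock_chain t L2) f g = 0.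
  by rewrite dtpow_delta big1 // => ? _; rewrite mul0r.
by ring.
Qed.

(** For constants equal to [1] the trace is a sum of principal minors of the chain, known from
    [det_chain]. Any other constant is reached by affinity of both sides in each insertion. *)
Lemma fock_trace_det d q L : q%:M + U 1 \in unitmx ->
  fock_trace q L = \det (q%:M + U 1) * \det (insertion_nth_mx d (size L) L q).
Proof.
move=> unitA.
(* [L1] holds the insertions already reduced to constant [1]. *)
suff gen L1 L2 : all (fun p => ins_const p.2 == 1) L1 ->
    fock_trace q (L1 ++ L2) = \det (q%:M + U 1) *
      \det (insertion_nth_mx d (size (L1 ++ L2)) (L1 ++ L2) q).
  exact: (gen [::] L).
elim: L2 L1 => [|[t [a c i k]] L2 IH] L1 allL1.
  rewrite cats0 -insertion_mx_nth -det_chain // det_scalar_add.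
  apply: eq_bigr => S _; congr (_ * _); rewrite asym_fock_chain // asym_tpow.
  by congr (\det _); apply/matrixP => i j; rewrite !mxE !ffunE.
rewrite fock_trace_affine det_insertion_affine; last first.
  by rewrite size_cat /= -addSnnS leq_addr.
have sizeE p : size (rcons L1 p ++ L2) = (size L1 + size L2).+1.
  by rewrite size_cat size_rcons.
by rewrite -!cat_rcons !IH ?all_rcons ?eqxx // !sizeE; ring.
Qed.
End InsertionDeterminant.

(** * Evolution in an eigenbasis of the bead operator *)

Section ConjugatedOperators.
Variables (R : realType) (n : nat).
Local Notation C := R[i].
Variables (eps : C) (z : 'I_n -> C) (P P' : 'M[C]_n).
Hypothesis PP' : P *m P' = 1%:M.
Hypothesis P'P : P' *m P = 1%:M.
Hypothesis sum_beads :
  \sum_h ev_mx eps (inr h) = P *m diag_mx (\row_j z j) *m P'.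

Section Degree.
Variable m : nat.
Local Notation I := {ffun 'I_m -> 'I_n}.

Definition eigen_sum (f : I) : C := \sum_i z (f i).

Definition conj_op (e : event n) : I -> I -> C :=
  kmul (tpow P') (kmul (ev_op eps e) (tpow P)).

Lemma tpowM (X Y : 'M[C]_n) : kmul (tpow X) (@tpow _ _ m Y) =2 tpow (X *m Y).
Proof. by move=> f g; rewrite /tpow tensM. Qed.

Lemma tpow1 : @tpow C n m 1%:M =2 @kid C _.
Proof. by move=> f g; exact: tens1. Qed.

Lemma kmulKl (X Y : 'M[C]_n) (B : I -> I -> C) : X *m Y = 1%:M ->
  kmul (tpow X) (kmul (tpow Y) B) =2 B.
Proof.
move=> XY f g; rewrite kmulA (eq_kmul (tpowM X Y) (fun _ _ => erefl)) XY.
by rewrite (eq_kmul tpow1 (fun _ _ => erefl)) kmul1k.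
Qed.

Lemma dtpow_sum (J : Type) (s : seq J) (X : J -> 'M[C]_n) (f g : I) :
  dtpow (\sum_(j <- s) X j) f g = \sum_(j <- s) dtpow (X j) f g.
Proof.
rewrite exchange_big; apply: eq_bigr => i _.
have tensE Y : tens (fun j => if j == i then Y else 1%:M) f g =
    Y (f i) (g i) * \prod_(j | j != i) (1%:M : 'M[C]_n) (f j) (g j).
  rewrite /tens (bigD1 i) //= eqxx; congr (_ * _).
  by apply: eq_bigr => j /negPf ->.
by rewrite tensE summxE mulr_suml; apply: eq_bigr => j _; rewrite tensE.
Qed.

Lemma dtpow_diag (d : 'rV[C]_n) (f g : I) :
  dtpow (diag_mx d) f g = kdiag (fun f : I => \sum_i d 0 (f i)) f g.
Proof.
rewrite /kdiag mulr_suml; apply: eq_bigr => i _.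
have [<-|fg] := eqVneq f g.
  rewrite /kid eqxx mulr1 /tens (bigD1 i) //= eqxx mxE eqxx mulr1n big1 ?mulr1 //.
  by move=> j /negPf ->; rewrite mxE eqxx.
rewrite /kid (negPf fg) mulr0.
have [j /negPf fgj] : exists j, f j != g j.
  apply/existsP; apply: contraNT fg; rewrite negb_exists => /forallP fg.
  by apply/eqP/ffunP => j; apply/eqP; rewrite -[_ == _]negbK fg.
by rewrite /tens (bigD1 j) //=; case: eqP => _; rewrite !mxE fgj ?mulr0n mul0r.
Qed.

Lemma tpow_diag (d : 'rV[C]_n) (f g : I) :
  tpow (diag_mx d) f g = kdiag (fun f : I => \prod_i d 0 (f i)) f g.
Proof.
rewrite /kdiag /kid; have [<-|fg] := eqVneq f g.
  by rewrite mulr1; apply: eq_bigr => i _; rewrite mxE eqxx mulr1n.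
rewrite mulr0.
have [j /negPf fgj] : exists j, f j != g j.
  apply/existsP; apply: contraNT fg; rewrite negb_exists => /forallP fg.
  by apply/eqP/ffunP => j; apply/eqP; rewrite -[_ == _]negbK fg.
by rewrite /tpow /tens (bigD1 j) //= mxE fgj mulr0n mul0r.
Qed.

Lemma tens_conj (X : 'I_m -> 'M[C]_n) :
  kmul (tpow P') (kmul (tens X) (tpow P)) =2 tens (fun i => P' *m (X i *m P)).
Proof.
move=> f g; rewrite (eq_kmul (fun _ _ => erefl) (@tensM _ _ _ X (fun=> P))).
by rewrite tensM.
Qed.

Lemma conj_op_beads (f g : I) :
  \sum_(b <- [seq inr h | h <- enum 'I_n]) conj_op b f g = eigen_sum f * (f == g)%:R.
Proof.
rewrite big_map big_enum /=.
have opE h : conj_op (inr h) f g = kmul (tpow P') (kmul (@dtpow _ _ m (ev_mx eps (inr h))) (tpow P)) f g.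
  apply: eq_kmul => // i j; apply: eq_kmul => // k l.
  by rewrite /ev_op /kaffine mul0r add0r mul1r.
have conjd X : kmul (tpow P') (kmul (@dtpow _ _ m X) (tpow P)) f g = dtpow (P' *m X *m P) f g.
  rewrite /dtpow; transitivity (\sum_i kmul (tpow P') (kmul (@tens C n m (fun j => if j == i then X else 1%:M)) (tpow P)) f g).
    rewrite exchange_big /=; apply: eq_bigr => k _; rewrite -mulr_sumr; congr (_ * _).
    by rewrite exchange_big /=; apply: eq_bigr => l _; rewrite -mulr_suml.
  apply: eq_bigr => i _; rewrite tens_conj; apply: eq_bigr => j _.
  by case: ifP => _; [rewrite mulmxA|rewrite mul1mx P'P].
under eq_bigr do rewrite opE conjd.
rewrite -(dtpow_sum _ (fun h => P' *m ev_mx eps (inr h) *m P)) -mulmx_suml -mulmx_sumr.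
rewrite sum_beads !mulmxA P'P mul1mx -mulmxA P'P mulmx1 dtpow_diag.
by congr (_ * _); apply: eq_bigr => i _; rewrite mxE.
Qed.
End Degree.

Implicit Types (q : C) (phi : C -> C) (L : seq (R * event n)).

(** One functional calculus serves both ends: [phi = x ^ r] describes exactly [r] free beads, and
    [phi = exp (T x)] the flow of the twisted shift. *)
Definition evolution_trace q phi L : C :=
  \sum_(S : {set 'I_n}) q ^+ #|~: S| *
    kmul (@asym C n #|S|) (kmul (tpow P)
      (kmul (evolve (@eigen_sum #|S|) (@conj_op #|S|) phi 0 0 L) (tpow P')))
    (enum_fun S) (enum_fun S).

Lemma eq_evolution_trace q phi psi L :
  phi =1 psi -> evolution_trace q phi L = evolution_trace q psi L.
Proof.
move=> eqp; apply: eq_bigr => S _; congr (_ * _).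
do 3!(apply: eq_kmul => // ? ?); exact: eq_evolve.
Qed.

(** With [phi = 1] the times are forgotten, and the changes of basis cancel between consecutive
    operators. *)
Lemma evolution_trace1 q L :
  evolution_trace q (fun=> 1) L = config_weight q eps [seq p.2 | p <- L].
Proof.
rewrite config_weight_trace; apply: eq_bigr => S _; congr (_ * _).
apply: eq_kmul => // {}f {}g.
rewrite -(eq_kmul (fun _ _ => erefl) (eq_kmul (fun i j => esym (evolve_cst1 _ _ _ _ _ i j)) (fun _ _ => erefl))).
elim: L f g => [|[t e] L IH] f g /=.
  by rewrite (eq_kmul (fun _ _ => erefl) (kmul1k _)) tpowM PP' tpow1.
transitivity (kmul (ev_op eps e) (kmul (tpow P) (kmul
   (foldr (fun p => kmul (@conj_op #|S| p.2)) (@kid C _) L) (tpow P'))) f g).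
  rewrite (eq_kmul (fun _ _ => erefl) (fun i j => esym (kmulA _ _ _ i j))).
  rewrite (eq_kmul (fun _ _ => erefl) (fun i j => esym (kmulA _ _ _ i j))).
  rewrite (kmulKl _ PP') -kmulA.
  by apply: eq_kmul.
by apply: eq_kmul => // ? ?; exact: IH.
Qed.

(** The sum of the bead operators is diagonal in the eigenbasis, with the rate of [x] as eigenvalue;
    [evolve_insert] then applies entry by entry in the finite sum defining the trace. *)
Lemma evolution_trace_insert q phi L : timed_from 0 L ->
  has_cintegral (@lebesgue_measure R) `[0, 1[
    (fun t => \sum_h evolution_trace q phi (insert_timed (t, inr h) L))
    (evolution_trace q (fun x => x * phi x) L).
Proof.
move=> L0; have mI : measurable (`[0, 1[ : set (measurableTypeR R)) by exact: measurable_itv.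
pose F S t := \sum_(b <- [seq inr h | h <- enum 'I_n]) q ^+ #|~: S| *
    kmul (@asym C n #|S|) (kmul (tpow P)
      (kmul (evolve (@eigen_sum #|S|) (@conj_op #|S|) phi 0 0 (insert_timed (t, b) L)) (tpow P')))
    (enum_fun S) (enum_fun S).
have FE : {in `[0, 1[%classic, (fun t => \sum_(S : {set 'I_n}) F S t) =1
    (fun t => \sum_h evolution_trace q phi (insert_timed (t, inr h) L))}.
  move=> t _; rewrite exchange_big /= big_map big_enum /=.
  by apply: eq_bigr => h _.
apply: (@has_cintegral_eq _ (measurableTypeR R) R _ _ _ _ _ FE).
apply: has_cintegral_sum => // S; rewrite /F.
pose G (f g : {ffun 'I_#|S| -> 'I_n}) t := \sum_(b <- [seq inr h | h <- enum 'I_n])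
  evolve (@eigen_sum #|S|) (@conj_op #|S|) phi 0 0 (insert_timed (t, b) L) f g.
pose X := (enum_fun S); pose X' := X.
have GE : {in `[0, 1[%classic, (fun t => q ^+ #|~: S| * \sum_k asym C X k *
      \sum_l tpow P k l * \sum_r tpow P' r X' * G l r t) =1
    (fun t => \sum_(b <- [seq inr h | h <- enum 'I_n]) q ^+ #|~: S| *
    kmul (@asym C n #|S|) (kmul (tpow P)
      (kmul (evolve (@eigen_sum #|S|) (@conj_op #|S|) phi 0 0 (insert_timed (t, b) L)) (tpow P')))
      X X')}.
  move=> t _; rewrite -mulr_sumr; congr (_ * _).
  rewrite exchange_big; apply: eq_bigr => k _; rewrite -mulr_sumr; congr (_ * _).
  rewrite exchange_big; apply: eq_bigr => l _; rewrite -mulr_sumr; congr (_ * _).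
  rewrite exchange_big; apply: eq_bigr => r _; rewrite -mulr_suml mulrC.
  by [].
apply: (@has_cintegral_eq _ (measurableTypeR R) R _ _ _ _ _ GE).
apply: has_cintegralZ => //; apply: has_cintegral_sum => // k.
apply: has_cintegralZ => //; apply: has_cintegral_sum => // l.
apply: has_cintegralZ => //.
rewrite (_ : kmul _ _ _ _ = \sum_r tpow P' r X' *
    evolve (@eigen_sum #|S|) (@conj_op #|S|) (fun x => x * phi x) 0 0 L l r); last first.
  by apply: eq_bigr => r _; rewrite mulrC.
apply: has_cintegral_sum => // r; apply: has_cintegralZ => //.
rewrite (@eq_evolve _ _ _ _ _ _ (fun x => (x - 0) * phi x)); last first.
  by move=> x; rewrite subr0.
by apply: evolve_insert => //; exact: conj_op_beads.
Qed.

Definition spectral_mx (X : C -> C) (t : R) : 'M[C]_n :=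
  P *m diag_mx (\row_j X (t%:C * z j)) *m P'.

Definition event_insertion (e : event n) : insertion C n :=
  match e with
  | inl (inl h) => Insertion 1 (-1) h h
  | inl (inr h) => Insertion 0 1 h h
  | inr h => Insertion 0 (twist eps h) (ordS h) h
  end.

Lemma evolution_trace_mult q (X : C -> C) L :
    {morph X : x y / x + y >-> x * y} -> X 0 = 1 ->
  evolution_trace q X L =
  fock_trace (spectral_mx X) q [seq (p.1, event_insertion p.2) | p <- L].
Proof.
move=> XD X0; apply: eq_bigr => S _; congr (_ * _); apply: eq_kmul => // {}f {}g.
have Xsum (m : nat) (h : 'I_m -> C) : X (\sum_i h i) = \prod_i X (h i).
  by rewrite (big_morph X XD X0).
have spec m t : kmul (tpow P) (kmul (kdiag (fun f => X (t%:C * @eigen_sum m f))) (tpow P')) =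
    tpow (spectral_mx X t).
  apply/funext => f1; apply/funext => g1; rewrite /spectral_mx -mulmxA -tpowM.
  apply: eq_kmul => // ? ?; rewrite -tpowM; apply: eq_kmul => // f2 g2.
  rewrite tpow_diag; congr (_ * _); rewrite /eigen_sum mulr_sumr Xsum.
  by apply: eq_bigr => i _; rewrite mxE.
have kA (B1 B2 B3 : {ffun 'I_#|S| -> 'I_n} -> {ffun 'I_#|S| -> 'I_n} -> C) :
    kmul B1 (kmul B2 B3) = kmul (kmul B1 B2) B3.
  by apply/funext => f1; apply/funext => g1; rewrite kmulA.
have evE e : kaffine (ins_const (event_insertion e)) 1 (@dtpow _ _ #|S| (ins_mx (0 : R, event_insertion e))) = ev_op eps e.
  by case: e => [[]|].
have -> : evolve (@eigen_sum #|S|) (@conj_op #|S|) X 0 0 L =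
    evolve_mult (@eigen_sum #|S|) (@conj_op #|S|) X 0 L.
  apply/funext => f1; apply/funext => g1.
  by rewrite evolve_multE // X0 mul1r.
suff -> t : kmul (tpow P) (kmul (evolve_mult (@eigen_sum #|S|) (@conj_op #|S|) X t L) (tpow P')) =
    fock_chain (spectral_mx X) t [seq (p.1, event_insertion p.2) | p <- L] by [].
elim: L t => [|[t1 e] L IH] t /=; first by rewrite spec.
by rewrite -IH -spec /conj_op -(evE e) !kA.
Qed.
End ConjugatedOperators.

(** * The complex exponential series *)

Definition exp_partial (K : unitRingType) (M : nat) (w : K) : K :=
  \sum_(r < M) w ^+ r / r`!%:R.

Section ExpCauchyProduct.
Variable K : numFieldType.
Implicit Types a b : K.
Let t i a : K := a ^+ i / i`!%:R.

Lemma exp_partialD N a b : exp_partial N (a + b) =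
  \sum_(i < N) \sum_(j < N) (i + j < N)%N%:R * (t i a * t j b).
Proof.
transitivity (\sum_(r < N) \sum_(i < N) \sum_(j < N) (i + j == r)%N%:R * (t i a * t j b)).
  apply: eq_bigr => r _.
  have inner (i : 'I_N) : \sum_(j < N) (i + j == r)%N%:R * (t i a * t j b) =
      if (i <= r)%N then t i a * t (r - i) b else 0.
    case: ifP => [ir|/negbT ir]; last first.
      rewrite big1 // => j _; case: eqP => [ijr|]; last by rewrite mul0r.
      by rewrite -ijr leq_addr in ir.
    have rN : (r - i < N)%N by rewrite (leq_ltn_trans (leq_subr _ _)).
    rewrite (bigD1 (Ordinal rN)) //= subnKC // eqxx mul1r big1 ?addr0 // => j jr.
    case: eqP => [ijr|]; last by rewrite mul0r.
    by move: jr; rewrite -val_eqE /= -ijr addKn eqxx.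
  under [RHS]eq_bigr do rewrite inner.
  rewrite -big_mkcond /=; transitivity (\sum_(i < r.+1) t i a * t (r - i) b); last first.
    by rewrite (big_ord_widen N (fun i => t i a * t (r - i) b) (ltn_ord r)).
  rewrite addrC exprDn mulr_suml; apply: eq_bigr => i _.
  have ir : (i <= r)%N by rewrite -ltnS.
  have fr0 k : k`!%:R != 0 :> K by rewrite pnatr_eq0 -lt0n fact_gt0.
  rewrite -mulr_natr -(bin_fact ir) !natrM /t.
  have b0 : 'C(r, i)%:R != 0 :> K by rewrite pnatr_eq0 -lt0n bin_gt0.
  by field; rewrite !fr0 b0.
rewrite exchange_big /=; apply: eq_bigr => i _.
rewrite exchange_big /=; apply: eq_bigr => j _.
rewrite -mulr_suml; congr (_ * _).
case: ltnP => ijN; last first.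
  by rewrite big1 // => r _; rewrite gtn_eqF // (leq_trans (ltn_ord r)).
rewrite (bigD1 (Ordinal ijN)) //= eqxx big1 ?addr0 // => r rij.
by rewrite -val_eqE /= in rij; rewrite eq_sym (negPf rij).
Qed.

Lemma exp_partialM N M a b : (M <= N)%N ->
  exp_partial M a * exp_partial M b =
  \sum_(i < N) \sum_(j < N) ((i < M) && (j < M))%N%:R * (t i a * t j b).
Proof.
move=> MN; rewrite /exp_partial !(big_ord_widen N (fun i => _ ^+ i / i`!%:R) MN).
rewrite big_mkcond mulr_suml; apply: eq_bigr => i _.
rewrite [X in _ * X]big_mkcond mulr_sumr; apply: eq_bigr => j _.
by case: ifP; case: ifP; rewrite /= ?mul1r ?mul0r ?mulr0.
Qed.

(** Indices both below [N / 2] have sum below [N], so the terms left over are among those with an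
    index at least [N / 2]. Their absolute values are terms of the same products formed with [|a|]
    and [|b|], where every discarded term is non-negative. *)
Lemma exp_partial_cauchy N a b :
  `|exp_partial N (a + b) - exp_partial N./2 a * exp_partial N./2 b| <=
  exp_partial N `|a| * exp_partial N `|b| -
  exp_partial N./2 `|a| * exp_partial N./2 `|b|.
Proof.
set M := N./2; have MN : (M <= N)%N by rewrite /M; lia.
rewrite exp_partialD !(@exp_partialM N) // -!sumrB.
apply: le_trans (ler_norm_sum _ _ _) _; apply: ler_sum => i _.
rewrite -!sumrB; apply: le_trans (ler_norm_sum _ _ _) _; apply: ler_sum => j _.
rewrite !ltn_ord -!mulrBl normrM.
have -> : `|t i a * t j b| = t i `|a| * t j `|b|.
  by rewrite /t !normrM !normrV ?unitfE ?pnatr_eq0 -?lt0n ?fact_gt0 // !normrX !normr_nat.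
apply: ler_wpM2r.
  by apply: mulr_ge0; apply: divr_ge0; rewrite ?exprn_ge0.
have [/andP[iM jM]|_] := boolP (_ && _).
  have -> : (i + j < N)%N by move: iM jM; rewrite /M; lia.
  by rewrite /= subrr normr0.
by rewrite !subr0; case: ltnP; rewrite ?normr1 ?normr0 ?ler01.
Qed.
End ExpCauchyProduct.

Section ComplexConvergence.
Variable R : realType.
Local Notation C := R[i].
Implicit Types (u v : nat -> C) (a b w : C).

Definition ccvg u a : Prop :=
  (complex.Re (u k) @[k --> \oo] --> complex.Re a) /\
  (complex.Im (u k) @[k --> \oo] --> complex.Im a).

Lemma ccvg_cst a : ccvg (fun=> a) a.
Proof. by split; exact: cvg_cst. Qed.

Lemma eq_ccvg u v a : u =1 v -> ccvg u a -> ccvg v a.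
Proof. by move=> /funext ->. Qed.

Lemma ccvgD u v a b : ccvg u a -> ccvg v b -> ccvg (fun k => u k + v k) (a + b).
Proof.
move=> [ur ui] [vr vi]; split; rewrite raddfD.
  by under eq_fun do rewrite raddfD; exact: cvgD.
by under eq_fun do rewrite raddfD; exact: cvgD.
Qed.

Lemma ccvgM u v a b : ccvg u a -> ccvg v b -> ccvg (fun k => u k * v k) (a * b).
Proof.
have reM (x y : C) : complex.Re (x * y) = complex.Re x * complex.Re y - complex.Im x * complex.Im y.
  by case: x y => [? ?] [].
have imM (x y : C) : complex.Im (x * y) = complex.Re x * complex.Im y + complex.Im x * complex.Re y.
  by case: x y => [? ?] [].
move=> [ur ui] [vr vi]; split; rewrite ?reM ?imM.
  by under eq_fun do rewrite reM; apply: cvgB; exact: cvgM.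
by under eq_fun do rewrite imM; apply: cvgD; exact: cvgM.
Qed.

Lemma ccvg_sum (I : Type) (s : seq I) (u : I -> nat -> C) (a : I -> C) :
  (forall i, ccvg (u i) (a i)) ->
  ccvg (fun k => \sum_(i <- s) u i k) (\sum_(i <- s) a i).
Proof.
move=> ua; elim: s => [|i s IH].
  by rewrite big_nil; apply: eq_ccvg (ccvg_cst 0) => k; rewrite big_nil.
rewrite big_cons; apply: eq_ccvg (ccvgD (ua i) IH) => k.
by rewrite big_cons.
Qed.

Lemma ccvg_near u v a : ccvg u a ->
  (exists e : nat -> R, (e @ \oo --> (0 : R)) /\ forall k, `|v k - u k| <= (e k)%:C) ->
  ccvg v a.
Proof.
move=> [ur ui] [e [e0 uv]].
have small (f : C -> R) : {morph f : x y / x - y} -> (forall x, `|f x|%:C <= `|x|) ->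
    (f (u k) @[k --> \oo] --> f a) -> f (v k) @[k --> \oo] --> f a.
  move=> fB fn fu.
  have d0 : f (v k) - f (u k) @[k --> \oo] --> (0 : R).
    apply: norm_cvg0; apply: squeeze_cvgr (cvg_cst 0) e0.
    near=> k; rewrite normr_ge0 /= -fB -lecR.
    exact: le_trans (fn _) (uv k).
  have -> : (fun k => f (v k)) = (fun k => f (v k) - f (u k) + f (u k)).
    by apply/funext => k; rewrite subrK.
  by rewrite -[f a]add0r; exact: cvgD.
split.
  apply: small ur; first exact: raddfB.
  by move=> x; exact: normc_ge_Re.
apply: small ui; first exact: raddfB.
by move=> [x y]; rewrite normc_def lecR /= -sqrtr_sqr ler_sqrt ?addr_ge0 ?sqr_ge0 // lerDr sqr_ge0.
Unshelve. all: by end_near.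
Qed.

Lemma cexpD a b : cexp (a + b) = cexp a * cexp b.
Proof.
case: a b => [a1 a2] [b1 b2]; rewrite /cexp /= expRD cosD sinD.
by apply/eqP; rewrite eq_complex /=; apply/andP; split; apply/eqP; ring.
Qed.

Lemma cexp0 : cexp (0 : C) = 1.
Proof.
by rewrite /cexp /= expR0 cos0 sin0; apply/eqP; rewrite eq_complex /=; apply/andP; split; apply/eqP; ring.
Qed.

Lemma exp_partial_real (M : nat) (x : R) :
  exp_partial M (x%:C : C) = (exp_partial M x)%:C.
Proof.
rewrite /exp_partial rmorph_sum; apply: eq_bigr => i _ /=.
by rewrite rmorphM rmorphXn fmorphV rmorph_nat.
Qed.

Lemma exp_partial_cvg (x : R) : exp_partial M x @[M --> \oo] --> expR x.
Proof.
have -> : (fun M => exp_partial M x) = series (exp_coeff x).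
  by apply/funext => M; rewrite /exp_partial /series /= big_mkord.
exact: is_cvg_series_exp_coeff.
Qed.

Lemma exp_partial_imag (M : nat) (y : R) :
  exp_partial M ((0 +i* y) : C) = series (cos_coeff y) M +i* series (sin_coeff y) M.
Proof.
have termE r : (0 +i* y : C) ^+ r / r`!%:R = cos_coeff y r +i* sin_coeff y r.
  have sq : (0 +i* y : C) ^+ 2 = (- y ^+ 2)%:C.
    by rewrite expr2; apply/eqP; rewrite eq_complex /=; apply/andP; split; apply/eqP; ring.
  rewrite -[r`!%:R](rmorph_nat (real_complex R)) -fmorphV /= /cos_coeff /sin_coeff /=.
  have [b [h ->]] : exists b : bool, exists h, r = (b + h.*2)%N.
    by exists (odd r), r./2; rewrite odd_double_half.
  rewrite half_bit_double oddD odd_double addbF oddb exprD -mul2n exprM sq -rmorphXn /= [(- y ^+ 2) ^+ h]exprNn.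
  rewrite -exprnP exprD (exprM y 2 h) mul2n.
  case: b => /=; rewrite ?doubleK ?expr1 ?expr0; move: ((y ^+ 2) ^+ h) ((-1) ^+ h) => e s1.
  - by apply/eqP; rewrite eq_complex /=; apply/andP; split; apply/eqP; ring.
  - by apply/eqP; rewrite eq_complex /=; apply/andP; split; apply/eqP; ring.
transitivity (\sum_(r < M) (cos_coeff y r +i* sin_coeff y r)).
  by apply: eq_bigr => r _; exact: termE.
rewrite /series /= !big_mkord; elim: M => [|M IH]; first by rewrite !big_ord0.
by rewrite !big_ord_recr /= IH.
Qed.

(** [cexp] is given by the real exponential, sine and cosine, so the series is known at [x] and at
    [i y] separately. The Cauchy product bound, whose right side tends to [0], joins the two. *)
Lemma cexp_cvg w : ccvg (fun M => exp_partial M w) (cexp w).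
Proof.
case: w => x y; have -> : (x +i* y : C) = x%:C + (0 +i* y).
  by apply/eqP; rewrite eq_complex /= addr0 add0r !eqxx.
pose prod M := exp_partial M (x%:C : C) * exp_partial M (0 +i* y : C).
have prod_cvg : ccvg prod (cexp (x%:C + (0 +i* y))).
  rewrite cexpD; apply: ccvgM.
    have -> : cexp (x%:C : C) = (expR x)%:C.
      by rewrite /cexp /= cos0 sin0; apply/eqP; rewrite eq_complex /=; apply/andP; split; apply/eqP; ring.
    apply: eq_ccvg (_ : ccvg (fun M => (exp_partial M x)%:C) _) => [M|].
      by rewrite exp_partial_real.
    by split => /=; [exact: exp_partial_cvg|exact: cvg_cst].
  have -> : cexp (0 +i* y : C) = cos y +i* sin y.
    by rewrite /cexp /= expR0; apply/eqP; rewrite eq_complex /=; apply/andP; split; apply/eqP; ring.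
  apply: eq_ccvg (_ : ccvg (fun M => series (cos_coeff y) M +i* series (sin_coeff y) M) _) => [M|].
    by rewrite exp_partial_imag.
  by split => /=; rewrite ?unlock; [exact: is_cvg_series_cos_coeff|exact: is_cvg_series_sin_coeff].
have half_oo : M./2 @[M --> \oo] --> \oo.
  apply/cvgnyPge => A; near=> M.
  have /half_leq : (A.*2 <= M)%N by near: M; exact: nbhs_infty_ge.
  by rewrite doubleK.
apply: ccvg_near (_ : ccvg (fun M => prod M./2) _) _.
  by case: prod_cvg => pr pi; split; [exact: cvg_comp pr|exact: cvg_comp pi].
exists (fun N => exp_partial N `|x| * exp_partial N `|y| -
  exp_partial N./2 `|x| * exp_partial N./2 `|y|); split.
  have xy : exp_partial N `|x| * exp_partial N `|y| @[N --> \oo] --> expR `|x| * expR `|y|.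
    by apply: cvgM; exact: exp_partial_cvg.
  rewrite -(subrr (expR `|x| * expR `|y|)); apply: cvgB => //.
  exact: cvg_comp xy.
move=> N; apply: le_trans (exp_partial_cauchy N _ _) _.
have -> : `|x%:C : C| = `|x|%:C.
  by rewrite normc_def /= expr0n addr0 sqrtr_sqr.
have -> : `|0 +i* y : C| = `|y|%:C.
  by rewrite normc_def /= expr0n add0r sqrtr_sqr.
by rewrite !exp_partial_real -!rmorphM -rmorphB.
Unshelve. all: by end_near.
Qed.
End ComplexConvergence.

Section EvolutionConvergence.
Variables (R : realType) (n : nat).
Local Notation C := R[i].
Variables (eps : C) (z : 'I_n -> C) (P P' : 'M[C]_n).
Implicit Types (q : C) (phi : C -> C) (L : seq (R * event n)).
Local Notation trace := (evolution_trace eps z P P').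

Lemma evolve_cvg (E : Type) (I : finType) (alpha : I -> C) (A : E -> I -> I -> C)
    (phi : nat -> C -> C) (psi : C -> C) tau e (L : seq (R * E)) i j :
  (forall x, ccvg (phi ^~ x) (psi x)) ->
  ccvg (fun k => evolve alpha A (phi k) tau e L i j) (evolve alpha A psi tau e L i j).
Proof.
move=> phipsi; elim: L tau e i => [|[t a] L IH] tau e i /=.
  by apply: ccvgM => //; exact: ccvg_cst.
by apply: ccvg_sum => k; apply: ccvgM; [exact: ccvg_cst|exact: IH].
Qed.

(** The trace is a finite linear combination of values of [phi], so pointwise convergence passes to
    it. *)
Lemma evolution_trace_cvg q (phi : nat -> C -> C) psi L :
  (forall x, ccvg (phi ^~ x) (psi x)) ->
  ccvg (fun k => trace q (phi k) L) (trace q psi L).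
Proof.
move=> phipsi; apply: ccvg_sum => S; apply: ccvgM; first exact: ccvg_cst.
do 2!(apply: ccvg_sum => ?; apply: ccvgM; first exact: ccvg_cst).
apply: ccvg_sum => ?; apply: ccvgM; last exact: ccvg_cst.
exact: evolve_cvg.
Qed.

Lemma evolution_trace_linear q (c : C) phi psi L :
  trace q (fun x => c * phi x + psi x) L = c * trace q phi L + trace q psi L.
Proof.
rewrite /evolution_trace mulr_sumr -big_split; apply: eq_bigr => S _ /=.
rewrite [in RHS]mulrCA -mulrDr; congr (_ * _).
do 2!(apply: kmul_linear_r => ? ?).
rewrite /kmul mulr_sumr -big_split; apply: eq_bigr => k _ /=.
by rewrite evolve_linear mulrDl mulrA.
Qed.

Lemma evolution_trace_exp_partial q (T : R) M L :
  trace q (fun x => exp_partial M (T%:C * x)) L =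
  \sum_(r < M) (T ^+ r / r`!%:R)%:C * trace q (fun x => x ^+ r) L.
Proof.
elim: M => [|M IH].
  pose phi0 (x : C) : C := 0; rewrite big_ord0.
  have trace0 : trace q (fun x => -1 * phi0 x + phi0 x) L = 0.
    by rewrite evolution_trace_linear mulN1r addNr.
  rewrite -trace0; apply: eq_evolution_trace => x.
  by rewrite /exp_partial big_ord0 mulr0 addr0.
rewrite big_ord_recr /= -IH addrC -evolution_trace_linear.
apply: eq_evolution_trace => x; rewrite /exp_partial big_ord_recr /= addrC.
congr (_ + _); rewrite exprMn rmorphM rmorphXn fmorphV rmorph_nat /=.
by rewrite mulrAC.
Qed.

Lemma evolution_trace_exp_series q (T : R) L :
  ccvg (fun M => \sum_(r < M) (T ^+ r / r`!%:R)%:C * trace q (fun x => x ^+ r) L)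
    (trace q (fun x => cexp (T%:C * x)) L).
Proof.
apply: eq_ccvg (fun M => evolution_trace_exp_partial q T M L) _.
by apply: evolution_trace_cvg => x; exact: cexp_cvg.
Qed.
End EvolutionConvergence.

(** * Measure and integration on the unit cube *)

Section FinitePatterns.
Context d (S : measurableType d) (R : realType) (I : finType).
Variable p : I -> S -> bool.
Hypothesis mp : forall i, measurable_fun setT (p i).

(** A set depending on finitely many measurable tests is a finite union of cells. Orders of events,
    words and interlacing depend only on comparisons between coordinates, so their measurability
    comes from here. *)
Lemma pattern_measurable (Y : set S) :
  (forall s s', (forall i, p i s = p i s') -> Y s -> Y s') -> measurable Y.
Proof.
move=> Yp; pose cell (e : {ffun I -> bool}) := \bigcap_(i in [set: I]) (p i @^-1` [set e i]).
have mcell e : measurable (cell e).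
  apply: fin_bigcap_measurable; first exact: finite_finset.
  by move=> i _; rewrite -[X in measurable X]setTI; apply: mp.
have -> : Y = \bigcup_(e in [set e | exists2 s, Y s & cell e s]) cell e.
  apply/seteqP; split => [s Ys|s [e [s' Ys' es'] es]].
    exists [ffun i => p i s]; last by move=> i _; rewrite /= ffunE.
    by exists s => // i _; rewrite /= ffunE.
  by apply: Yp Ys' => i; rewrite (es' i Logic.I) (es i Logic.I).
by apply: fin_bigcup_measurable; [exact: finite_finset|move=> e _].
Qed.

Lemma pattern_measurable_fun d' (S' : measurableType d') (f : S -> S') :
  (forall s s', (forall i, p i s = p i s') -> f s = f s') -> measurable_fun setT f.
Proof.
move=> fp _ Y _; rewrite setTI; apply: pattern_measurable => s s' ss' /=.
by rewrite (fp _ _ ss').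
Qed.

Lemma pattern_bounded (f : S -> R) :
  (forall s s', (forall i, p i s = p i s') -> f s = f s') ->
  exists M, forall s, `|f s| <= M.
Proof.
move=> fp; pose val (e : {ffun I -> bool}) : R :=
  if pselect (exists s, forall i, p i s = e i) is left ex then f (projT1 (cid ex)) else 0.
exists (\sum_e `|val e|) => s; pose e := [ffun i => p i s].
rewrite (bigD1 e) //= (_ : f s = val e).
  by rewrite lerDl sumr_ge0.
rewrite /val; case: pselect => [ex|]; last first.
  by case; exists s => i; rewrite ffunE.
by case: (cid ex) => s' /= es'; apply: fp => i; rewrite es' ffunE.
Qed.
End FinitePatterns.

Section LebesgueTuple.
Variable R : realType.
Local Notation RR := (measurableTypeR R).
Local Notation tuples m := (m.-tuple RR).

Definition box m (A : 'I_m -> set RR) : set (tuples m) :=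
  [set s | forall i, A i (tnth s i)].

Lemma measurable_box m (A : 'I_m -> set RR) :
  (forall i, measurable (A i)) -> measurable (box A).
Proof.
move=> mA; have -> : box A = \bigcap_(i in [set: 'I_m]) ((fun s => tnth s i) @^-1` A i).
  by apply/seteqP; split => s sA i; [move=> _; exact: sA|exact: (sA i Logic.I)].
apply: fin_bigcap_measurable; first exact: finite_finset.
by move=> i _; rewrite -[X in measurable X]setTI; apply: measurable_tnth.
Qed.

Lemma lebesgue_tuple_box m (A : 'I_m -> set RR) :
  (forall i, measurable (A i)) ->
  lebesgue_tuple R m (box A) = (\prod_i lebesgue_measure (A i))%E.
Proof.
elim: m A => [|m IH] A mA.
  rewrite big_ord0 /= diracE mem_set //.
  by move=> [].
rewrite big_ord_recl /= /pushforward.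
pose A' : 'I_m -> set RR := fun i => A (lift ord0 i).
have mA' i : measurable (A' i) by exact: mA.
have -> : @tcons R m @^-1` box A = A ord0 `*` box A'.
  apply/seteqP; split => [[x s] /= sA|[x s] /= [Ax sA] i].
    split => /=; first by have := sA ord0.
    by move=> i; have := sA (lift ord0 i); rewrite tnthS.
  case: (unliftP ord0 i) => [j|] ->; last exact: Ax.
  by rewrite tnthS; exact: sA.
by rewrite product_measure1E; [congr (_ * _)%E; exact: IH|exact: mA|exact: measurable_box].
Qed.

Lemma measurable_tuple_boxes m :
  @measurable _ (tuples m) = <<s [set B | exists2 A, (forall i, measurable (A i)) & B = @box m A] >>.
Proof.
apply/seteqP; split; last first.
  apply: smallest_sub; first exact: sigma_algebra_measurable.
  by move=> _ [A mA ->]; exact: measurable_box.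
apply: smallest_sub; first exact: smallest_sigma_algebra.
move=> B; rewrite -bigcup_seq => -[i _ [A mA <-]]; apply: sub_sigma_algebra.
exists (fun j => if j == i then A else setT) => [j|]; first by case: ifP.
rewrite setTI; apply/seteqP; split => s /= sA => [j|].
  by case: eqP => // ->.
by have := sA i; rewrite eqxx.
Qed.

Definition tuple_perm m (sg : 'S_m) (s : tuples m) : tuples m :=
  [tuple tnth s (sg i) | i < m].

Lemma measurable_tuple_perm m (sg : 'S_m) : measurable_fun setT (tuple_perm sg).
Proof.
apply/measurable_fun_tnthP => i.
have -> : (@tnth m RR)^~ i \o tuple_perm sg = (@tnth m RR)^~ (sg i).
  by apply/funext => s /=; rewrite tnth_mktuple.
exact: measurable_tnth.
Qed.

(** Boxes generate the sigma-algebra, are stable under intersection, and have permutation invariant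
    volume; the growing bounded boxes exhaust the space. *)
Lemma lebesgue_tuple_perm m (sg : 'S_m) (X : set (tuples m)) : measurable X ->
  lebesgue_tuple R m (tuple_perm sg @^-1` X) = lebesgue_tuple R m X.
Proof.
move=> mX; apply/esym.
pose G := [set B | exists2 A, (forall i, measurable (A i)) & B = @box m A].
pose g k := @box m (fun=> `[(- k%:R), k%:R]%classic).
have mI (k : nat) : measurable (`[(- k%:R), k%:R]%classic : set RR) by exact: measurable_itv.
pose nu := @measure_function_pushforward__canonical__measure_function_Measure
  _ _ _ _ _ (lebesgue_tuple R m) _ (measurable_tuple_perm sg).
apply: (@measure_unique _ R _ G g (measurable_tuple_boxes m) _ _ _ (lebesgue_tuple R m) nu) => //.
- move=> _ _ [A mA ->] [B mB ->]; exists (fun i => A i `&` B i) => [i|].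
    exact: measurableI.
  apply/seteqP; split => s /= => [[sA sB] i|sAB]; first by split.
  by split => i; have [] := sAB i.
- by move=> k; exists (fun=> `[(- k%:R), k%:R]%classic).
- rewrite -subTset => s _.
  exists (Num.truncn (\sum_i `|tnth s i|)).+1 => // i.
  rewrite /= in_itv /= -ler_norml.
  apply: le_trans (ltW (truncnS_gt _)).
  by rewrite (bigD1 i) //= lerDl sumr_ge0.
- move=> _ [A mA ->]; rewrite /nu /= /pushforward.
  have -> : tuple_perm sg @^-1` box A = box (fun i => A (sg^-1 i)%g).
    apply/seteqP; split => s /= sA i.
      by have := sA (sg^-1 i)%g; rewrite tnth_mktuple permKV.
    by rewrite tnth_mktuple; have := sA (sg i); rewrite permK.
  rewrite !lebesgue_tuple_box //.
  by rewrite [RHS](reindex_inj (@perm_inj _ sg)); apply: eq_bigr => i _; rewrite permK.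
- move=> k.
  have gE : lebesgue_tuple R m (g k) =
      (\prod_(i < m) lebesgue_measure (`[(- k%:R)%R, k%:R]%classic : set RR))%E.
    exact: lebesgue_tuple_box.
  rewrite [X in (X < _)%E]gE ltey_eq; apply/orP; left.
  apply: (big_ind (fun x : \bar R => x \is a fin_num)) => // [x y|i _]; first exact: fin_numM.
  by rewrite [X in X \is a fin_num]lebesgue_measure_itv; case: ifP.
Qed.

End LebesgueTuple.

Section CubeIntegral.
Variable R : realType.
Local Notation RR := (measurableTypeR R).
Local Notation tuples m := (m.-tuple RR).
Local Notation cube m := (@unit_cube R m).
Local Notation mu m := (lebesgue_tuple R m).

Lemma unit_cube_box m : cube m = box (fun=> `[0, 1[%classic : set RR).
Proof.
by apply/seteqP; split => s sI i /=; have := sI i; rewrite /= in_itv.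
Qed.

Lemma measurable_cube m : measurable (cube m).
Proof. by rewrite unit_cube_box; apply: measurable_box => i; exact: measurable_itv. Qed.

Lemma lebesgue_tuple_cube m : mu m (cube m) = 1%E.
Proof.
rewrite unit_cube_box lebesgue_tuple_box => [|i]; last exact: measurable_itv.
apply: big1 => i _; rewrite [LHS]lebesgue_measure_itv /= lte_fin ltr01.
by rewrite oppr0 adde0.
Qed.

(** Bounded and measurable: enough to be integrable over every measurable part of the cube, which
    has mass one. *)
Definition bmeasurable d (S : measurableType d) (f : S -> R) : Prop :=
  measurable_fun setT f /\ exists M, forall s, `|f s| <= M.

Lemma bmeasurable_cst d (S : measurableType d) (c : R) : bmeasurable (fun _ : S => c).
Proof. by split; [exact: measurable_cst|exists `|c|]. Qed.

Lemma bmeasurable_integrable m (f : tuples m -> R) D : bmeasurable f ->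
  measurable D -> D `<=` cube m -> (mu m).-integrable D (EFin \o f).
Proof.
move=> [mf [M fM]] mD DC; apply: measurable_bounded_integrable => //.
- apply: (@le_lt_trans _ _ (mu m (cube m))); last by rewrite lebesgue_tuple_cube ltry.
  by apply: le_measure => //; rewrite inE //; exact: measurable_cube.
- exact: measurable_funTS.
- exists M; split; first exact: num_real.
  by move=> x Mx s _; exact: le_trans (fM s) (ltW Mx).
Qed.

Definition cube_integral m (f : tuples m -> R) : R := \int[mu m]_(s in cube m) f s.

Lemma tcons_cube m : @tcons R m @^-1` cube m.+1 = `[0, 1[%classic `*` cube m.
Proof.
apply/seteqP; split => [[x s] /= sI|[x s] /= [xI sI] i].
  split; first by have := sI ord0; rewrite /= in_itv.
  by move=> i; have := sI (lift ord0 i); rewrite tnthS.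
case: (unliftP ord0 i) => [j|] ->; last by move: xI; rewrite in_itv.
by rewrite tnthS; exact: sI.
Qed.

Lemma cube_integral_param d (S : measurableType d) m (f : S * tuples m -> R) :
  bmeasurable f -> bmeasurable (fun x => cube_integral (fun s => f (x, s))).
Proof.
move=> [mf [M fM]]; pose g x := cube_integral (fun s => f (x, s)).
have bfx x : bmeasurable (fun s => f (x, s)).
  split; last by exists M.
  by apply: (measurableT_comp mf); exact: measurable_pair1.
have intx x : (mu m).-integrable (cube m) (EFin \o (fun s => f (x, s))).
  by apply: bmeasurable_integrable => //; exact: measurable_cube.
have gE x : (g x)%:E = (\int[mu m]_(s in cube m) (f (x, s))%:E)%E.
  rewrite /g /cube_integral /Rintegral fineK //.
  by apply: (integrable_fin_num _ (intx x)); exact: measurable_cube.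
have intM : (mu m).-integrable (cube m) (EFin \o (fun=> M)).
  by apply: bmeasurable_integrable; [exact: bmeasurable_cst|exact: measurable_cube|].
have mg : measurable_fun setT g.
  (* Adding the bound [M] makes the integrand non-negative, so that Tonelli gives the measurability
     of the partial integral. *)
  pose h (p : S * tuples m) : \bar R := ((f p + M) * \1_(cube m) p.2)%:E.
  have mh : measurable_fun setT h.
    apply/measurable_EFinP/measurable_funM; first by apply: measurable_funD.
    by apply: measurableT_comp => //; apply: measurable_indic; exact: measurable_cube.
  have h0 p : (0 <= h p)%E.
    rewrite lee_fin mulr_ge0 // -lerBlDr sub0r.
    by have := fM p; rewrite ler_norml => /andP[].
  have mH : measurable_fun setT (fubini_F (mu m) h) by exact: measurable_fun_fubini_tonelli_F.
  apply/measurable_EFinP.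
  have -> : EFin \o g = (fun x => fubini_F (mu m) h x - M%:E)%E.
    apply/funext => x; rewrite /= gE /fubini_F.
    have -> : (\int[mu m]_s h (x, s) = \int[mu m]_(s in cube m) ((f (x, s))%:E + M%:E))%E.
      rewrite [RHS]integral_mkcond; apply: eq_integral => s _.
      by rewrite patchE /h /= indicE; case: ifP => sC; rewrite ?mulr1 ?mulr0.
    rewrite (integralD _ (intx x) intM); last exact: measurable_cube.
    rewrite integral_cst; last exact: measurable_cube.
    by rewrite [X in (_ * X)%E](lebesgue_tuple_cube m) mule1 addeK.
  exact: emeasurable_funB.
have gM x : `|g x| <= M.
  rewrite /g /cube_integral; apply: le_trans (le_normr_Rintegral _ (intx x)) _.
    exact: measurable_cube.
  apply: (@le_trans _ _ (\int[mu m]_(s in cube m) M)).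
    apply: le_Rintegral; [exact: measurable_cube| |exact: intM|by move=> s _; exact: fM].
    exact: (integrable_norm (intx x)).
  rewrite Rintegral_cst; last exact: measurable_cube.
  by rewrite [X in _ * fine X](lebesgue_tuple_cube m) mulr1.
by split; [exact: mg|exists M].
Qed.

Lemma cube_integral_cons m (f : tuples m.+1 -> R) : bmeasurable f ->
  bmeasurable (fun x : RR => cube_integral (fun s => f (tcons (x, s)))) /\
  cube_integral f =
    \int[@lebesgue_measure R]_(x in `[0, 1[) cube_integral (fun s => f (tcons (x, s))).
Proof.
move=> bf; have [mf [M fM]] := bf.
pose pi := product_measure1 (@lebesgue_measure R) (mu m).
pose D : set (RR * tuples m) := `[0, 1[%classic `*` cube m.
have mD : measurable D by apply: measurableX; [exact: measurable_itv|exact: measurable_cube].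
have piD : pi D = 1%E.
  rewrite /pi /D -tcons_cube.
  have := lebesgue_tuple_cube m.+1; exact.
have mft : measurable_fun setT (f \o @tcons R m).
  by apply: measurableT_comp => //; exact: measurable_tcons.
have intft : pi.-integrable D (EFin \o (f \o @tcons R m)).
  apply: measurable_bounded_integrable => //.
  - by rewrite [X in (X < _)%E]piD ltry.
  - exact: measurable_funTS.
  - exists M; split; first exact: num_real.
    by move=> x Mx s _; exact: le_trans (fM _) (ltW Mx).
pose F := (EFin \o (f \o @tcons R m)) \_ D.
have intF : pi.-integrable setT F by apply/(integrable_mkcond _ mD).
have F12 := integral12_prod_meas1 intF.
pose g x := cube_integral (fun s => f (tcons (x, s))).
have bfx x : bmeasurable (fun s => f (tcons (x, s))).
  split; last by exists M.
  by apply: (measurableT_comp mft); exact: measurable_pair1.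
have intx x : (mu m).-integrable (cube m) (EFin \o (fun s => f (tcons (x, s)))).
  by apply: bmeasurable_integrable => //; exact: measurable_cube.
have gE x : (g x)%:E = (\int[mu m]_(s in cube m) (f (tcons (x, s)))%:E)%E.
  rewrite /g /cube_integral /Rintegral fineK //.
  by apply: (integrable_fin_num _ (intx x)); exact: measurable_cube.
have Fin x : fubini_F (mu m) F x = ((EFin \o g) \_ `[0, 1[%classic) x.
  rewrite /fubini_F /F patchE; case: ifPn => [/set_mem xI|/negP xI].
    rewrite /= gE [RHS]integral_mkcond; apply: eq_integral => s _.
    rewrite !patchE; have [/set_mem sC|/negP sC] := boolP (s \in cube m).
      by rewrite mem_set.
    by rewrite memNset // => -[_ sC']; apply: sC; exact: mem_set.
  rewrite [LHS]integral0_eq // => s _; rewrite patchE; case: ifPn => // /set_mem [xI' _].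
  by case: xI; apply/mem_set.
split.
  apply: (@cube_integral_param _ _ m (f \o @tcons R m)).
  by split; [exact: mft|exists M => p; exact: fM].
rewrite /cube_integral /Rintegral; congr fine.
transitivity (\int[pi]_(p in D) (f (tcons p))%:E)%E.
  have := @integral_pushforward _ _ _ _ R (@tcons R m) (@measurable_tcons R m) pi
    (cube m.+1) (EFin \o f).
  rewrite tcons_cube; apply; [exact/measurable_EFinP|exact: intft|exact: measurable_cube].
transitivity (\int[pi]_p F p)%E; first by rewrite [LHS]integral_mkcond.
apply: (eq_trans (esym F12)).
rewrite [RHS]integral_mkcond; apply: eq_integral => x _.
exact: Fin.
Qed.
End CubeIntegral.

Section BoundedMeasurable.
Context d (S : measurableType d) (R : realType).
Implicit Types f g : S -> R.

Lemma bmeasurableM f g : bmeasurable f -> bmeasurable g -> bmeasurable (fun s => f s * g s).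
Proof.
move=> [mf [M fM]] [mg [N gN]]; split; first exact: measurable_funM.
by exists (M * N) => s; rewrite normrM ler_pM.
Qed.

Lemma bmeasurableD f g : bmeasurable f -> bmeasurable g -> bmeasurable (fun s => f s + g s).
Proof.
move=> [mf [M fM]] [mg [N gN]]; split; first exact: measurable_funD.
by exists (M + N) => s; rewrite (le_trans (ler_normD _ _)) // lerD.
Qed.

Lemma bmeasurable_sum (I : Type) (r : seq I) (f : I -> S -> R) :
  (forall i, bmeasurable (f i)) -> bmeasurable (fun s => \sum_(i <- r) f i s).
Proof.
move=> bf; elim: r => [|i r IH].
  by under eq_fun do rewrite big_nil; exact: bmeasurable_cst.
by under eq_fun do rewrite big_cons; exact: bmeasurableD.
Qed.

Lemma bmeasurable_indic (A : set S) : measurable A -> bmeasurable (\1_A : S -> R).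
Proof.
move=> mA; split; first exact: measurable_indic.
by exists 1 => s; rewrite indicE; case: (_ \in _); rewrite ?normr1 ?normr0.
Qed.

Lemma bmeasurable_comp d' (S' : measurableType d') (h : S' -> S) f :
  bmeasurable f -> measurable_fun setT h -> bmeasurable (f \o h).
Proof.
move=> [mf [M fM]] mh; split; first exact: measurableT_comp.
by exists M => s; exact: fM.
Qed.

Lemma pattern_bmeasurable (I : finType) (p : I -> S -> bool) f :
  (forall i, measurable_fun setT (p i)) ->
  (forall s s', (forall i, p i s = p i s') -> f s = f s') -> bmeasurable f.
Proof.
move=> mp fp; split; first exact: (pattern_measurable_fun mp).
exact: (pattern_bounded fp).
Qed.
End BoundedMeasurable.

Section CubeIntegralTheory.
Variable R : realType.
Local Notation RR := (measurableTypeR R).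
Local Notation tuples m := (m.-tuple RR).
Local Notation cube m := (@unit_cube R m).
Local Notation mu m := (lebesgue_tuple R m).

Lemma cube_has_integral m (f : tuples m -> R) : bmeasurable f ->
  has_integral (mu m) (cube m) f (cube_integral f).
Proof.
by move=> bf; split => //; apply: bmeasurable_integrable => //; exact: measurable_cube.
Qed.

Lemma cube_integral_sum m (I : Type) (r : seq I) (f : I -> tuples m -> R) :
  (forall i, bmeasurable (f i)) ->
  cube_integral (fun s => \sum_(i <- r) f i s) = \sum_(i <- r) cube_integral (f i).
Proof.
move=> bf; have [_ //] := has_integral_sum r (@measurable_cube R m)
  (fun i => cube_has_integral (bf i)).
Qed.

Lemma cube_integralZ m c (f : tuples m -> R) : bmeasurable f ->
  cube_integral (fun s => c * f s) = c * cube_integral f.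
Proof.
by move=> bf; have [_ //] := has_integralZ c (@measurable_cube R m) (cube_has_integral bf).
Qed.

Lemma cube_integral_perm m (sg : 'S_m) (f : tuples m -> R) : bmeasurable f ->
  cube_integral (fun s => f (tuple_perm sg s)) = cube_integral f.
Proof.
move=> bf; have [mf _] := bf.
have preC : tuple_perm sg @^-1` cube m = cube m.
  apply/seteqP; split => s /= sI i; last by rewrite tnth_mktuple; exact: sI.
  by have := sI (sg^-1 i)%g; rewrite tnth_mktuple permKV.
pose nu := @measure_function_pushforward__canonical__measure_function_Measure
  _ _ _ _ _ (mu m) _ (measurable_tuple_perm sg).
rewrite /cube_integral /Rintegral; congr fine; symmetry.
transitivity (\int[nu]_(s in cube m) (f s)%:E)%E.
  apply: eq_measure_integral => A mA _; rewrite [RHS]/= /pushforward.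
  by rewrite lebesgue_tuple_perm.
have := @integral_pushforward _ _ _ _ R (tuple_perm sg) (measurable_tuple_perm sg) (mu m)
  (cube m) (EFin \o f).
rewrite preC; apply; [exact/measurable_EFinP| |exact: measurable_cube].
apply: (@bmeasurable_integrable _ _ (f \o tuple_perm sg)) => //; last exact: measurable_cube.
exact: bmeasurable_comp (measurable_tuple_perm sg).
Qed.

(* the tuples having two equal entries or an entry in [F] *)
Definition degenerate (F : seq R) m : set (tuples m) := [set s : tuples m | ~~ uniq ((s : seq R) ++ F)].

Lemma measurable_nth_cat F m i :
  measurable_fun setT (fun s : tuples m => nth 0 ((s : seq R) ++ F) i : RR).
Proof.
have [im|im] := ltnP i m.
  have -> : (fun s : tuples m => nth 0 ((s : seq R) ++ F) i) = (fun s => tnth s (Ordinal im)).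
    by apply/funext => s; rewrite nth_cat size_tuple im (tnth_nth 0).
  exact: measurable_tnth.
have -> : (fun s : tuples m => nth 0 ((s : seq R) ++ F) i) = (fun=> nth 0 F (i - m)).
  by apply/funext => s; rewrite nth_cat size_tuple ltnNge im.
exact: measurable_cst.
Qed.

Lemma measurable_degenerate F m : measurable (@degenerate F m).
Proof.
pose p (e : 'I_(m + size F) * 'I_(m + size F)) (s : tuples m) : bool :=
  nth 0 ((s : seq R) ++ F) e.1 == nth 0 ((s : seq R) ++ F) e.2.
apply: (@pattern_measurable _ _ _ p) => [e|s s' ss'].
  by apply: measurable_fun_eqr; exact: measurable_nth_cat.
have uniqE (a b : tuples m) : (forall e, p e a = p e b) ->
    uniq ((a : seq R) ++ F) -> uniq ((b : seq R) ++ F).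
  move=> ab /(uniqP 0) ua; apply/(uniqP 0) => i j; rewrite !inE !size_cat !size_tuple => im jm.
  move/eqP => eij; apply: ua; rewrite ?inE ?size_cat ?size_tuple //.
  by apply/eqP; have := ab (Ordinal im, Ordinal jm); rewrite /p /= eij.
by rewrite /degenerate /=; apply: contra; apply: uniqE => e; rewrite ss'.
Qed.

(** Slicing along the first coordinate [x]: outside the finite set [F] the slice is the degenerate
    set for [x :: F], which is null by induction, and [F] itself is null. *)
Lemma lebesgue_tuple_degenerate F m : uniq F -> mu m (@degenerate F m) = 0%E.
Proof.
elim: m F => [|m IH] F uF.
  rewrite /= diracE memNset // /degenerate /=.
  by rewrite uF.
rewrite /= /pushforward /product_measure1 /=.
rewrite (_ : (fun x => _) = (fun x : RR => if x \in F then mu m setT else 0%E)); last first.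
  apply/funext => x /=.
  have -> : xsection (@tcons R m @^-1` @degenerate F m.+1) x = @degenerate (x :: F) m.
    have uniqC (s : tuples m) : uniq (x :: (s : seq R) ++ F) = uniq ((s : seq R) ++ x :: F).
      by rewrite -(cat1s x F) uniq_catCA.
    by apply/seteqP; split => s; rewrite /xsection /degenerate /= inE -uniqC.
  case: ifPn => xF; last by apply: IH; rewrite /= uF andbT.
  congr (mu m _); apply/seteqP; split => // s _; rewrite /degenerate /=.
  by rewrite cat_uniq /= xF /= !andbF.
have mF : measurable ([set` F] : set RR).
  by apply: countable_measurable => [x|]; [exact: measurable_set1|exact/finite_set_countable/finite_seq].
have F0 : lebesgue_measure ([set` F] : set RR) = 0%E.
  exact/countable_lebesgue_measure0/finite_set_countable/finite_seq.
rewrite (ge0_negligible_integral mF measurableT) //.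
- by rewrite integral0_eq // => x [_ /= /negP /negPf ->].
- apply: measurable_fun_ifT => //; apply: (measurable_fun_bool true) => //.
  by rewrite setTI; exact: mF.
- by move=> x _; case: ifP.
Qed.

(** Coinciding coordinates, and coordinates at the observation times [F], form a null set;
    identities between integrals therefore reduce to generic times. *)
Lemma cube_integral_generic m F (f g : tuples m -> R) : uniq F ->
  bmeasurable f -> bmeasurable g ->
  (forall s, cube m s -> uniq ((s : seq R) ++ F) -> f s = g s) ->
  cube_integral f = cube_integral g.
Proof.
move=> uF bf bg fg; rewrite /cube_integral /Rintegral; congr fine.
have mN := @measurable_degenerate F m; have N0 := lebesgue_tuple_degenerate m uF.
rewrite (negligible_integral mN (@measurable_cube R m) _ N0); last first.
  by apply: bmeasurable_integrable => //; exact: measurable_cube.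
rewrite [RHS](negligible_integral mN (@measurable_cube R m) _ N0); last first.
  by apply: bmeasurable_integrable => //; exact: measurable_cube.
apply: eq_integral => s /set_mem[sC sN]; rewrite fg //.
by apply: contrapT => /negP sN'; apply: sN.
Qed.

Definition cat_pair b r (s : tuples b) (t : tuples r) : tuples (b + r) := [tuple of s ++ t].

Lemma measurable_cat_pair b r :
  measurable_fun setT (fun p : tuples b * tuples r => cat_pair p.1 p.2).
Proof.
apply/measurable_fun_tnthP => i.
have [ib|ib] := ltnP i b.
  have -> : (@tnth _ RR)^~ i \o (fun p : tuples b * tuples r => cat_pair p.1 p.2) =
      (@tnth _ RR)^~ (Ordinal ib) \o fst.
    by apply/funext => p /=; rewrite !(tnth_nth 0) /= nth_cat size_tuple ib.
  by apply: measurableT_comp => //; exact: measurable_tnth.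
have ir : (i - b < r)%N by rewrite ltn_subLR.
have -> : (@tnth _ RR)^~ i \o (fun p : tuples b * tuples r => cat_pair p.1 p.2) =
    (@tnth _ RR)^~ (Ordinal ir) \o snd.
  by apply/funext => p /=; rewrite !(tnth_nth 0) /= nth_cat size_tuple ltnNge ib.
by apply: measurableT_comp => //; exact: measurable_tnth.
Qed.

Lemma bmeasurable_cat b r (f : tuples (b + r) -> R) : bmeasurable f ->
  bmeasurable (fun s : tuples b => cube_integral (fun t : tuples r => f (cat_pair s t))).
Proof.
move=> bf; apply: (@cube_integral_param _ _ _ _ (f \o (fun p => cat_pair p.1 p.2))).
exact: bmeasurable_comp (@measurable_cat_pair b r).
Qed.

Lemma cube_integral0 (f : tuples 0 -> R) : cube_integral f = f [tuple].
Proof.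
rewrite /cube_integral /Rintegral (_ : cube 0 = setT); last first.
  by apply/seteqP; split => // s _ [].
have -> : f = (fun=> f [tuple]) by apply/funext => s; rewrite tuple0.
rewrite -[RHS]/(fine (f [tuple])%:E); congr fine.
have := @integral_dirac _ (tuples 0) [tuple] R setT measurableT (fun=> (f [tuple])%:E) (measurable_cst _).
by rewrite diracE mem_set // mul1e.
Qed.

Lemma bmeasurable_tcons m (f : tuples m.+1 -> R) (x : RR) :
  bmeasurable f -> bmeasurable (fun s => f (tcons (x, s))).
Proof.
move=> bf; apply: (@bmeasurable_comp _ _ _ _ _ (fun s => tcons (x, s)) f bf).
by apply: (measurableT_comp (@measurable_tcons R m)); exact: measurable_pair1.
Qed.

Lemma cube_integral_cat b r (f : tuples (b + r) -> R) : bmeasurable f ->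
  cube_integral f =
  cube_integral (fun s : tuples b => cube_integral (fun t => f (cat_pair s t))).
Proof.
elim: b f => [|b IH] f bf.
  by rewrite cube_integral0; congr cube_integral; apply/funext => t; congr f; apply: val_inj.
have [_ ->] := cube_integral_cons bf.
have [_ ->] := cube_integral_cons (bmeasurable_cat bf).
apply: eq_Rintegral => x _; rewrite IH; last exact: bmeasurable_tcons.
congr cube_integral; apply/funext => s; congr cube_integral; apply/funext => t.
by congr f; apply: val_inj.
Qed.
End CubeIntegralTheory.

(** * Beads placed at independent uniform times *)

Section InsertBy.
Context {E : Type}.
Implicit Types (lt : rel E) (e : E) (s : seq E).

(** Insertion along an abstract comparison separates labels from times: the resulting word depends
    on the times through their comparisons only. *)
Fixpoint insert_by lt e s : seq E :=
  if s is e' :: s' then if lt e e' then e :: s else e' :: insert_by lt e s' else [:: e].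

Definition insert_all_by lt s r := foldl (fun s e => insert_by lt e s) s r.

Lemma eq_insert_all_by lt lt' s r : lt =2 lt' -> insert_all_by lt s r = insert_all_by lt' s r.
Proof.
move=> eqlt; rewrite /insert_all_by; elim: r s => //= e r IH s; rewrite -IH; congr foldl.
by elim: s => //= e' s IHs; rewrite eqlt IHs.
Qed.

Lemma map_insert_all_by (R : realType) (F : Type) (g : E -> R * F) s r :
  [seq g e | e <- insert_all_by (fun e e' => (g e).1 < (g e').1) s r] =
  insert_all [seq g e | e <- s] [seq g e | e <- r].
Proof.
rewrite /insert_all_by /insert_all; elim: r s => //= e r IH s; rewrite IH; congr foldl.
by elim: s => //= e' s IHs; case: ifP => //= _; rewrite IHs.
Qed.
End InsertBy.

Section TimedFrom.
Variables (R : realType) (E : Type).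
Implicit Types (L : seq (R * E)).

Lemma timed_from_insert (t : R) e L (tau : R) : tau <= t -> t <= 1 -> timed_from tau L ->
  timed_from tau (insert_timed (t, e) L).
Proof.
elim: L tau => [|p L IH] tau taut t1 /=; first by move=> _; rewrite taut.
case/andP => taup fromp; case: ltP => tp /=; first by rewrite taut fromp (ltW tp).
by rewrite taup IH.
Qed.

Lemma timed_from_insert_all L s : timed_from 0 L ->
  (forall p, 0 <= (tnth (in_tuple s) p).1 <= 1) -> timed_from 0 (insert_all L s).
Proof.
elim: s L => // [[t e] s] IH L L0 s01; apply: IH => [|i].
  by have /= /andP[? ?] := s01 ord0; apply: timed_from_insert.
by have := s01 (lift ord0 i); rewrite !(tnth_nth (t, e)).
Qed.
End TimedFrom.

Section BeadAverage.
Variables (R : realType) (n : nat) (q eps : R).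
Local Notation C := R[i].
Local Notation RR := (measurableTypeR R).
Implicit Types (L : seq (R * event n)).

Definition list_weight L : R := config_weight q eps [seq p.2 | p <- L].

Definition bead_seq r (t : r.-tuple R) (w : 'I_r -> 'I_n) : seq (R * event n) :=
  [seq (tnth t i, inr (w i)) | i <- enum 'I_r].

Definition with_beads L r (t : r.-tuple R) (w : 'I_r -> 'I_n) :=
  insert_all L (bead_seq t w).

Lemma bead_seq_cons r (x : R) (t : r.-tuple R) (w : 'I_r.+1 -> 'I_n) :
  bead_seq (tcons (x, t)) w = (x, inr (w ord0)) :: bead_seq t (fun i => w (lift ord0 i)).
Proof.
rewrite /bead_seq enum_ordSl /= -map_comp; congr cons.
by apply: eq_map => i /=; rewrite tnthS.
Qed.

Lemma with_beads_pattern L r (w : 'I_r -> 'I_n) (t t' : r.-tuple R) :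
  (forall i j : 'I_(r + size L),
     (nth 0 (t ++ [seq p.1 | p <- L]) i < nth 0 (t ++ [seq p.1 | p <- L]) j) =
     (nth 0 (t' ++ [seq p.1 | p <- L]) i < nth 0 (t' ++ [seq p.1 | p <- L]) j)) ->
  [seq p.2 | p <- with_beads L t w] = [seq p.2 | p <- with_beads L t' w].
Proof.
move=> tt'.
pose g (u : r.-tuple R) (e : 'I_r + 'I_(size L)) : R * event n := match e with
  | inl i => (tnth u i, inr (w i)) | inr j => tnth (in_tuple L) j end.
have gE u : with_beads L u w = [seq g u e | e <- insert_all_by (fun e e' => (g u e).1 < (g u e').1)
    [seq inr j | j <- enum 'I_(size L)] [seq inl i | i <- enum 'I_r]].
  have gL : [seq g u e | e <- [seq inr j | j <- enum 'I_(size L)]] = L.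
    by rewrite -[RHS](map_tnth_enum (in_tuple L)) -map_comp; apply: eq_map.
  rewrite map_insert_all_by gL /with_beads /bead_seq; congr (insert_all _ _).
  by rewrite -[RHS]map_comp.
have g1 u e : (g u e).1 = nth 0 (u ++ [seq p.1 | p <- L]) (unsplit e).
  case: e => j /=; rewrite nth_cat size_tuple.
    by rewrite ltn_ord; exact: tnth_nth.
  rewrite ltnNge leq_addr /= addKn (nth_map (tnth (in_tuple L) j)) ?ltn_ord //.
  by congr fst; exact: tnth_nth.
rewrite !gE -!map_comp (eq_insert_all_by (lt' := fun e e' => (g t' e).1 < (g t' e').1)).
  by apply: eq_map => -[].
by move=> e e'; rewrite !g1 tt'.
Qed.

(** The [r] times range over the whole cube, not over ordered tuples; this removes the factor
    [1 / r!] from the evolution. *)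
Definition bead_average L r : R :=
  \sum_(w : {ffun 'I_r -> 'I_n}) cube_integral (fun t : r.-tuple RR => list_weight (with_beads L t w)).

Lemma bmeasurable_with_beads L r (w : 'I_r -> 'I_n) :
  bmeasurable (fun t : r.-tuple RR => list_weight (with_beads L t w)).
Proof.
pose F := [seq p.1 | p <- L].
pose p (e : 'I_(r + size L) * 'I_(r + size L)) (s : r.-tuple RR) : bool :=
  nth 0 ((s : seq R) ++ F) e.1 < nth 0 ((s : seq R) ++ F) e.2.
apply: (@pattern_bmeasurable _ _ _ _ p) => [e|s s' ss'].
  by apply: measurable_fun_ltr; exact: measurable_nth_cat.
by congr config_weight; apply: with_beads_pattern => i j; exact: (ss' (i, j)).
Qed.

Section Spectrum.
Variables (z : 'I_n -> C) (P P' : 'M[C]_n).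
Hypothesis PP' : P *m P' = 1%:M.
Hypothesis P'P : P' *m P = 1%:M.
Hypothesis sum_beads :
  \sum_h ev_mx eps%:C (inr h) = P *m diag_mx (\row_j z j) *m P'.

Lemma config_weightC (L : seq (event n)) :
  config_weight q%:C eps%:C L = (config_weight q eps L)%:C.
Proof.
rewrite /config_weight rmorph_sum; apply: eq_bigr => S _ /=.
rewrite rmorphM rmorphXn /=; congr (_ * _); case: ifP => _; last by rewrite rmorph0.
by rewrite rmorphXn rmorphM rmorphXn rmorphN1.
Qed.

Lemma sum_ffun_cons r (V : nmodType) (G : ('I_r.+1 -> 'I_n) -> V) :
  (forall w w', w =1 w' -> G w = G w') ->
  \sum_(w : {ffun 'I_r.+1 -> 'I_n}) G w = \sum_h \sum_(w : {ffun 'I_r -> 'I_n})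
    G (fun i => if unlift ord0 i is Some j then w j else h).
Proof.
move=> eqG; rewrite pair_bigA /=.
pose c (p : 'I_n * {ffun 'I_r -> 'I_n}) : {ffun 'I_r.+1 -> 'I_n} :=
  [ffun i => if unlift ord0 i is Some j then p.2 j else p.1].
rewrite (reindex c) /=; first by apply: eq_bigr => p _; apply: eqG => i; rewrite ffunE.
exists (fun w => (w ord0, [ffun j => w (lift ord0 j)])) => [[h w] _|w _].
  rewrite /c; congr pair; first by rewrite ffunE unlift_none.
  by apply/ffunP => j; rewrite !ffunE liftK.
by apply/ffunP => i; rewrite ffunE; case: unliftP => [j ->|->] //=; rewrite ffunE.
Qed.

(** Induction on [r] for all lists at once: integrating over the first bead multiplies [phi] by [x],
    starting from [phi = 1] for the bare word. The integrals compared are complex on one side and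
    real on the other, so the imaginary parts vanish. *)
Lemma bead_average_trace L r : timed_from 0 L ->
  (bead_average L r)%:C = evolution_trace eps%:C z P P' q%:C (fun x => x ^+ r) L.
Proof.
elim: r L => [|r IH] L L0.
  rewrite /bead_average (bigD1 (ffun0 (card_ord 0))) //= big1 => [|w]; last first.
    by case/eqP; apply/ffunP => -[].
  rewrite addr0 cube_integral0 (@eq_evolution_trace _ _ _ _ _ _ _ _ (fun=> 1)) => [|x]; last by rewrite expr0.
  by rewrite evolution_trace1 // config_weightC /list_weight /with_beads /bead_seq enum_ord0.
have := evolution_trace_insert P'P sum_beads q%:C (fun x => x ^+ r) L0.
rewrite (@eq_evolution_trace _ _ _ _ _ _ _ _ (fun x => x ^+ r.+1)) => [|x]; last by rewrite exprS.
case=> [[_ reE] [_ imE]].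
have mI : measurable (`[0, 1[ : set (measurableTypeR R)) by exact: measurable_itv.
have [_ avgE] : has_integral (@lebesgue_measure R) `[0, 1[
    (fun t => \sum_h bead_average (insert_timed (t, inr h) L) r) (bead_average L r.+1).
  have Fint w : has_integral (@lebesgue_measure R) `[0, 1[
      (fun x => cube_integral (fun s : r.-tuple RR => list_weight (with_beads L (tcons (x, s)) w)))
      (cube_integral (fun t : r.+1.-tuple RR => list_weight (with_beads L t w))).
    have [bm ->] := cube_integral_cons (bmeasurable_with_beads L w); split => //.
    case: bm => mf [M fM]; apply: measurable_bounded_integrable => //.
    - have := @lebesgue_measure_itv R `[0, 1[; rewrite /= lte_fin ltr01 oppr0 adde0 => leb1.
      by rewrite [X in (X < _)%E]leb1 ltry.
    - exact: measurable_funTS.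
    exists M; split; first exact: num_real.
    by move=> x Mx s _; exact: le_trans (fM s) (ltW Mx).
  have [avg_int avgE] := has_integral_sum (index_enum {ffun 'I_r.+1 -> 'I_n}) mI Fint.
  rewrite -[bead_average L r.+1]avgE; apply: (has_integral_eq _ (conj avg_int erefl)) => t _.
  rewrite (sum_ffun_cons (G := fun w => cube_integral (fun s : r.-tuple RR => list_weight (with_beads L (tcons (t, s)) w)))).
    apply: eq_bigr => h _; apply: eq_bigr => w _; congr cube_integral; apply/funext => s.
    rewrite /with_beads bead_seq_cons unlift_none /insert_all /=; congr (list_weight (foldl _ _ _)).
    by apply: eq_map => i; rewrite liftK.
  move=> w w' ww'; congr cube_integral; apply/funext => s; congr (list_weight (insert_all _ _)).
  by apply: eq_map => i; rewrite ww'.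
have evoE t : t \in (`[0, 1[%classic : set R) ->
    \sum_h evolution_trace eps%:C z P P' q%:C (fun x => x ^+ r) (insert_timed (t, inr h) L) =
    (\sum_h bead_average (insert_timed (t, inr h) L) r)%:C.
  rewrite inE /= in_itv /= => /andP[t0 t1]; rewrite rmorph_sum; apply: eq_bigr => h _.
  by rewrite /= IH // timed_from_insert // ltW.
have Re_evo : \int[@lebesgue_measure R]_(t in `[0, 1[) complex.Re (\sum_h
    evolution_trace eps%:C z P P' q%:C (fun x => x ^+ r) (insert_timed (t, inr h) L)) =
    bead_average L r.+1 by rewrite -avgE; apply: eq_Rintegral => t tI; rewrite evoE.
have Im_evo : \int[@lebesgue_measure R]_(t in `[0, 1[) complex.Im (\sum_h
    evolution_trace eps%:C z P P' q%:C (fun x => x ^+ r) (insert_timed (t, inr h) L)) = 0.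
  have [_ I0] := has_integral0 (@lebesgue_measure R) `[0, 1[.
  by rewrite -[RHS]I0; apply: eq_Rintegral => t tI; rewrite evoE.
by apply/eqP; rewrite eq_complex /= -reE -imE Re_evo Im_evo !eqxx.
Qed.
End Spectrum.
End BeadAverage.

(** * Closed words at generic times *)

Section GenericPaths.
Variables (R : realType) (n : nat).
Implicit Types (c : 'I_n -> int) (p : R * event n) (L : seq (R * event n)).

Definition is_bead (e : event n) : bool := if e is inr _ then true else false.

Definition jump (e : event n) (h : 'I_n) : int :=
  if e is inr g then (h == ordS g)%:Z - (h == g)%:Z else 0.

Lemma advanceE c e : advance c e = fun h => c h + jump e h.
Proof.
by apply/funext => h; case: e => [[]g|g] /=; rewrite ?addr0 // addrA.
Qed.

Lemma admissible_bead c g :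
  admissible c (inr g) = (c (ordS g) == 0) && (c g + jump (inr g) g == 0).
Proof. by rewrite /admissible advanceE. Qed.

(** Strict as soon as a bead is involved; two observations may share a time. *)
Definition generic_le p p' : bool :=
  if is_bead p.2 || is_bead p'.2 then p.1 < p'.1 else p.1 <= p'.1.

Definition generic_pair p p' : bool := (is_bead p.2 || is_bead p'.2) ==> (p.1 != p'.1).

Lemma generic_leW p p' : generic_le p p' -> p.1 <= p'.1.
Proof. by rewrite /generic_le; case: ifP => // _ /ltW. Qed.

Lemma perm_insert_timed p L : perm_eq (insert_timed p L) (p :: L).
Proof.
elim: L => //= p' L IH; case: ifP => // _.
by rewrite (perm_trans (y := p' :: p :: L)) ?perm_cons // -cat1s -(cat1s p) perm_catCA.
Qed.

Lemma perm_insert_all L s : perm_eq (insert_all L s) (s ++ L).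
Proof.
rewrite /insert_all; elim: s L => //= p s IH L; apply: (perm_trans (IH _)).
rewrite (perm_trans (y := s ++ p :: L)) ?perm_cat2l ?perm_insert_timed //.
by rewrite -cat1s perm_catCA.
Qed.

Lemma pairwise_insert_timed p L : all (generic_pair p) L -> pairwise generic_le L ->
  pairwise generic_le (insert_timed p L).
Proof.
elim: L => //= p' L IH /andP[pp' pL] /andP[p'L Lp]; case: ltP => /= tp.
  rewrite p'L Lp !andbT; apply/andP; split; first by rewrite /generic_le tp (ltW tp) if_same.
  apply/allP => q qL; have q0 := generic_leW (allP p'L q qL).
  by have tq := lt_le_trans tp q0; rewrite /generic_le tq (ltW tq) if_same.
rewrite IH // andbT (perm_all _ (perm_insert_timed p L)) /= p'L andbT.
move: pp'; rewrite /generic_pair /generic_le orbC; case: ifP => //= _ ne.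
by rewrite lt_neqAle eq_sym ne.
Qed.

Lemma pairwise_insert_all L s : pairwise generic_le L ->
  (forall p, p \in s -> all (generic_pair p) L) -> pairwise generic_pair s ->
  pairwise generic_le (insert_all L s).
Proof.
rewrite /insert_all; elim: s L => //= p s IH L Lp sL /andP[ps ss].
apply: IH => //; first by apply: pairwise_insert_timed => //; apply: sL; rewrite mem_head.
move=> p' p's; rewrite (perm_all _ (perm_insert_timed p L)) /= sL ?inE ?p's ?orbT // andbT.
by have := allP ps p' p's; rewrite /generic_pair orbC eq_sym.
Qed.

Definition occ_at c L (tau : R) (h : 'I_n) : int :=
  c h + \sum_(p <- L | p.1 < tau) jump p.2 h.

(** Ties occur between observations only, and these leave the occupation unchanged. So the
    occupation met by an event is a function of its time, and admissibility along the list becomes a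
    condition on each event that is insensitive to reordering. *)
Lemma admissible_path_at c L : pairwise generic_le L ->
  admissible_path c [seq p.2 | p <- L] = all (fun p => admissible (occ_at c L p.1) p.2) L.
Proof.
elim: L c => //= p L IH c /andP[pL Lp]; rewrite IH //; congr (_ && _).
  congr admissible; apply/funext => h; rewrite /occ_at big_cons ltxx big1_seq ?addr0 // => q /andP[qp qL].
  have := allP pL q qL; rewrite /generic_le; case: ifP => [_ /(lt_trans qp)|]; first by rewrite ltxx.
  by case: (q.2) => [//|g]; rewrite orbT.
apply: eq_in_all => q qL; congr admissible; apply/funext => h.
rewrite advanceE /occ_at big_cons; have := allP pL q qL; rewrite /generic_le.
case: (ltP p.1 q.1) => [_ _|_]; first by rewrite addrA.
by case: (p.2) => // a _; rewrite addr0.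
Qed.

Lemma occupation_after_at c L h :
  occupation_after c [seq p.2 | p <- L] h = c h + \sum_(p <- L) jump p.2 h.
Proof.
rewrite /occupation_after; elim: L c => [|p L IH] c /=; first by rewrite big_nil addr0.
by rewrite IH advanceE big_cons addrA.
Qed.

Lemma path_closed_at c L L' : pairwise generic_le L -> perm_eq L L' ->
  path_closed c [seq p.2 | p <- L] =
    all (fun p => admissible (occ_at c L' p.1) p.2) L' &&
    [forall h, \sum_(p <- L') jump p.2 h == 0].
Proof.
move=> Lp LL'; rewrite /path_closed admissible_path_at // (perm_all _ LL'); congr (_ && _).
  apply: eq_all => p; congr admissible; apply/funext => h.
  by rewrite /occ_at (perm_big _ LL').
apply: eq_forallb => h; rewrite occupation_after_at (perm_big _ LL') /=.
by rewrite -subr_eq0 addrAC subrr add0r.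
Qed.

Section Beads.
Variables (N : nat) (t : N.-tuple R) (w : 'I_N -> 'I_n).

Definition nlt (h : 'I_n) (tau : R) : nat := #|[pred i | (w i == h) && (tnth t i < tau)]|.
Definition nbeads (h : 'I_n) : nat := #|[pred i | w i == h]|.

Lemma sum_jump (P : pred 'I_N) (g : 'I_n) :
  \sum_(i | P i) jump (inr (w i)) (ordS g) =
  #|[pred i | (w i == g) && P i]|%:Z - #|[pred i | (w i == ordS g) && P i]|%:Z.
Proof.
have cnt (h : 'I_n) : #|[pred i | (w i == h) && P i]|%:Z = \sum_(i | P i) (h == w i)%:Z.
  rewrite -natz -sum1_card natr_sum big_mkcond [RHS]big_mkcond; apply: eq_bigr => i _.
  by rewrite inE eq_sym; case: eqP; case: ifP.
by rewrite !cnt -sumrB; apply: eq_bigr => i _; rewrite /jump (inj_eq (@ordS_inj n)).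
Qed.

(** Occupation of string [g + 1] just before [tau]: a bead on [g] raises it and a bead on [g + 1]
    lowers it. *)
Definition string_occ (S : {set 'I_n}) (g : 'I_n) (tau : R) : int :=
  (ordS g \notin S)%:Z + (nlt g tau)%:Z - (nlt (ordS g) tau)%:Z.

Definition observed (L : seq (R * event n)) (occ : 'I_n -> R -> int) : bool :=
  all (fun p => match p.2 with
    | inl (inl h) => occ (ord_pred h) p.1 == 1
    | inl (inr h) => occ (ord_pred h) p.1 == 0
    | inr h => false end) L.

Variable Lx : seq (R * event n).
Hypothesis Lx_le : pairwise generic_le Lx.
Hypothesis Lx_bead : all (fun p => ~~ is_bead p.2) Lx.
Hypothesis t_uniq : uniq (t ++ undup [seq p.1 | p <- Lx]).

Lemma pairwise_with_beads : pairwise generic_le (with_beads Lx t w).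
Proof.
apply: pairwise_insert_all => //.
  move=> p /mapP[i _ ->]; apply/allP => p' p'L; rewrite /generic_pair /=.
  move: t_uniq; rewrite cat_uniq => /and3P[_ /hasPn tL _].
  have := tL p'.1; rewrite mem_undup (map_f fst p'L) => /(_ isT) /=; apply: contraNneq => <-; exact: mem_tnth.
rewrite pairwise_map.
have : uniq [seq tnth t i | i <- enum 'I_N].
  by rewrite map_tnth_enum; move: t_uniq; rewrite cat_uniq => /andP[].
by rewrite uniq_pairwise pairwise_map; apply: sub_pairwise => i j /= ij; rewrite /generic_pair /= ij.
Qed.

(** A bead on [w i] finds the next string empty, and leaves its own string empty; the [jump] in the
    second condition takes the bead itself into account. *)
Definition bead_admissible (S : {set 'I_n}) : bool := [forall i,
  (string_occ S (w i) (tnth t i) == 0) &&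
  (string_occ S (ord_pred (w i)) (tnth t i) + jump (inr (w i)) (w i) == 0)].

Definition strings_closed (S : {set 'I_n}) : bool :=
  [&& bead_admissible S, observed Lx (string_occ S) & [forall g, nbeads g == nbeads (ordS g)]].

Lemma occ_at_with_beads S g tau :
  occ_at (occupation_of S) (bead_seq t w ++ Lx) tau (ordS g) = string_occ S g tau.
Proof.
rewrite /occ_at big_cat /= [X in _ + (_ + X)]big1_seq ?addr0; last first.
  move=> p /andP[_ pL]; have := allP Lx_bead p pL; rewrite /is_bead /jump.
  by case: (p.2).
by rewrite /bead_seq big_map big_enum_cond /= sum_jump /string_occ /occupation_of addrA.
Qed.

Lemma path_closed_with_beads S :
  path_closed (occupation_of S) [seq p.2 | p <- with_beads Lx t w] = strings_closed S.
Proof.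
rewrite (path_closed_at _ pairwise_with_beads (perm_insert_all _ _)) all_cat.
have occE h tau : occ_at (occupation_of S) (bead_seq t w ++ Lx) tau h = string_occ S (ord_pred h) tau.
  by rewrite -occ_at_with_beads ord_predK.
rewrite /strings_closed -andbA; congr [&& _, _ & _].
- rewrite /bead_seq all_map; apply/allP/forallP => [adm i|adm i _].
    by have := adm i (mem_enum _ i); rewrite -/(is_bead _) [preim _ _ _]admissible_bead !occE ordSK.
  by have := adm i; rewrite [preim _ _ _]admissible_bead !occE ordSK.
- apply: eq_in_all => p pL; have := allP Lx_bead p pL.
  by case: p pL => tau [[h|h]|h] //= _ _; rewrite occE.
have sumE g : \sum_(p <- bead_seq t w ++ Lx) jump p.2 (ordS g) = (nbeads g)%:Z - (nbeads (ordS g))%:Z.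
  rewrite big_cat /= [X in _ + X]big1_seq ?addr0; last first.
    move=> p /andP[_ pL]; have := allP Lx_bead p pL; rewrite /is_bead /jump.
    by case: (p.2).
  rewrite /bead_seq big_map big_enum /= sum_jump; congr (Posz _ - Posz _);
    by apply: eq_card => i; rewrite !inE andbT.
apply/forallP/forallP => [bal g|bal h].
  by have := bal (ordS g); rewrite sumE subr_eq0.
by rewrite -[h]ord_predK sumE subr_eq0; exact: bal.
Qed.

Lemma wraps_with_beads :
  wraps [seq p.2 | p <- with_beads Lx t w] = #|[pred i | (w i).+1 == n]|.
Proof.
rewrite /wraps count_map; have /seq.permP -> := perm_insert_all Lx (bead_seq t w).
rewrite count_cat /bead_seq count_map.
rewrite [X in (_ + X)%N](_ : _ = 0%N) ?addn0.
  by rewrite -sum1_card -sum1_count big_enum_cond; apply: eq_bigl => i; rewrite inE.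
apply/eqP; rewrite -leqn0 leqNgt -has_count; apply/hasPn => p pL.
by have := allP Lx_bead p pL; rewrite /is_bead /=; case: (p.2).
Qed.

Lemma list_weight_with_beads (q eps : R) :
  list_weight q eps (with_beads Lx t w) = \sum_(S : {set 'I_n}) q ^+ #|~: S| *
    (if strings_closed S then ((-1) ^+ #|S|.-1 * eps) ^+ #|[pred i | (w i).+1 == n]| else 0).
Proof.
by apply: eq_bigr => S _; rewrite path_closed_with_beads wraps_with_beads.
Qed.
End Beads.
End GenericPaths.

(** * Interlacing expressed by ranks *)

Section Ranks.
Variable k : nat.

Lemma card_ord_ltn m : (m <= k)%N -> #|[pred j : 'I_k | (j < m)%N]| = m.
Proof.
by move=> mk; rewrite -sum1_card -(big_ord_widen k (fun=> 1%N) mk) sum1_card card_ord.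
Qed.

Lemma ltn_card_down (P : pred 'I_k) (i : 'I_k) :
  (forall j j' : 'I_k, (j <= j')%N -> P j' -> P j) -> (i < #|P|)%N = P i.
Proof.
move=> Pdown; apply/idP/idP => [|Pi]; last first.
  rewrite -{1}(@card_ord_ltn i.+1) //; apply/subset_leq_card/fintype.subsetP => j.
  by rewrite !inE ltnS => /Pdown; apply.
apply: contraLR => nPi; rewrite -leqNgt -[X in (_ <= X)%N](card_ord_ltn (ltnW (ltn_ord i))).
apply/subset_leq_card/fintype.subsetP => j; rewrite !inE ltnNge; apply: contraL => ij.
by apply: contra nPi; exact: Pdown.
Qed.
End Ranks.

Section StringPair.
Variables (R : realType) (k : nat).
Implicit Types u v : 'I_k -> R.

Definition count_lt u (tau : R) : nat := #|[pred i | u i < tau]|.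
Definition count_le u (tau : R) : nat := #|[pred i | u i <= tau]|.

Definition string_increasing u := forall i j : 'I_k, (i < j)%N -> u i < u j.

Lemma string_increasing_le u (i j : 'I_k) : string_increasing u -> (i <= j)%N -> u i <= u j.
Proof. by move=> incr_u; rewrite leq_eqVlt => /predU1P[/ord_inj ->//|/incr_u/ltW]. Qed.

Lemma ltn_count_lt u tau (i : 'I_k) : string_increasing u -> (i < count_lt u tau)%N = (u i < tau).
Proof.
move=> incr_u; rewrite /count_lt ltn_card_down // => j j' jj' /=.
exact/le_lt_trans/string_increasing_le.
Qed.

Lemma ltn_count_le u tau (i : 'I_k) : string_increasing u -> (i < count_le u tau)%N = (u i <= tau).
Proof.
move=> incr_u; rewrite /count_le ltn_card_down // => j j' jj' /=.
exact/le_trans/string_increasing_le.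
Qed.

Lemma count_le_k u tau : (count_le u tau <= k)%N.
Proof. by rewrite -[X in (_ <= X)%N]card_ord; exact: max_card. Qed.

Lemma count_lt_k u tau : (count_lt u tau <= k)%N.
Proof. by rewrite -[X in (_ <= X)%N]card_ord; exact: max_card. Qed.

Variables u v : 'I_k -> R.
Hypotheses (incr_u : string_increasing u) (incr_v : string_increasing v).

(** Both interlacing patterns say that bead [i] of one string has [i + o] beads of the next string
    strictly before it, with [o = 0] here and [o = 1] in the other pattern. In this form they
    coincide with the emptiness of the next string at a bead, [o] being the occupation of that
    string at the start. *)
Lemma interlaced_leP : interlaced_le u v <-> forall i, count_lt v (u i) = i.
Proof.
split=> [[uv vu] i|uvE].
  apply/eqP; rewrite eqn_leq; apply/andP; split.
    by rewrite leqNgt ltn_count_lt // -leNgt.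
  case: i => -[|i] ik //=; have ik' := ltnW ik.
  by rewrite (ltn_count_lt _ (Ordinal ik')) // vu.
split=> [i|i j ij]; first by rewrite leNgt -ltn_count_lt // uvE ltnn.
by rewrite -ltn_count_lt // uvE ij.
Qed.

Lemma interlaced_gtP : interlaced_gt u v <-> forall i, count_lt v (u i) = i.+1.
Proof.
split=> [[vu uv] i|uvE].
  apply/eqP; rewrite eqn_leq ltn_count_lt // vu andbT.
  rewrite leqNgt; apply/negP => ic; have ik := leq_trans ic (count_lt_k _ _).
  by move: ic; rewrite (ltn_count_lt _ (Ordinal ik)) // ltNge uv.
split=> [i|i j ij]; first by rewrite -ltn_count_lt // uvE.
by rewrite leNgt -ltn_count_lt // uvE ij ltnn.
Qed.

Variable o : bool.
Hypothesis uvE : forall i, count_lt v (u i) = (i + o)%N.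

(** [count_le u tau + o - count_le v tau] is the occupation of the string of [v]. It lies in {0, 1}:
    the first bead of [u] after [tau] bounds the beads of [v] up to [tau] from above, and the last
    bead of [u] up to [tau] bounds them from below. *)
Lemma count_interlaced tau :
  (count_le v tau <= count_le u tau + o)%N /\ (count_le u tau + o <= (count_le v tau).+1)%N.
Proof.
split.
  rewrite leqNgt; apply/negP => lt_uv; have vk := count_le_k v tau.
  have uk : (count_le u tau < k)%N by lia.
  have := ltn_count_le tau (Ordinal uk) incr_u; rewrite ltnn => /esym/negbT; rewrite -ltNge => tau_u.
  have : (count_le v tau <= count_lt v (u (Ordinal uk)))%N.
    by apply/subset_leq_card/fintype.subsetP => j; rewrite !inE => /le_lt_trans; apply.
  by rewrite uvE /=; lia.
case E : (count_le u tau) => [|m]; first by case: (o).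
have mk : (m < k)%N by have := count_le_k u tau; rewrite E.
have um : u (Ordinal mk) <= tau by rewrite -ltn_count_le // E /=.
have : (count_lt v (u (Ordinal mk)) <= count_le v tau)%N.
  by apply/subset_leq_card/fintype.subsetP => j; rewrite !inE => /lt_le_trans /(_ um)/ltW.
by rewrite uvE /=; lia.
Qed.

(** At a bead of [v] the occupation of its string is zero, since [v j] ends the occupied stretch;
    were it one, a bead of [u] would come too late for its rank. *)
Lemma count_interlaced_bead j : (count_le u (v j) + o)%N = (count_le v (v j))%N.
Proof.
have [le1 le2] := count_interlaced (v j); apply/eqP; rewrite eqn_leq le1 andbT leqNgt; apply/negP => lt1.
have vj : count_le v (v j) = j.+1.
  apply/eqP; rewrite eqn_leq ltn_count_le // lexx andbT leqNgt; apply/negP => jc.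
  have jk := leq_trans jc (count_le_k _ _).
  by move: jc; rewrite (ltn_count_le _ (Ordinal jk)) // leNgt incr_v.
have mk : (j.+1 - o < k)%N by have := count_le_k u (v j); lia.
have : u (Ordinal mk) <= v j by rewrite -ltn_count_le //=; lia.
by rewrite leNgt -ltn_count_lt // uvE /=; lia.
Qed.

(** The witness is the last bead of [u] up to [tau], or, when there is none, the last bead of the
    string, whose occupied stretch then runs through time [0]. *)
Lemma count_interlaced_occupied tau : (0 < k)%N ->
  ((exists2 i, u i <= tau & forall j, v j < u i \/ tau < v j) \/
   (exists2 i, tau < u i & forall j, tau < v j < u i)) <->
  (count_le v tau < count_le u tau + o)%N.
Proof.
move=> k0; split.
  case=> [[i ui uv]|[i ui uv]].
    have : (i < count_le u tau)%N by rewrite ltn_count_le.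
    have : (count_le v tau <= count_lt v (u i))%N.
      by apply/subset_leq_card/fintype.subsetP => j; rewrite !inE; case: (uv j) => // vj /(lt_le_trans vj); rewrite ltxx.
    by rewrite uvE; lia.
  have -> : count_le v tau = 0%N.
    by apply: eq_card0 => j; rewrite !inE leNgt; have /andP[-> _] := uv j.
  have : count_lt v (u i) = k.
    by rewrite -[RHS]card_ord; apply: eq_card => j; rewrite !inE; have /andP[_ ->] := uv j.
  by rewrite uvE; have := ltn_ord i; lia.
move=> lt_vu; case E : (count_le u tau) => [|m].
  right; have km : (k.-1 < k)%N by lia.
  exists (Ordinal km) => [|j]; first by rewrite ltNge -ltn_count_le // E.
  rewrite [tau < _]ltNge -ltn_count_le // -ltn_count_lt // uvE /=; have := ltn_ord j; lia.
left; have mk : (m < k)%N by have := count_le_k u tau; rewrite E.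
exists (Ordinal mk) => [|j]; first by rewrite -ltn_count_le // E /=.
case: (ltP (v j) (u (Ordinal mk))) => [|uj]; first by left.
right; rewrite ltNge -ltn_count_le //.
by move: uj; rewrite leNgt -ltn_count_lt // uvE /=; lia.
Qed.
End StringPair.

(** * Occupied points and bead arrays *)

Section Occupied.
Variables (R : realType) (n : nat).
Local Notation point := (R * 'I_n)%type.
Implicit Types (X : set point) (a b tau : R).

Definition fwd a b : R := b - a + (b < a)%R%:R.

Lemma fwd_itv a b : 0 <= a < 1 -> 0 <= b < 1 -> 0 <= fwd a b < 1.
Proof. by rewrite /fwd => ? ?; case: ltP => /= ?; lra. Qed.

Lemma mod1_itv a : 0 <= a < 1 -> mod1 a = a.
Proof.
move=> /andP[a0 a1]; rewrite /mod1 (_ : Num.floor a = 0) ?subr0 //.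
by apply/eqP; rewrite floor_eq // a0 add0r.
Qed.

Lemma mod1_fwd a b : 0 <= a < 1 -> 0 <= b < 1 -> mod1 (a + fwd a b) = b.
Proof.
move=> a01 b01; rewrite /fwd /mod1; case: ltP => /= ba.
  have -> : a + (b - a + 1) = b + 1 by ring.
  have -> : Num.floor (b + 1) = 1; last by rewrite addrK.
  by apply/eqP; rewrite floor_eq //; lra.
have -> : a + (b - a + 0) = b by ring.
exact: mod1_itv.
Qed.

Lemma fwd_mod1 a c : 0 <= a < 1 -> 0 <= c < 1 ->
  0 <= mod1 (a + c) < 1 /\ fwd a (mod1 (a + c)) = c.
Proof.
move=> a01 c01; have [ac|ac] := ltP (a + c) 1.
  by rewrite mod1_itv; [|lra]; split; [lra|rewrite /fwd; case: ltP => /=; lra].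
have -> : mod1 (a + c) = a + c - 1.
  rewrite /mod1 (_ : Num.floor (a + c) = 1) //.
  by apply/eqP; rewrite floor_eq //; lra.
by split; [lra|rewrite /fwd; case: ltP => /=; lra].
Qed.

(** Walking forward from [u i], the time [tau] must come before every bead [v j]. The two
    alternatives are a walk that reaches [tau] directly and one that passes through time [1]. *)
Lemma occupied_byP X (k : nat) (u v : 'I_k -> R) h tau : (0 < k)%N ->
  (forall i, 0 <= u i < 1) -> (forall j, 0 <= v j < 1) ->
  (forall a, X (a, h) <-> exists i, a = u i) ->
  (forall b, X (b, ordS h) <-> exists j, b = v j) -> 0 <= tau < 1 ->
  occupied_by X (tau, ordS h) <->
    (exists2 i, u i <= tau & forall j, v j < u i \/ tau < v j) \/
    (exists2 i, tau < u i & forall j, tau < v j < u i).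
Proof.
move=> k0 u01 v01 Xu Xv tau01.
have fwdE i j : (fwd (u i) tau < fwd (u i) (v j)) =
    if u i <= tau then (v j < u i) || (tau < v j) else tau < v j < u i.
  rewrite /fwd; have := u01 i; have := v01 j.
  by case: (ltP tau (u i)) => /=; case: (ltP (v j) (u i)) => /=; case: (ltP tau (v j)) => /=; lra.
apply: (iff_trans (B := exists i, forall j, fwd (u i) tau < fwd (u i) (v j))).
  split.
    case=> -[a h'] [g [c [Xa [g01 Xg gmin] /andP[c0 cg] yE]]].
    have tauE := congr1 fst yE; have hE := ordS_inj (congr1 snd yE); rewrite /= in tauE hE; subst h'.
    move: Xa g01 Xg gmin tauE => /= /Xu[i ->] g01 Xg gmin tauE; exists i => j.
    have c01 : 0 <= c < 1 by lra.
    have [_] := fwd_mod1 (u01 i) c01; rewrite -tauE => ->; apply: (lt_le_trans cg).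
    by apply: gmin; [exact: fwd_itv|rewrite mod1_fwd //; apply/Xv; exists j].
  case=> i tau_i; pose j0 : 'I_k := [arg min_(j < Ordinal k0) fwd (u i) (v j)]%O.
  have minP j : fwd (u i) (v j0) <= fwd (u i) (v j).
    by rewrite /j0; case: arg_minP => // j1 _; apply.
  exists (u i, h), (fwd (u i) (v j0)), (fwd (u i) tau); split => /=.
  - by apply/Xu; exists i.
  - split; first exact: fwd_itv.
      by rewrite /= mod1_fwd //; apply/Xv; exists j0.
    move=> c c01 /Xv[j jE]; have [_ <-] := fwd_mod1 (u01 i) c01; rewrite jE; exact: minP.
  - by have /andP[-> _] := fwd_itv (u01 i) tau01; exact: tau_i.
  by rewrite mod1_fwd.
split.
  case=> i tau_i; case: (leP (u i) tau) => ui; [left|right]; exists i => // j.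
    by have := tau_i j; rewrite fwdE ui => /orP.
  by have := tau_i j; rewrite fwdE leNgt ui.
case=> -[i ui uv]; exists i => j; rewrite fwdE.
  by rewrite ui; apply/orP.
by rewrite leNgt ui /=.
Qed.
End Occupied.

Section BeadArrays.
Variables (R : realType) (n k : nat).
Implicit Types (a : 'I_n -> 'I_k -> R).

Definition leb_strings a h : bool := [forall i, a h i <= a (ordS h) i] &&
  [forall i : 'I_k, forall j : 'I_k, (j == i.+1 :> nat) ==> (a (ordS h) i < a h j)].

Definition gtb_strings a h : bool := [forall i, a (ordS h) i < a h i] &&
  [forall i : 'I_k, forall j : 'I_k, (j == i.+1 :> nat) ==> (a h i <= a (ordS h) j)].

Definition sorted_array a : bool := [forall h, forall i, 0 <= a h i < 1] &&
  [forall h, forall i : 'I_k, forall j : 'I_k, (i < j)%N ==> (a h i < a h j)].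

Definition bead_array a : bool :=
  sorted_array a && [forall h, leb_strings a h || gtb_strings a h].

(** The pairs of neighbouring strings in the second pattern; their number is the occupation
    number. *)
Definition gt_count a : nat := #|[pred h | gtb_strings a h]|.

Lemma leb_stringsP a h : reflect (interlaced_le (a h) (a (ordS h))) (leb_strings a h).
Proof.
apply: (iffP andP) => -[A B]; split.
- by move=> i; apply: (forallP A).
- by move=> i j ij; have /forallP/(_ j) := forallP B i; rewrite ij eqxx.
- by apply/forallP.
by apply/forallP => i; apply/forallP => j; apply/implyP => /eqP; exact: B.
Qed.

Lemma gtb_stringsP a h : reflect (interlaced_gt (a h) (a (ordS h))) (gtb_strings a h).
Proof.
apply: (iffP andP) => -[A B]; split.
- by move=> i; apply: (forallP A).
- by move=> i j ij; have /forallP/(_ j) := forallP B i; rewrite ij eqxx.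
- by apply/forallP.
by apply/forallP => i; apply/forallP => j; apply/implyP => /eqP; exact: B.
Qed.

Lemma sorted_arrayP a : reflect ((forall h i, 0 <= a h i < 1) /\ forall h, string_increasing (a h))
  (sorted_array a).
Proof.
apply: (iffP andP) => -[A B]; split.
- by move=> h; apply/forallP; exact: (forallP A).
- by move=> h i j; have /forallP/(_ i)/forallP/(_ j)/implyP := forallP B h.
- by apply/forallP => h; apply/forallP.
by apply/forallP => h; apply/forallP => i; apply/forallP => j; apply/implyP; exact: B.
Qed.

Lemma bead_arrayP a : reflect (is_bead_array a) (bead_array a).
Proof.
apply: (iffP andP).
  case=> /sorted_arrayP[A B] /forallP C; split => //.
  by move=> h; case/orP: (C h) => [/leb_stringsP|/gtb_stringsP]; [left|right].
case=> A B C; split; first by apply/sorted_arrayP.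
by apply/forallP => h; case: (C h) => [/leb_stringsP ->//|/gtb_stringsP ->]; rewrite orbT.
Qed.

Hypothesis k_gt0 : (0 < k)%N.

Lemma gtb_rank a h (o : bool) : (forall h, string_increasing (a h)) ->
  (forall i, count_lt (a (ordS h)) (a h i) = (i + o)%N) ->
  gtb_strings a h = o /\ (leb_strings a h || gtb_strings a h).
Proof.
move=> incr; case: o => aE.
  have -> : gtb_strings a h.
    by apply/gtb_stringsP/interlaced_gtP => // i; rewrite aE addn1.
  by rewrite orbT.
have -> : leb_strings a h.
  by apply/leb_stringsP/interlaced_leP => // i; rewrite aE addn0.
split=> //; apply/negP => /gtb_stringsP; rewrite (interlaced_gtP (a h) (incr (ordS h))) => /(_ (Ordinal k_gt0)).
by rewrite aE addn0 /=; lia.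
Qed.

Lemma bead_array_rank a h i : bead_array a ->
  count_lt (a (ordS h)) (a h i) = (i + gtb_strings a h)%N.
Proof.
case/andP => /sorted_arrayP[_ incr] /forallP/(_ h).
case: gtb_stringsP => [gt _|_].
  by rewrite /= addn1; move: i; apply/interlaced_gtP.
by rewrite orbF addn0 => /leb_stringsP le; move: i; apply/interlaced_leP.
Qed.

(** Occupation of string [h + 1] at [tau]. Beads at [tau] itself are counted, in line with occupied
    stretches that contain their starting point and exclude their end. *)
Definition array_occ a h tau : int :=
  (gtb_strings a h)%:Z + (count_le (a h) tau)%:Z - (count_le (a (ordS h)) tau)%:Z.

Lemma array_occ01 a h tau : bead_array a -> array_occ a h tau = 0 \/ array_occ a h tau = 1.
Proof.
move=> ba; have /andP[/sorted_arrayP[_ incr] _] := ba.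
have [] := count_interlaced (incr h) (fun i => bead_array_rank h i ba) tau.
by rewrite /array_occ; lia.
Qed.

Lemma occupied_array a h tau : bead_array a -> 0 <= tau < 1 ->
  occupied (configuration_of_beads (array_beads a)) (tau, ordS h) <-> array_occ a h tau = 1.
Proof.
move=> ba tau01; have /andP[/sorted_arrayP[a01 incr] _] := ba.
rewrite /= (occupied_byP (u := a h) (v := a (ordS h)) k_gt0) //.
rewrite (count_interlaced_occupied (incr h) (incr (ordS h)) (fun i => bead_array_rank h i ba) _ k_gt0).
have [] := count_interlaced (incr h) (fun i => bead_array_rank h i ba) tau.
by rewrite /array_occ; lia.
Qed.

Lemma sum_ordS (F : 'I_n -> int) : \sum_h F (ordS h) = \sum_h F h.
Proof. by rewrite [RHS](reindex (@ordS n)) //; apply: onW_bij; exact: ordS_bij. Qed.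

(** Summed over all strings, the bead counts cancel around the cycle and only the initial
    occupations remain; this also explains why the number does not depend on time. *)
Lemma occupation_number_array a l : (0 < n)%N -> bead_array a ->
  occupation_number_is (configuration_of_beads (array_beads a)) l <-> gt_count a = l.
Proof.
move=> n0 ba.
suff occE tau : 0 <= tau < 1 -> #|[pred h : 'I_n |
    `[< occupied (configuration_of_beads (array_beads a)) (tau, h) >]]| = gt_count a.
  split=> [/(_ 0)|gl tau tau01]; last by rewrite occE.
  by rewrite lexx ltr01 => <- //; rewrite occE // lexx ltr01.
move=> tau01; apply/eqP; rewrite -eqz_nat; apply/eqP.
have card_sum (P : pred 'I_n) : #|P|%:Z = \sum_h (P h)%:Z.
  rewrite -natz -sum1_card natr_sum big_mkcond; apply: eq_bigr => i _.
  by rewrite /in_mem /=; case: (P i).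
rewrite /gt_count !card_sum -[LHS]sum_ordS.
transitivity (\sum_h array_occ a h tau).
  apply: eq_bigr => h _ /=; have := occupied_array h ba tau01.
  have occ01 := array_occ01 h tau ba; case: asboolP => [occ|nocc] [to1 of1]; first by rewrite to1.
  by case: occ01 => [-> //|/of1/nocc].
rewrite /array_occ sumrB big_split /= (sum_ordS (fun h => (count_le (a h) tau)%:Z)).
by rewrite addrK.
Qed.
End BeadArrays.

(** * From words to bead arrays *)

Section StringsOfWord.
Variables (R : realType) (n k N : nat) (t : N.-tuple R) (w : 'I_N -> 'I_n).
Variables (s : 'I_n -> 'I_k -> 'I_N) (Lx : seq (R * event n)).
Hypothesis ws : forall h i, w (s h i) = h.
Hypothesis s_surj : forall j, exists i, j = s (w j) i.
Hypothesis k_gt0 : (0 < k)%N.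
Hypothesis n_gt0 : (0 < n)%N.
Local Notation a := (fun h i => tnth t (s h i)).
Hypothesis a_sorted : sorted_array a.

Let incr h : string_increasing (a h).
Proof. by have /sorted_arrayP[_] := a_sorted; exact. Qed.

Let s_inj h : injective (s h).
Proof.
move=> i j ij; apply: ord_inj; apply/eqP; rewrite eqn_leq; apply/andP.
by split; rewrite leqNgt; apply/negP => /(@incr h) /=; rewrite ij ltxx.
Qed.

Lemma card_string (P : pred R) h :
  #|[pred j | (w j == h) && P (tnth t j)]| = #|[pred i | P (a h i)]|.
Proof.
rewrite -(fintype.card_image (@s_inj h)); apply: eq_card => j; rewrite !inE; apply/andP/fintype.imageP.
  by case=> /eqP wj Pj; have [i jE] := s_surj j; exists i; rewrite ?inE -wj -jE.
by case=> i Pi ->; rewrite ws.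
Qed.

Lemma nlt_array h tau : nlt t w h tau = count_lt (a h) tau.
Proof. exact: (card_string (fun x => x < tau)). Qed.

Lemma nbeads_array h : nbeads w h = k.
Proof.
transitivity #|[pred j | (w j == h) && predT (tnth t j)]|; first by apply: eq_card => j; rewrite !inE andbT.
by rewrite card_string -[RHS]card_ord; apply: eq_card.
Qed.

Lemma count_lt_self h i : count_lt (a h) (a h i) = i.
Proof.
apply/eqP; rewrite eqn_leq leqNgt ltn_count_lt // ltxx /=.
case: i => -[//|i] ik; have ik' := ltnW ik.
by rewrite (ltn_count_lt _ (Ordinal ik')) //; exact: incr.
Qed.

Definition array_holes : {set 'I_n} := [set g | ~~ gtb_strings a (ord_pred g)].

Lemma strings_closed_rank S h i : strings_closed t w Lx S ->
  count_lt (a (ordS h)) (a h i) = (i + (ordS h \notin S))%N.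
Proof.
case/and3P => /forallP/(_ (s h i))/andP[/eqP + _] _ _.
by rewrite ws /string_occ !nlt_array count_lt_self; lia.
Qed.

(** Emptiness of the next string at each bead fixes all ranks, hence the interlacing pattern of each
    pair of strings, and the pattern in turn fixes the initial holes. *)
Lemma strings_closed_bead_array S : strings_closed t w Lx S ->
  bead_array a /\ S = array_holes.
Proof.
move=> cS; have rank h := gtb_rank k_gt0 incr (fun i => strings_closed_rank h i cS).
split; first by rewrite /bead_array a_sorted; apply/forallP => h; have [] := rank h.
by apply/setP => g; rewrite inE; have [-> _] := rank (ord_pred g); rewrite ord_predK negbK.
Qed.

Hypothesis t_uniq : uniq (t ++ undup [seq p.1 | p <- Lx]).

(** For an interlaced array the conditions at the beads hold by the rank identities. At observation
    times no bead is present, so strict and weak counts agree and only the observations remain to be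
    tested. *)
Lemma strings_closed_array : bead_array a ->
  strings_closed t w Lx array_holes = observed Lx (array_occ a).
Proof.
move=> ba.
have oE h : (ordS h \notin array_holes) = gtb_strings a h by rewrite inE ordSK negbK.
have tU : uniq t by move: t_uniq; rewrite cat_uniq => /andP[].
have count_at h i : count_le (a h) (tnth t i) = (nlt t w h (tnth t i) + (h == w i))%N.
  transitivity #|[pred j | (w j == h) && (tnth t j <= tnth t i)]|.
    by symmetry; exact: (card_string (fun x => x <= tnth t i) h).
  rewrite /nlt.
  have [->|hi] := eqVneq h (w i); last first.
    rewrite addn0; apply: eq_card => j; rewrite !inE; case: eqP => //= wj.
    rewrite le_eqVlt; case: eqP => //= tij; case/eqP: hi; rewrite -wj; congr w.
    by move/tuple_uniqP: tU; apply.
  rewrite (cardD1 i) !inE eqxx lexx /= addnC; congr addn; apply: eq_card => j.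
  rewrite !inE; case: (w j == w i); rewrite ?andbF //= lt_neqAle; congr andb.
  by congr negb; apply/eqP/eqP => [->//|]; move/tuple_uniqP: tU; apply.
have bal : [forall g, nbeads w g == nbeads w (ordS g)].
  by apply/forallP => g; rewrite !nbeads_array.
rewrite /strings_closed bal andbT (_ : bead_admissible _ _ _) /=; last first.
  apply/forallP => j; apply/andP; split.
    have [i jE] := s_surj j; rewrite {2}jE /string_occ oE !nlt_array.
    rewrite -[tnth t (s _ _)]/(a (w j) i) count_lt_self (bead_array_rank _ _ ba); lia.
  set p := ord_pred (w j); have wjE : w j = ordS p by rewrite ord_predK.
  have [i jE] := s_surj j.
  have := count_interlaced_bead (incr p) (@incr (ordS p)) (fun i => bead_array_rank p i ba) i.
  rewrite -wjE -jE !count_at eqxx /string_occ -wjE wjE oE /jump eqxx -wjE.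
  have -> : (w j == ordS (w j)) = (p == w j) by rewrite {1}wjE (inj_eq (@ordS_inj n)).
  by case: (p == w j) => /=; lia.
apply: eq_in_all => q qL; have tq i : tnth t i != q.1.
  move: t_uniq; rewrite cat_uniq => /and3P[_ /hasPn tL _].
  by have := tL q.1; rewrite mem_undup (map_f fst qL) => /(_ isT) /=; apply: contraNneq => <-; exact: mem_tnth.
have occE g : string_occ t w array_holes g q.1 = array_occ a g q.1.
  rewrite /string_occ /array_occ oE !nlt_array.
  by congr (_ + Posz _ - Posz _); apply: eq_card => i; rewrite !inE lt_neqAle tq.
by case: q.2 => [[g|g]|g]; rewrite ?occE.
Qed.

(** A single set of holes contributes to the weight, with [n - gt_count] elements. *)
Lemma list_weight_array (q eps : R) :
  pairwise (@generic_le R n) Lx -> all (fun p => ~~ is_bead p.2) Lx ->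
  list_weight q eps (with_beads Lx t w) =
    (bead_array a && observed Lx (array_occ a))%:R *
    (q ^+ gt_count a * ((-1) ^+ (n - gt_count a).-1 * eps) ^+ k).
Proof.
move=> Lp Lb; rewrite list_weight_with_beads //.
have [ba|nba] /= := boolP (bead_array a); last first.
  rewrite mul0r big1 // => S _; case: ifP; rewrite ?mulr0 // => /strings_closed_bead_array[ba].
  by rewrite ba in nba.
rewrite (bigD1 array_holes) //= big1 ?addr0 => [|S SH]; last first.
  case: ifP; rewrite ?mulr0 // => /strings_closed_bead_array[_ SE].
  by rewrite SE eqxx in SH.
rewrite strings_closed_array //; case: ifP => _; rewrite ?mulr0 ?mul0r // mul1r.
have holesC : #|~: array_holes| = gt_count a.
  rewrite /gt_count -[RHS](fintype.card_image (@ordS_inj n)); apply: eq_card => g; rewrite !inE negbK.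
  apply/idP/fintype.imageP => [gt|[h gt ->]]; last by rewrite ordSK.
  by exists (ord_pred g); rewrite ?ord_predK.
(* Wraps are the beads on the last string, which carries [k] beads like every other one. *)
have lastE : #|[pred i | (w i).+1 == n]| = k.
  have n1 : (n.-1 < n)%N by lia.
  rewrite -(nbeads_array (Ordinal n1)); apply: eq_card => i; rewrite !inE -val_eqE /=.
  by apply/eqP/eqP; lia.
have holes_card : #|array_holes| = (n - gt_count a)%N.
  by have := cardsC array_holes; rewrite holesC card_ord; lia.
by rewrite lastE holesC holes_card.
Qed.
End StringsOfWord.

Section StringOrder.
Variables (R : realType) (n k : nat).
Local Notation N := (n * k)%N.
Implicit Types (t : N.-tuple R) (w : 'I_N -> 'I_n).

Definition string_pos (j : 'I_N) : 'I_n * 'I_k := enum_val (cast_ord (esym (mxvec_cast n k)) j).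

Lemma string_posK j : mxvec_index (string_pos j).1 (string_pos j).2 = j.
Proof.
by rewrite /mxvec_index -surjective_pairing /string_pos enum_valK cast_ordKV.
Qed.

Lemma mxvec_indexK h i : string_pos (mxvec_index h i) = (h, i).
Proof. by rewrite /string_pos /mxvec_index cast_ordK enum_rankK. Qed.

Lemma mxvec_index_inj h i h' i' : mxvec_index h i = mxvec_index h' i' :> 'I_N -> (h, i) = (h', i').
Proof. by move=> e; rewrite -!mxvec_indexK e. Qed.

Definition string_of (j : 'I_N) : 'I_n := (string_pos j).1.

Definition sorting t w (sg : 'S_N) : bool :=
  [forall j, w (sg j) == string_of j] && sorted_array (array_of_tuple (tuple_perm sg t)).

Definition equidistributed w : bool := [forall h, nbeads w h == k].

Section Word.
Variables (t : N.-tuple R) (w : 'I_N -> 'I_n).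

Lemma sorting_string sg h i : sorting t w sg -> w (sg (mxvec_index h i)) = h.
Proof. by case/andP => /forallP/(_ (mxvec_index h i))/eqP -> _; rewrite /string_of mxvec_indexK. Qed.

Lemma sorting_surj sg j : sorting t w sg -> exists i, j = sg (mxvec_index (w j) i).
Proof.
case/andP => /forallP/(_ ((sg^-1%g : {perm _}) j))/eqP; rewrite permKV /string_of => wj _.
by exists (string_pos ((sg^-1%g : {perm _}) j)).2; rewrite wj string_posK permKV.
Qed.

Lemma sorting_array sg : sorting t w sg ->
  sorted_array (fun h i => tnth t (sg (mxvec_index h i))).
Proof.
case/andP => _; congr (is_true (sorted_array _)).
by apply/funext => h; apply/funext => i; rewrite /array_of_tuple tnth_mktuple.
Qed.

Lemma sorting_equidistributed sg : sorting t w sg -> equidistributed w.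
Proof.
move=> sgS; apply/forallP => h; apply/eqP.
apply: (@nbeads_array R n k N t w (fun h i => sg (mxvec_index h i))).
- by move=> g i; exact: sorting_string.
- by move=> j; exact: sorting_surj.
exact: sorting_array.
Qed.

Lemma sorting_rank sg h i : sorting t w sg ->
  nlt t w h (tnth t (sg (mxvec_index h i))) = i.
Proof.
move=> sgS; rewrite (@nlt_array R n k N t w (fun h i => sg (mxvec_index h i))).
- exact: (@count_lt_self R n k N t (fun h i => sg (mxvec_index h i)) (sorting_array sgS)).
- by move=> g j; exact: sorting_string.
- by move=> j; exact: sorting_surj.
exact: sorting_array.
Qed.

Hypothesis t_uniq : uniq t.

Lemma nlt_lt j j' : w j = w j' -> tnth t j < tnth t j' ->
  (nlt t w (w j) (tnth t j) < nlt t w (w j') (tnth t j'))%N.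
Proof.
move=> wj tj; rewrite /nlt -wj; apply/proper_card/properP; split.
  by apply/fintype.subsetP => i; rewrite !inE => /andP[-> /lt_trans]; apply.
by exists j; rewrite !inE eqxx ?tj // ltxx.
Qed.

Lemma nlt_inj j j' : w j = w j' ->
  nlt t w (w j) (tnth t j) = nlt t w (w j') (tnth t j') -> j = j'.
Proof.
move=> wj rj; move/tuple_uniqP: t_uniq; apply; apply/eqP; rewrite eq_le !leNgt; apply/andP.
by split; apply/negP => /nlt_lt; rewrite rj ltnn => /(_ _) H; have := H _; rewrite ?wj => /(_ erefl).
Qed.

Lemma sorting_unique sg sg' : sorting t w sg -> sorting t w sg' -> sg = sg'.
Proof.
move=> s1 s2; apply/permP => j; rewrite -(string_posK j).
set h := (string_pos j).1; set i := (string_pos j).2.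
apply: nlt_inj; rewrite ?sorting_string // ?sorting_rank //.
Qed.

Lemma sorting_exists : (forall j, 0 <= tnth t j < 1) -> equidistributed w ->
  exists sg, sorting t w sg.
Proof.
move=> t01 /forallP wk.
have rank_lt j : (nlt t w (w j) (tnth t j) < k)%N.
  rewrite -[X in (_ < X)%N](eqP (wk (w j))) /nlt /nbeads; apply/proper_card/properP; split.
    by apply/fintype.subsetP => i; rewrite !inE => /andP[].
  by exists j; rewrite !inE eqxx // ltxx.
pose rho j : 'I_N := mxvec_index (w j) (Ordinal (rank_lt j)).
have rho_inj : injective rho.
  by move=> j j' /mxvec_index_inj[wj rj]; apply: nlt_inj; [exact: wj|exact: rj].
pose sg := (perm rho_inj)^-1%g.
have rhoE j : rho (sg j) = j by rewrite -[rho _](permE rho_inj) permKV.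
have wsg h i : w (sg (mxvec_index h i)) = h.
  by have /mxvec_index_inj[] := rhoE (mxvec_index h i).
have rsg h i : nlt t w h (tnth t (sg (mxvec_index h i))) = i.
  have /mxvec_index_inj[e re] := rhoE (mxvec_index h i).
  by have := congr1 val re; rewrite /= e.
exists sg; apply/andP; split.
  by apply/forallP => j; rewrite -{1}(string_posK j) wsg.
apply/sorted_arrayP; rewrite /array_of_tuple; split=> [h i|h i j ij]; first by rewrite tnth_mktuple.
rewrite !tnth_mktuple ltNge le_eqVlt; apply/negP => /orP[/eqP E|lt1].
  by have := rsg h i; rewrite -E rsg => E'; rewrite E' ltnn in ij.
have := @nlt_lt (sg (mxvec_index h j)) (sg (mxvec_index h i)).
by rewrite !wsg => /(_ erefl lt1); rewrite !rsg ltnNge (ltnW ij).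
Qed.
End Word.

(** Permutations are grouped by the word they induce. At generic times exactly one permutation of an
    equidistributed word sorts every string, and the unsorted ones contribute zero. *)
Lemma sum_sorting t (G : N.-tuple R -> R) (Psi : {ffun 'I_N -> 'I_n} -> R) :
  uniq t -> (forall j, 0 <= tnth t j < 1) ->
  (forall s, ~~ sorted_array (array_of_tuple s) -> G s = 0) ->
  (forall (w : {ffun 'I_N -> 'I_n}) sg, sorting t w sg -> G (tuple_perm sg t) = Psi w) ->
  (forall w : {ffun 'I_N -> 'I_n}, ~~ equidistributed w -> Psi w = 0) ->
  \sum_(sg : 'S_N) G (tuple_perm sg t) = \sum_w Psi w.
Proof.
move=> tU t01 G0 GPsi Psi0.
rewrite (partition_big (fun sg : 'S_N => [ffun j : 'I_N => string_of ((sg^-1%g : {perm _}) j)]) predT) //=.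
apply: eq_bigr => w _.
have Gsort sg : [ffun j : 'I_N => string_of ((sg^-1%g : {perm _}) j)] == w -> G (tuple_perm sg t) != 0 -> sorting t w sg.
  move=> /eqP <- GN; apply/andP; split; last by apply: contraNT GN => /G0 ->.
  by apply/forallP => j; rewrite ffunE permK.
have [wk|nwk] := boolP (equidistributed w); last first.
  rewrite (Psi0 _ nwk) big1 // => sg sgw; apply/eqP; apply: contraR nwk => /(Gsort _ sgw).
  exact: sorting_equidistributed.
have [sg sgS] := sorting_exists tU t01 wk.
have sgw : [ffun j : 'I_N => string_of ((sg^-1%g : {perm _}) j)] == w.
  apply/eqP/ffunP => j; rewrite ffunE; case/andP: sgS => /forallP/(_ ((sg^-1%g : {perm _}) j))/eqP <- _.
  by rewrite permKV.
rewrite (bigD1 sg) //= (GPsi _ _ sgS) big1 ?addr0 // => sg' /andP[sgw' ne].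
apply/eqP; apply: contraNT ne => /(Gsort _ sgw') sgS'.
by apply/eqP; exact: sorting_unique sgS' sgS.
Qed.
End StringOrder.

(** * Observations and families of beads *)

Section Observations.
Variables (R : realType) (n : nat) (O U : finType) (x : O + U -> R * 'I_n).

Definition observation (i : O + U) : R * event n :=
  match i with
  | inl _ => ((x i).1, inl (inl (x i).2))
  | inr _ => ((x i).1, inl (inr (x i).2))
  end.

Definition observations : seq (R * event n) :=
  insert_all [::] [seq observation i | i <- enum {: O + U}].

Lemma perm_observations : perm_eq observations [seq observation i | i <- enum {: O + U}].
Proof. by have := perm_insert_all [::] [seq observation i | i <- enum {: O + U}]; rewrite cats0. Qed.

Lemma observations_nonbead : all (fun p => ~~ is_bead p.2) observations.
Proof.
by rewrite (perm_all _ perm_observations) all_map; apply/allP => -[].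
Qed.

Lemma pairwise_observations : pairwise (@generic_le R n) observations.
Proof.
apply: pairwise_insert_all => //; rewrite pairwise_map.
by elim: (enum _) => //= i s ->; rewrite andbT; apply/allP => -[j|j] _; case: i.
Qed.

Lemma observed_event k (a : 'I_n -> 'I_k -> R) : (0 < k)%N ->
  (forall i, torus (x i)) -> bead_array a ->
  observed observations (array_occ a) =
  `[< occupation_event x (configuration_of_beads (array_beads a)) >].
Proof.
move=> k0 x01 ba; rewrite /observed (perm_all _ perm_observations) all_map.
have occP i : occupied (configuration_of_beads (array_beads a)) (x i) <->
    array_occ a (ord_pred (x i).2) (x i).1 = 1.
  have := @occupied_array R n k k0 a (ord_pred (x i).2) (x i).1 ba (x01 i).
  by rewrite ord_predK -surjective_pairing.
apply/allP/asboolP => [obs|[occ unocc] [i|u] _ /=].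
- split=> [i|u]; first by apply/occP/eqP; have := obs (inl i) (mem_enum _ _).
  by have := obs (inr u) (mem_enum _ _); rewrite /= => /eqP o0 /occP; rewrite o0.
- by apply/eqP/occP.
- have occ01 := array_occ01 k0 (ord_pred (x (inr u)).2) (x (inr u)).1 ba.
  by apply/eqP; case: occ01 => // /occP /unocc.
Qed.
End Observations.

Section CountFamilies.
Variables (R : realType) (n b : nat) (A : set (b.-tuple R)) (hh : 'I_b -> 'I_n).

Definition pick_beads N (t : N.-tuple R) (psi : 'I_b -> 'I_N) : b.-tuple R :=
  [tuple tnth t (psi j) | j < b].

Definition count_families N (t : N.-tuple R) (w : 'I_N -> 'I_n) : nat :=
  #|[pred psi : {ffun 'I_b -> 'I_N} | [&& injectiveb psi,
     [forall j, w (psi j) == hh j] & `[< A (pick_beads t psi) >]]]|.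

Lemma count_families_perm N (t : N.-tuple R) (w w' : 'I_N -> 'I_n) (sg : 'S_N) :
  (forall j, w (sg j) = w' j) ->
  count_families (tuple_perm sg t) w' = count_families t w.
Proof.
move=> ww'; pose act (psi : {ffun 'I_b -> 'I_N}) := [ffun j => sg (psi j)].
have act_inj : injective act.
  move=> p p' /ffunP e; apply/ffunP => j; have := e j; rewrite !ffunE.
  exact: perm_inj.
rewrite /count_families -[LHS](fintype.card_image act_inj); apply: eq_card => psi.
have mem_act p : (p \in [pred psi : {ffun 'I_b -> 'I_N} | [&& injectiveb psi,
     [forall j, w' (psi j) == hh j] & `[< A (pick_beads (tuple_perm sg t) psi) >]]]) =
   (act p \in [pred psi : {ffun 'I_b -> 'I_N} | [&& injectiveb psi,
     [forall j, w (psi j) == hh j] & `[< A (pick_beads t psi) >]]]).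
  rewrite !inE; congr [&& _, _ & _].
  - apply/injectiveP/injectiveP => pI i j.
      by rewrite !ffunE => /perm_inj/pI.
    by move=> pij; apply: pI; rewrite !ffunE pij.
  - by apply: eq_forallb => j; rewrite ffunE ww'.
  congr (`[< A _ >]); apply: eq_from_tnth => j; rewrite !tnth_mktuple ffunE.
  by [].
apply/fintype.imageP/idP => [[p pP ->]|psiP]; first by rewrite -mem_act.
have psiE : psi = act [ffun j : 'I_b => (sg^-1%g : {perm _}) (psi j)].
  by apply/ffunP => j; rewrite !ffunE permKV.
by exists [ffun j : 'I_b => (sg^-1%g : {perm _}) (psi j)]; rewrite // mem_act -psiE.
Qed.
End CountFamilies.

Section EventCount.
Variables (R : realType) (n k : nat) (B : finType) (h : B -> 'I_n).
Variable (A : set (#|B|.-tuple R)).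
Local Notation N := (n * k)%N.
Local Notation hh := (fun j : 'I_#|B| => h (enum_val j)).

(** Times increase along each string, so distinct labels give distinct beads and families of beads
    correspond to injections into labels. *)
Lemma card_bead_families (s : N.-tuple R) : bead_array (array_of_tuple s) ->
  #|` fset_set (bead_families h A (configuration_of_tuple s))| =
  count_families A hh s (@string_of n k).
Proof.
move=> /andP[/sorted_arrayP[_ incr] _].
pose P := [pred psi : {ffun 'I_#|B| -> 'I_N} | [&& injectiveb psi,
  [forall j, string_of (psi j) == hh j] & `[< A (pick_beads s psi) >]]].
pose E := [seq pick_beads s psi | psi : {ffun 'I_#|B| -> 'I_N} in P].
have pos_inj j j' : tnth s j = tnth s j' -> string_of j = string_of j' -> j = j'.
  move=> sj gj; rewrite -(string_posK j) -(string_posK j') -/(string_of j) -/(string_of j') gj.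
  have sE l : tnth s l = array_of_tuple s (string_of l) (string_pos l).2.
    by rewrite /array_of_tuple string_posK.
  congr mxvec_index; apply: ord_inj; apply/eqP; rewrite eqn_leq; apply/andP.
  split; rewrite leqNgt; apply/negP => /(incr (string_of j')).
    by rewrite -{2}gj -!sE sj ltxx.
  by rewrite -{1}gj -!sE sj ltxx.
have EP : bead_families h A (configuration_of_tuple s) = [set` [fset u | u in E]%fset].
  apply/seteqP; split => u.
    case=> Au beads_u inj_u.
    have : forall j : 'I_#|B|, exists i : 'I_k, tnth u j = tnth s (mxvec_index (hh j) i).
      by move=> j; have [i /= iE] := beads_u (enum_val j); exists i; move: iE; rewrite enum_valK.
    case/fin_all_exists => f fE.
    have uE : u = pick_beads s [ffun j => mxvec_index (hh j) (f j)].
      by apply: eq_from_tnth => j; rewrite tnth_mktuple ffunE fE.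
    rewrite /= inE; apply/fintype.imageP; exists [ffun j => mxvec_index (hh j) (f j)] => //.
    rewrite !inE -uE; apply/and3P; split; last by apply/asboolP.
      apply/injectiveP => j j'; rewrite !ffunE => jj'.
      apply: enum_val_inj; apply: inj_u; rewrite /bead_points !enum_valK !fE jj'.
      by congr pair; have [] := mxvec_index_inj jj'.
    by apply/forallP => j; rewrite ffunE /string_of mxvec_indexK.
  rewrite /= inE => /fintype.imageP[psi]; rewrite !inE => /and3P[/injectiveP psiI /forallP psiB /asboolP psiA] ->.
  split => //.
    move=> c; have /eqP := psiB (enum_rank c); rewrite enum_rankK => hc.
    exists (string_pos (psi (enum_rank c))).2.
    by rewrite /= tnth_mktuple -hc /array_of_tuple string_posK.
  move=> c c' [+ hc]; rewrite !tnth_mktuple => /pos_inj e; apply: enum_rank_inj; apply: psiI.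
  by apply: e; rewrite (eqP (psiB _)) (eqP (psiB _)) !enum_rankK.
rewrite EP set_fsetK card_fseq undup_id; first by rewrite size_image.
rewrite map_inj_in_uniq ?enum_uniq // => p p'.
rewrite !mem_enum !inE => /and3P[_ /forallP pB _] /and3P[_ /forallP pB' _] pp'.
apply/ffunP => j; apply: pos_inj; last by rewrite (eqP (pB j)) (eqP (pB' j)).
by have := congr1 (fun u => tnth u j) pp'; rewrite !tnth_mktuple.
Qed.
End EventCount.

Section CountMeasurable.
Variables (R : realType) (n b N : nat).
Local Notation RR := (measurableTypeR R).
Variables (A : set (b.-tuple RR)) (hh : 'I_b -> 'I_n).
Hypothesis mA : measurable A.

Lemma count_familiesE (t : N.-tuple R) (w : 'I_N -> 'I_n) :
  (count_families A hh t w)%:R = \sum_(psi : {ffun 'I_b -> 'I_N} | injectiveb psi)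
    [forall j, w (psi j) == hh j]%:R * \1_A (pick_beads t psi) :> R.
Proof.
rewrite /count_families -sum1_card natr_sum big_mkcond [RHS]big_mkcond; apply: eq_bigr => psi _.
rewrite inE indicE; case: injectiveP => //= _; case: forallP => /= _; rewrite ?mul0r // mul1r.
by case: asboolP => At; [rewrite mem_set|rewrite memNset].
Qed.

Lemma bmeasurable_indic_pick (psi : 'I_b -> 'I_N) :
  bmeasurable (fun t : N.-tuple RR => \1_A (pick_beads t psi) : R).
Proof.
apply: (@bmeasurable_comp _ _ _ _ _ (fun t : N.-tuple RR => pick_beads t psi) (\1_A)).
  exact: bmeasurable_indic.
apply/measurable_fun_tnthP => i.
rewrite (_ : _ \o _ = fun t : N.-tuple RR => tnth t (psi i)); first exact: measurable_tnth.
by apply/funext => t /=; rewrite tnth_mktuple.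
Qed.

Lemma bmeasurable_count_families (w : 'I_N -> 'I_n) :
  bmeasurable (fun t : N.-tuple RR => (count_families A hh t w)%:R : R).
Proof.
rewrite (_ : (fun _ => _) = fun t : N.-tuple RR => \sum_(psi : {ffun 'I_b -> 'I_N})
    (injectiveb psi && [forall j, w (psi j) == hh j])%:R * (\1_A (pick_beads t psi) : R)).
  apply: bmeasurable_sum => psi; apply: bmeasurableM; first exact: bmeasurable_cst.
  exact: bmeasurable_indic_pick.
apply/funext => t; rewrite count_familiesE big_mkcond; apply: eq_bigr => psi _.
by case: injectiveP => //= _; rewrite mul0r.
Qed.
End CountMeasurable.

Section AverageFamilies.
Variables (R : realType) (n b r : nat) (q eps : R).
Local Notation RR := (measurableTypeR R).
Variables (A : set (b.-tuple RR)) (hh : 'I_b -> 'I_n) (Lx : seq (R * event n)).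
Hypothesis mA : measurable A.
Hypothesis Lx_le : pairwise (@generic_le R n) Lx.
Hypothesis Lx_bead : all (fun p => ~~ is_bead p.2) Lx.

Lemma list_weight_perm L L' : pairwise (@generic_le R n) L -> pairwise (@generic_le R n) L' ->
  perm_eq L L' -> list_weight q eps L = list_weight q eps L'.
Proof.
move=> Lp Lp' LL'; apply: eq_bigr => S _; congr (_ * _).
rewrite (path_closed_at _ Lp LL') (path_closed_at _ Lp' (perm_refl _)).
by rewrite /wraps !count_map; have /seq.permP -> := LL'.
Qed.

Lemma with_beads_perm N (t : N.-tuple R) (w w' : 'I_N -> 'I_n) (sg : 'S_N) :
  uniq (t ++ undup [seq p.1 | p <- Lx]) -> (forall j, w (sg j) = w' j) ->
  list_weight q eps (with_beads Lx (tuple_perm sg t) w') = list_weight q eps (with_beads Lx t w).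
Proof.
move=> tU ww'.
have tpE : perm_eq (tuple_perm sg t) t by apply/tuple_permP; exists sg.
apply: list_weight_perm.
- apply: pairwise_with_beads => //.
  by rewrite (perm_uniq (s2 := t ++ undup [seq p.1 | p <- Lx])) // perm_cat2r.
- exact: pairwise_with_beads.
apply: (perm_trans (perm_insert_all _ _)); rewrite perm_sym.
apply: (perm_trans (perm_insert_all _ _)); rewrite perm_cat2r perm_sym.
rewrite /bead_seq (eq_map (g := (fun i => (tnth t i, inr (w i))) \o sg)) => [|i]; last first.
  by rewrite /= tnth_mktuple ww'.
rewrite map_comp; apply: perm_map; apply: uniq_perm.
- by rewrite map_inj_uniq ?enum_uniq //; exact: perm_inj.
- exact: enum_uniq.
move=> i; rewrite mem_enum; apply/mapP; exists ((sg^-1%g : {perm _}) i); rewrite ?mem_enum //.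
by rewrite permKV.
Qed.

Lemma perm_extending (psi : 'I_b -> 'I_(b + r)) : injective psi ->
  exists sg : 'S_(b + r), forall j, sg (lshift r j) = psi j.
Proof.
move=> psiI; pose D := [seq i <- enum 'I_(b + r) | i \notin codom psi].
have szD : size D = r.
  transitivity #|[predC [in codom psi]]|.
    by rewrite size_filter -sum1_count -sum1_card big_enum_cond; apply: eq_bigl.
  apply: (@addnI b); have := cardC [in codom psi].
  by rewrite (fintype.card_codom psiI) !card_ord.
have sz : size (codom psi ++ D) == (b + r)%N by rewrite size_cat size_codom card_ord szD.
have : perm_eq (Tuple sz) (ord_tuple (b + r)).
  apply: uniq_perm; rewrite ?enum_uniq //.
    rewrite /= cat_uniq (map_inj_uniq psiI) enum_uniq filter_uniq ?enum_uniq // andbT.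
    by apply/hasPn => i; rewrite mem_filter => /andP[].
  by move=> i; rewrite mem_cat mem_filter !mem_enum andbT orbN.
case/tuple_permP => sg sgE; exists sg => j.
have := congr1 (fun s => nth (psi j) s (lshift r j)) sgE.
rewrite /= nth_cat size_codom card_ord ltn_ord => e.
have -> : sg (lshift r j) = nth (psi j) [seq tnth (ord_tuple (b + r)) (sg i) | i <- enum 'I_(b + r)] (lshift r j).
  by rewrite (nth_map (lshift r j)) ?size_enum_ord ?ltn_ord // tnth_ord_tuple nth_ord_enum.
rewrite -[in LHS]e codomE (nth_map j) ?size_enum_ord ?ltn_ord //.
by rewrite (nth_ord_enum j j).
Qed.

Definition sum_words (psi : 'I_b -> 'I_(b + r)) (t : (b + r).-tuple R) : R :=
  \sum_(w : {ffun 'I_(b + r) -> 'I_n})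
    list_weight q eps (with_beads Lx t w) *
    ([forall j, w (psi j) == hh j]%:R * \1_A (pick_beads t psi)).

Lemma bmeasurable_sum_words psi : bmeasurable (sum_words psi : (b + r).-tuple RR -> R).
Proof.
apply: bmeasurable_sum => w; apply: bmeasurableM; first exact: bmeasurable_with_beads.
by apply: bmeasurableM; [exact: bmeasurable_cst|exact: bmeasurable_indic_pick].
Qed.

Lemma sum_words_perm psi (sg : 'S_(b + r)) (t : (b + r).-tuple R) :
  uniq (t ++ undup [seq p.1 | p <- Lx]) -> (forall j, sg (lshift r j) = psi j) ->
  sum_words (@lshift b r) (tuple_perm sg t) = sum_words psi t.
Proof.
move=> tU sgE; rewrite /sum_words.
rewrite [LHS](reindex (fun w : {ffun 'I_(b + r) -> 'I_n} => [ffun i => w (sg i)])) /=; last first.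
  exists (fun w : {ffun 'I_(b + r) -> 'I_n} => [ffun i => w ((sg^-1%g : {perm _}) i)]) => w _;
  by apply/ffunP => i; rewrite !ffunE ?permKV ?permK.
apply: eq_bigr => w _; rewrite (with_beads_perm (w := w)) //; last by move=> j; rewrite ffunE.
congr (_ * (_%:R * \1_A _)).
  by congr nat_of_bool; apply: eq_forallb => j; rewrite ffunE sgE.
by apply: eq_from_tnth => j; rewrite !tnth_mktuple sgE.
Qed.

Lemma enum_ordD : enum 'I_(b + r) = map (@lshift b r) (enum 'I_b) ++ map (@rshift b r) (enum 'I_r).
Proof.
apply: (inj_map val_inj); rewrite map_cat val_enum_ord iotaD; congr cat.
  by rewrite -[iota 0 b](val_enum_ord b) -[RHS]map_comp; apply: eq_map.
rewrite add0n -[X in iota X]addn0 iotaDl -(val_enum_ord r) -[LHS]map_comp -[RHS]map_comp.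
exact: eq_map.
Qed.

Lemma with_beads_cat (s : b.-tuple R) (u : r.-tuple R) (w : 'I_(b + r) -> 'I_n) :
  with_beads Lx (cat_pair s u) w =
  with_beads (with_beads Lx s (fun j => w (lshift r j))) u (fun j => w (rshift b j)).
Proof.
rewrite /with_beads /insert_all -foldl_cat; congr foldl.
rewrite /bead_seq enum_ordD map_cat -!map_comp; congr cat; apply: eq_map => i /=.
  by congr pair; rewrite !(tnth_nth 0) /= nth_cat size_tuple ltn_ord.
by congr pair; rewrite !(tnth_nth 0) /= nth_cat size_tuple ltnNge leq_addr /= addKn.
Qed.

Definition family_integral : R :=
  cube_integral (fun s : b.-tuple RR => \1_A s * bead_average q eps (with_beads Lx s hh) r).

Lemma sum_words_cat (s : b.-tuple R) (u : r.-tuple R) :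
  sum_words (@lshift b r) (cat_pair s u) =
  \1_A s * \sum_(w : {ffun 'I_r -> 'I_n}) list_weight q eps (with_beads (with_beads Lx s hh) u w).
Proof.
have pickE : pick_beads (cat_pair s u) (@lshift b r) = s.
  apply: eq_from_tnth => j; rewrite tnth_mktuple !(tnth_nth 0) /=.
  by rewrite nth_cat size_tuple ltn_ord.
rewrite /sum_words pickE mulr_sumr.
pose ext (w : {ffun 'I_r -> 'I_n}) : {ffun 'I_(b + r) -> 'I_n} :=
  [ffun i => match fintype.split i with inl j => hh j | inr j => w j end].
rewrite (bigID (fun w : {ffun 'I_(b + r) -> 'I_n} => [forall j, w (lshift r j) == hh j])) /=.
rewrite [X in _ + X]big1 ?addr0 => [|w /negPf ->]; last by rewrite mul0r mulr0.
rewrite (reindex ext) /=.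
  apply: eq_big => [w|w _].
    by apply/forallP => j; rewrite ffunE (unsplitK (inl j)).
  rewrite (_ : [forall j, _]) ?mul1r; last first.
    by apply/forallP => j; rewrite ffunE (unsplitK (inl j)).
  rewrite mulrC with_beads_cat; congr (_ * list_weight _ _ _).
  have -> : (fun j => ext w (lshift r j)) = hh.
    by apply/funext => j; rewrite ffunE (unsplitK (inl j)).
  by congr with_beads; apply/funext => j; rewrite ffunE (unsplitK (inr j)).
exists (fun w => [ffun j => w (rshift b j)]) => [w _|w].
  by apply/ffunP => j; rewrite !ffunE (unsplitK (inr j)).
rewrite inE => /forallP wh; apply/ffunP => i; rewrite ffunE.
case: fintype.split_ordP => j ->; first by rewrite (eqP (wh j)).
by rewrite ffunE.
Qed.

Lemma integral_sum_words_lshift : cube_integral (sum_words (@lshift b r)) = family_integral.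
Proof.
rewrite cube_integral_cat; last exact: bmeasurable_sum_words.
congr cube_integral; apply/funext => s.
rewrite (_ : (fun t => _) = fun u => \1_A s * \sum_(w : {ffun 'I_r -> 'I_n})
    list_weight q eps (with_beads (with_beads Lx s hh) u w)); last first.
  by apply/funext => u; rewrite sum_words_cat.
have bm (w : {ffun 'I_r -> 'I_n}) := bmeasurable_with_beads q eps (with_beads Lx s hh) w.
rewrite cube_integralZ; last exact: bmeasurable_sum.
by rewrite cube_integral_sum.
Qed.

(** The integration variables are exchangeable: each injection of the [b] marked beads into the
    [b + r] labels contributes as much as the one onto the first [b] labels, and a falling factorial
    counts the injections. *)
Lemma integral_count_families :
  cube_integral (fun t : (b + r).-tuple RR => \sum_(w : {ffun 'I_(b + r) -> 'I_n})
    list_weight q eps (with_beads Lx t w) * (count_families A hh t w)%:R) =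
  ((b + r) ^_ b)%:R * family_integral.
Proof.
pose F := undup [seq p.1 | p <- Lx].
transitivity (cube_integral (fun t : (b + r).-tuple RR =>
    \sum_(psi : {ffun 'I_b -> 'I_(b + r)} | injectiveb psi) sum_words psi t)).
  congr cube_integral; apply/funext => t; rewrite exchange_big /=; apply: eq_bigr => w _.
  by rewrite count_familiesE mulr_sumr.
rewrite (_ : (fun t => _) = fun t : (b + r).-tuple RR =>
    \sum_(psi <- [seq psi : {ffun 'I_b -> 'I_(b + r)} <- index_enum _ | injectiveb psi]) sum_words psi t); last first.
  by apply/funext => t; rewrite big_filter.
rewrite cube_integral_sum => [|psi]; last exact: bmeasurable_sum_words.
rewrite big_filter (eq_bigr (fun=> family_integral)) => [|psi /injectiveP psiI].
  rewrite sumr_const mulr_natl; congr (_ *+ _).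
  have := card_inj_ffuns 'I_b 'I_(b + r); rewrite !card_ord => <-.
  by rewrite [RHS]cardsE.
have [sg sgE] := perm_extending psiI.
rewrite -integral_sum_words_lshift -[RHS](cube_integral_perm sg); last exact: bmeasurable_sum_words.
apply: (cube_integral_generic (F := F)); first exact: undup_uniq.
- exact: bmeasurable_sum_words.
- exact: (bmeasurable_comp (bmeasurable_sum_words (@lshift b r)) (@measurable_tuple_perm R _ sg)).
by move=> s _ sU; rewrite (sum_words_perm (psi := psi)).
Qed.
End AverageFamilies.

Section Balance.
Variables (n N : nat) (w : 'I_N -> 'I_n).

(** Closedness gives neighbouring strings equally many beads, so only multiples of [n] occur as
    numbers of beads. *)
Lemma nbeads_balanced : [forall g, nbeads w g == nbeads w (ordS g)] ->
  forall h, (n * nbeads w h)%N = N.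
Proof.
move=> /forallP bal h; have n_gt0 : (0 < n)%N := leq_ltn_trans (leq0n h) (ltn_ord h).
have to0 m (mn : (m < n)%N) : nbeads w (Ordinal mn) = nbeads w (Ordinal n_gt0).
  elim: m mn => [|m IH] mn; first by congr nbeads; apply: ord_inj.
  rewrite -(IH (ltnW mn)) (eqP (bal (Ordinal (ltnW mn)))); congr nbeads; apply: ord_inj.
  by rewrite /= modn_small.
have const g : nbeads w g = nbeads w h.
  by case: g => g gn; case: h => h' hn; rewrite !to0.
rewrite -[RHS]card_ord -sum1_card (partition_big w predT) //=.
rewrite (eq_bigr (fun=> nbeads w h)) ?sum_nat_const ?card_ord // => g _.
by rewrite -(const g) sum1_card; apply: eq_card.
Qed.
End Balance.

(** * Integrals over ordered arrays *)

Section ArrayPattern.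
Variables (R : realType) (n k : nat).
Local Notation N := (n * k)%N.
Local Notation RR := (measurableTypeR R).
Variables (Lx : seq (R * event n)).

(** The thresholds [0] and [1] are included so that membership in [[0, 1)] is read off from
    comparisons too. *)
Let F : seq R := 0 :: 1 :: [seq p.1 | p <- Lx].

Definition array_comparison (e : 'I_N * 'I_N + 'I_N * 'I_(size F) * bool) (s : N.-tuple R) : bool :=
  match e with
  | inl (i, j) => tnth s i < tnth s j
  | inr (i, m, true) => tnth s i < tnth (in_tuple F) m
  | inr (i, m, false) => tnth (in_tuple F) m < tnth s i
  end.

Lemma measurable_array_comparison e :
  measurable_fun setT (array_comparison e : N.-tuple RR -> bool).
Proof.
case: e => [[i j]|[[i m] []]]; apply: measurable_fun_ltr;
  solve [exact: measurable_tnth|exact: measurable_cst].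
Qed.

Variables s s' : N.-tuple R.
Hypothesis ss' : forall e, array_comparison e s = array_comparison e s'.

Let lt_tt i j : (tnth s i < tnth s j) = (tnth s' i < tnth s' j) := ss' (inl (i, j)).

Let lt_tF i tau : tau \in F -> (tnth s i < tau) = (tnth s' i < tau).
Proof. by case/(tnthP (in_tuple F)) => m ->; exact: (ss' (inr (i, m, true))). Qed.

Let lt_Ft i tau : tau \in F -> (tau < tnth s i) = (tau < tnth s' i).
Proof. by case/(tnthP (in_tuple F)) => m ->; exact: (ss' (inr (i, m, false))). Qed.

Lemma gtb_strings_comparison h :
  gtb_strings (array_of_tuple s) h = gtb_strings (array_of_tuple s') h.
Proof.
rewrite /gtb_strings /array_of_tuple; congr (_ && _).
  by apply: eq_forallb => i; rewrite lt_tt.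
by apply: eq_forallb => i; apply: eq_forallb => j; rewrite !leNgt lt_tt.
Qed.

Lemma bead_array_comparison : bead_array (array_of_tuple s) = bead_array (array_of_tuple s').
Proof.
rewrite /bead_array /sorted_array; congr [&& _ && _ & _].
- apply: eq_forallb => h; apply: eq_forallb => i.
  have F0 : 0 \in F by rewrite /F inE eqxx.
  have F1 : 1 \in F by rewrite /F !inE eqxx orbT.
  by rewrite /array_of_tuple !leNgt (lt_tF _ F0) (lt_tF _ F1).
- by apply: eq_forallb => h; apply: eq_forallb => i; apply: eq_forallb => j; rewrite /array_of_tuple lt_tt.
apply: eq_forallb => h; rewrite gtb_strings_comparison; congr (_ || _).
rewrite /leb_strings /array_of_tuple; congr (_ && _).
  by apply: eq_forallb => i; rewrite !leNgt lt_tt.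
by apply: eq_forallb => i; apply: eq_forallb => j; rewrite lt_tt.
Qed.

Lemma gt_count_comparison : gt_count (array_of_tuple s) = gt_count (array_of_tuple s').
Proof. by apply: eq_card => h; rewrite !inE gtb_strings_comparison. Qed.

Lemma observed_comparison :
  observed Lx (array_occ (array_of_tuple s)) = observed Lx (array_occ (array_of_tuple s')).
Proof.
apply: eq_in_all => p pL; have pF : p.1 \in F by rewrite /F !inE map_f ?orbT.
have occE g : array_occ (array_of_tuple s) g p.1 = array_occ (array_of_tuple s') g p.1.
  rewrite /array_occ gtb_strings_comparison; congr (_ + Posz _ - Posz _);
  by apply: eq_card => i; rewrite !inE /array_of_tuple !leNgt (lt_Ft _ pF).
by case: p.2 => [[h|h]|h]; rewrite ?occE.
Qed.
End ArrayPattern.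

Section ArrayIntegrals.
Variables (R : realType) (n k : nat) (O U B : finType).
Variables (x : O + U -> R * 'I_n) (h : B -> 'I_n).
Local Notation N := (n * k)%N.
Local Notation b := (#|B|).
Local Notation hh := (fun j : 'I_b => h (enum_val j)).
Local Notation RR := (measurableTypeR R).
Local Notation Lx := (observations x).
Variable (A : set (b.-tuple RR)).
Hypothesis mA : measurable A.
Hypothesis n_gt0 : (0 < n)%N.
Hypothesis k_gt0 : (0 < k)%N.
Hypothesis x01 : forall i, torus (x i).

Definition array_integrand (c : nat -> R) (s : N.-tuple R) : R :=
  (bead_array (array_of_tuple s))%:R * (observed Lx (array_occ (array_of_tuple s)))%:R *
    c (gt_count (array_of_tuple s)) * (count_families A hh s (@string_of n k))%:R.

Lemma bmeasurable_array_integrand c : bmeasurable (array_integrand c : N.-tuple RR -> R).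
Proof.
apply: bmeasurableM; last exact: bmeasurable_count_families.
apply: (pattern_bmeasurable (@measurable_array_comparison R n k Lx)) => s s' ss'.
by rewrite (bead_array_comparison ss') (observed_comparison ss') (gt_count_comparison ss').
Qed.

Lemma nkl_configurationsE l : @nkl_configurations R n k l =
  [set s | bead_array (array_of_tuple s) && (gt_count (array_of_tuple s) == l)].
Proof.
apply/seteqP; split => s.
  case=> /bead_arrayP ba /(occupation_number_array k_gt0 _ n_gt0 ba) <-.
  by rewrite /= ba eqxx.
case/andP => ba /eqP gl; split; first exact/bead_arrayP.
exact/(occupation_number_array k_gt0 _ n_gt0 ba).
Qed.

Lemma nkl_configurations_cube l : @nkl_configurations R n k l `<=` @unit_cube R N.
Proof.
move=> s [[s01 _ _] _] j; have := s01 (string_pos j).1 (string_pos j).2.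
by rewrite /array_of_tuple string_posK.
Qed.

Lemma measurable_nkl_configurations l : measurable (@nkl_configurations R n k l).
Proof.
rewrite nkl_configurationsE.
apply: (pattern_measurable (@measurable_array_comparison R n k Lx)) => s s' ss' /=.
by rewrite (bead_array_comparison ss') (gt_count_comparison ss').
Qed.

Lemma event_count_array (s : N.-tuple R) : bead_array (array_of_tuple s) ->
  event_count x h A (configuration_of_tuple s) =
  (observed Lx (array_occ (array_of_tuple s)))%:R * (count_families A hh s (@string_of n k))%:R.
Proof.
by move=> ba; rewrite /event_count card_bead_families // mulrC observed_event.
Qed.

Lemma event_count_nkl l (s : N.-tuple R) : nkl_configurations l s ->
  event_count x h A (configuration_of_tuple s) = array_integrand (fun m => (m == l)%:R) s.
Proof.
rewrite nkl_configurationsE => /andP[ba gl].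
by rewrite event_count_array // /array_integrand ba gl mul1r mulr1.
Qed.

Lemma event_count_integrable l :
  (lebesgue_tuple R N).-integrable (@nkl_configurations R n k l)
    (fun s => (event_count x h A (configuration_of_tuple s))%:E).
Proof.
have mD := measurable_nkl_configurations l.
apply: (eq_integrable mD (EFin \o array_integrand (fun m => (m == l)%:R))) => [s /set_mem sD|].
  by rewrite /= (event_count_nkl sD).
apply: bmeasurable_integrable mD (@nkl_configurations_cube l).
exact: bmeasurable_array_integrand.
Qed.

Lemma integral_event_count l :
  \int[lebesgue_tuple R N]_(s in @nkl_configurations R n k l)
     event_count x h A (configuration_of_tuple s) =
  cube_integral (array_integrand (fun m => (m == l)%:R)).
Proof.
have mD := measurable_nkl_configurations l.
transitivity (\int[lebesgue_tuple R N]_(s in @nkl_configurations R n k l)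
    array_integrand (fun m => (m == l)%:R) s).
  by apply: eq_Rintegral => s /set_mem sD; rewrite (event_count_nkl sD).
rewrite /cube_integral /Rintegral; congr fine.
rewrite -[X in (\int[_]_(_ in X) _)%E](setIidr (@nkl_configurations_cube l)) integral_mkcondr.
apply: eq_integral => s _; rewrite patchE; case: ifPn => // /negP sD.
rewrite /= /array_integrand; case: (boolP (bead_array _)) => [ba|_]; last by rewrite !mul0r.
case: eqP => [gl|_]; last by rewrite mulr0 mul0r.
by case: sD; rewrite inE nkl_configurationsE /= ba gl eqxx.
Qed.

(** An interlaced array has one occupation number, so the sum over [l] collapses and the coefficient
    becomes a function of the array. *)
Lemma sum_event_count (c : nat -> R) :
  \sum_(l < n.+1) c l * \int[lebesgue_tuple R N]_(s in @nkl_configurations R n k l)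
     event_count x h A (configuration_of_tuple s) =
  cube_integral (array_integrand c).
Proof.
rewrite (eq_bigr (fun l : 'I_n.+1 => cube_integral (fun s : N.-tuple RR =>
    c l * array_integrand (fun m => (m == l)%:R) s))) => [|l _]; last first.
  by rewrite integral_event_count cube_integralZ //; exact: bmeasurable_array_integrand.
rewrite -cube_integral_sum => [|l]; last first.
  apply: bmeasurableM; [exact: bmeasurable_cst|exact: bmeasurable_array_integrand].
congr cube_integral; apply/funext => s.
have gn : (gt_count (array_of_tuple s) < n.+1)%N.
  by rewrite ltnS -[X in (_ <= X)%N]card_ord; exact: max_card.
rewrite (bigD1 (Ordinal gn)) //= big1 => [|l ne]; last first.
  rewrite /array_integrand (negPf (_ : gt_count _ != l)); first by rewrite mulr0 mul0r mulr0.
  by apply: contra ne => /eqP gl; apply/eqP/ord_inj.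
rewrite /array_integrand /= eqxx addr0 mulr1; ring.
Qed.

(** If every pair of strings were in the second pattern, the first beads would strictly decrease all
    the way around the cycle. A configuration with beads thus has a hole, and [(n - l).-1] is not
    truncated. *)
Lemma gt_count_lt (a : 'I_n -> 'I_k -> R) : bead_array a -> (gt_count a < n)%N.
Proof.
move=> ba; have cn := max_card [pred h | gtb_strings a h]; rewrite card_ord in cn.
rewrite ltn_neqAle [(_ <= _)%N]cn andbT; apply/negP => /eqP gn.
have gt g : gtb_strings a g.
  move: gn (cardC [pred h | gtb_strings a h]); rewrite /gt_count card_ord => -> /eqP.
  rewrite -[X in _ == X]addn0 eqn_add2l => /eqP/card0_eq/(_ g).
  by rewrite !inE => /negbFE.
have : \sum_g a (ordS g) (Ordinal k_gt0) < \sum_g a g (Ordinal k_gt0).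
  apply: ltr_sum => [|g _]; last by have /andP[/forallP] := gt g.
  by apply/hasP; exists (Ordinal n_gt0); rewrite ?mem_index_enum.
rewrite [X in _ < X](reindex (@ordS n)) ?ltxx //.
by apply: onW_bij; exact: ordS_bij.
Qed.

Variables (q eps : R).

(** Averaging over all orders of the variables replaces ordered arrays by free times with a word;
    words that are not equidistributed have weight zero because they cannot close up. *)
Lemma factorial_array_integral :
  N`!%:R * cube_integral (array_integrand (fun l => q ^+ l * ((-1) ^+ (n - l).-1 * eps) ^+ k)) =
  cube_integral (fun t : N.-tuple RR => \sum_(w : {ffun 'I_N -> 'I_n})
    list_weight q eps (with_beads Lx t w) * (count_families A hh t w)%:R).
Proof.
set c := fun l => _; pose F := undup [seq p.1 | p <- Lx].
have bG := bmeasurable_array_integrand c.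
have bGp (sg : 'S_N) : bmeasurable (fun t => array_integrand c (tuple_perm sg t)).
  by apply: (bmeasurable_comp bG); exact: measurable_tuple_perm.
transitivity (cube_integral (fun t => \sum_(sg : 'S_N) array_integrand c (tuple_perm sg t))).
  rewrite cube_integral_sum // (eq_bigr (fun=> cube_integral (array_integrand c))).
    by rewrite sumr_const card_Sn mulr_natl.
  by move=> sg _; rewrite cube_integral_perm.
apply: (cube_integral_generic (F := F)).
- exact: undup_uniq.
- exact: bmeasurable_sum.
- apply: bmeasurable_sum => w; apply: bmeasurableM; first exact: bmeasurable_with_beads.
  exact: bmeasurable_count_families.
move=> t t01 tF; have tU : uniq t by move: tF; rewrite cat_uniq => /andP[].
apply: sum_sorting => //.
- by move=> s ns; rewrite /array_integrand /bead_array (negPf ns) !mul0r.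
- move=> w sg sgS; rewrite (@list_weight_array R n k N t w (fun h i => sg (mxvec_index h i)) Lx
    (fun g i => sorting_string g i sgS) (fun j => sorting_surj j sgS) k_gt0 n_gt0 (sorting_array sgS)
    tF q eps (pairwise_observations x) (observations_nonbead x)).
  have arrE : array_of_tuple (tuple_perm sg t) = fun h i => tnth t (sg (mxvec_index h i)).
    by apply/funext => g; apply/funext => i; rewrite /array_of_tuple tnth_mktuple.
  rewrite /array_integrand arrE (@count_families_perm _ _ _ A hh _ t w).
    by rewrite -mulnb natrM.
  by case/andP: sgS => /forallP e _ j; exact/eqP.
move=> w nw; rewrite list_weight_with_beads ?mul0r //; last 2 first.
- exact: pairwise_observations.
- exact: observations_nonbead.
rewrite big1 ?mul0r // => S _; case: ifP; rewrite ?mulr0 // => /and3P[_ _ bal].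
case/negP: nw; apply/forallP => g; apply/eqP/eqP.
by rewrite -(eqn_pmul2l n_gt0) (nbeads_balanced bal).
Qed.
End ArrayIntegrals.

(** * The weights as a series in the number of beads *)

Section WeightSeries.
Variables (R : realType) (n : nat) (theta : bool * bool) (lambda T : R).
Variables (O U B : finType) (x : O + U -> R * 'I_n) (h : B -> 'I_n).
Local Notation b := (#|B|).
Local Notation RR := (measurableTypeR R).
Local Notation hh := (fun j : 'I_b => h (enum_val j)).
Local Notation Lx := (observations x).
Variable (A : set (b.-tuple RR)).
Hypothesis mA : measurable A.
Hypothesis n_gt0 : (0 < n)%N.
Hypothesis x01 : forall i, torus (x i).

(** This is [- exp (- (lambda + theta_1 pi i))], so that [1 - exp (- (lambda + theta_1 pi i + T z))]
    equals [(q + exp (T z)) / exp (T z)]. *)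
Definition hole_weight : R := (-1) ^+ (theta.1 + 1) * expR (- lambda).
Definition wrap_weight : R := (-1) ^+ theta.2.
Definition prefactor : R := 2^-1 * (-1) ^+ ((theta.1 + 1) * (theta.2 + n + 1)).
Local Notation q := hole_weight.
Local Notation eps := wrap_weight.

(* [l] here is the occupation number: [q] weighs occupied strings, and the sign
   per wrap is that of the cyclic rotation of the [n - l] holes *)
Lemma signed_densityE Z k l : (l < n)%N || (k == 0%N) ->
  signed_density n theta lambda T Z k l =
  prefactor / Z * T ^+ (n * k) * (q ^+ l * ((-1) ^+ (n - l).-1 * eps) ^+ k).
Proof.
move=> lk; rewrite /signed_density /prefactor /hole_weight /wrap_weight.
have -> : expR (- (lambda * l%:R)) = expR (- lambda) ^+ l.
  by rewrite -mulNr -expRM_natr.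
rewrite !exprMn -!exprM.
suff -> : (-1) ^+ ((theta.1 + k + 1) * (theta.2 + n + l + 1)) = (-1) ^+ ((theta.1 + 1) * (theta.2 + n + 1)) *
    ((-1) ^+ ((theta.1 + 1) * l) * ((-1) ^+ ((n - l).-1 * k) * (-1) ^+ (theta.2 * k))) :> R by ring.
rewrite -!exprD -signr_odd -[RHS]signr_odd; congr ((-1) ^+ (nat_of_bool _)).
(* Exponents of [-1] are compared modulo 2. For [k = 0] the factor with [n - l] has exponent zero;
   otherwise [l < n] makes [n] the sum of [l], [n - l - 1] and [1]. *)
case/orP: lk => [ln|/eqP ->]; last first.
  by rewrite !muln0 !oddD !oddM !oddD !oddb /=; case: (theta.1); case: (theta.2); case: (odd n); case: (odd l).
have nE : n = (l + (n - l).-1 + 1)%N by lia.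
rewrite {1 2}nE; move: (n - l).-1 => m.
rewrite !oddD !oddM !oddD !oddb /=.
by case: (theta.1); case: (theta.2); case: (odd m); case: (odd l); case: (odd k).
Qed.

Definition word_weight N : R := cube_integral (fun t : N.-tuple RR =>
  \sum_(w : {ffun 'I_N -> 'I_n}) list_weight q eps (with_beads Lx t w) * (count_families A hh t w)%:R).

Lemma word_weight_average r : word_weight (b + r) = ((b + r) ^_ b)%:R * family_integral r q eps A hh Lx.
Proof.
by apply: integral_count_families; rewrite ?pairwise_observations ?observations_nonbead.
Qed.

Lemma word_weight_short N : (N < b)%N -> word_weight N = 0.
Proof.
move=> Nb; rewrite /word_weight (_ : (fun _ => _) = fun=> 0 * 0).
  by rewrite cube_integralZ ?mul0r //; exact: bmeasurable_cst.
apply/funext => t; rewrite mul0r big1 // => w _.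
rewrite (_ : count_families _ _ _ _ = 0%N) ?mulr0 //; apply: eq_card0 => psi; rewrite !inE.
apply/negP => /and3P[/injectiveP psiI _ _].
by have := leq_card psi psiI; rewrite !card_ord leqNgt Nb.
Qed.

Lemma bmeasurable_word_weight N : bmeasurable (fun t : N.-tuple RR =>
  \sum_(w : {ffun 'I_N -> 'I_n}) list_weight q eps (with_beads Lx t w) * (count_families A hh t w)%:R).
Proof.
apply: bmeasurable_sum => w; apply: bmeasurableM; first exact: bmeasurable_with_beads.
exact: bmeasurable_count_families.
Qed.

Lemma word_weight_ndvd N : ~~ (n %| N)%N -> word_weight N = 0.
Proof.
move=> nN; transitivity (cube_integral (fun _ : N.-tuple RR => 0 * 0)); last first.
  by rewrite cube_integralZ ?mul0r //; exact: bmeasurable_cst.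
apply: (cube_integral_generic (F := undup [seq p.1 | p <- Lx])).
- exact: undup_uniq.
- exact: bmeasurable_word_weight.
- exact: bmeasurable_cst.
move=> t t01 tF; rewrite mul0r big1 // => w _.
rewrite (list_weight_with_beads _ (pairwise_observations x) (observations_nonbead x) tF).
rewrite big1 ?mul0r // => S _; case: ifP; rewrite ?mulr0 // => /and3P[_ _ bal].
by case/negP: nN; rewrite -(nbeads_balanced bal (Ordinal n_gt0)) dvdn_mulr.
Qed.

Lemma bead_term Z k : (0 < k)%N ->
  \sum_(l < n.+1) signed_density n theta lambda T Z k l *
    \int[lebesgue_tuple R (n * k)]_(s in @nkl_configurations R n k l)
      event_count x h A (configuration_of_tuple s) =
  prefactor / Z * (T ^+ (n * k) / (n * k)`!%:R * word_weight (n * k)).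
Proof.
move=> k0; rewrite sum_event_count //.
rewrite /word_weight -factorial_array_integral //.
rewrite [X in _ = _ * X]mulrA -[X in _ * (X * _)]mulrA mulVf ?pnatr_eq0 -?lt0n ?fact_gt0 // mulr1 mulrA.
rewrite -cube_integralZ; last exact: bmeasurable_array_integrand.
congr cube_integral; apply/funext => s; rewrite /array_integrand.
case: (boolP (bead_array _)) => [ba|_]; last by rewrite !mul0r mulr0.
rewrite signed_densityE ?gt_count_lt //.
set c1 := _%:R; set c2 := _%:R; set c3 := _%:R; ring.
Qed.

Lemma empty_term Z :
  \sum_(S : {set 'I_n}) signed_density n theta lambda T Z 0 #|S| *
    event_count x h A (configuration_of_strings R S) =
  prefactor / Z * word_weight 0.
Proof.
have w0 : {ffun 'I_0 -> 'I_n} by exact: (ffun0 (card_ord 0)).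
have words (w : {ffun 'I_0 -> 'I_n}) : w = w0 by apply/ffunP => -[].
have count0 (S : {set 'I_n}) :
    #|` fset_set (bead_families h A (configuration_of_strings R S))| =
    count_families A hh ([tuple] : 0.-tuple R) w0.
  have [c0|b0] := pickP B.
    rewrite (_ : bead_families _ _ _ = set0) ?fset_set0; last first.
      by rewrite -subset0 => s [_ /(_ c0)].
    by move=> _; rewrite cardfs0; symmetry; apply: eq_card0 => psi; case: (psi (enum_rank c0)).
  have tup (s s' : b.-tuple R) : s = s' by apply: eq_from_tnth => j; have := b0 (enum_val j).
  have psi0 : {ffun 'I_b -> 'I_0}.
    by apply: finfun => j; have := b0 (enum_val j).
  have psiE psi : psi = psi0 by apply/ffunP => j; have := b0 (enum_val j).
  have fam s : bead_families h A (configuration_of_strings R S) s <-> A s.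
    split=> [[]//|As]; split => // c; by have := b0 c.
  rewrite /count_families; have [As|nAs] := pselect (A (pick_beads [tuple] psi0)).
    rewrite (_ : bead_families _ _ _ = [set pick_beads [tuple] psi0]); last first.
      by apply/seteqP; split => s => [_|->]; [exact: tup|apply/fam].
    rewrite fset_set1 cardfs1 (eq_card (B := pred1 psi0)) ?card1 // => psi.
    rewrite !inE (psiE psi) eqxx; apply/and3P; split; last exact/asboolP.
      by apply/injectiveP => j; have := b0 (enum_val j).
    by apply/forallP => j; have := b0 (enum_val j).
  rewrite (_ : bead_families _ _ _ = set0); last first.
    by rewrite -subset0 => s /fam; rewrite (tup s (pick_beads [tuple] psi0)).
  rewrite fset_set0 cardfs0; symmetry; apply: eq_card0 => psi; rewrite !inE (psiE psi).
  by apply/negP => /and3P[_ _ /asboolP].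
rewrite /word_weight cube_integral0 (bigD1 w0) //= [X in _ + X]big1 ?addr0 => [|w]; last by rewrite (words w) eqxx.
rewrite /list_weight /with_beads /bead_seq enum_ord0 /= mulr_suml mulr_sumr.
(* Weights of words sum over sets of holes, configurations without beads over sets of occupied
   strings: the two are complementary. *)
rewrite (reindex_inj (inv_inj (@finset.setCK _))) /=; apply: eq_bigr => S _.
rewrite signed_densityE ?orbT // muln0 expr0 mulr1 /event_count count0.
have -> : wraps [seq p.2 | p <- Lx] = 0%N.
  rewrite /wraps count_map; apply/eqP; rewrite -leqn0 leqNgt -has_count; apply/hasPn => p pL.
  by have := allP (observations_nonbead x) p pL; rewrite /is_bead /=; case: (p.2).
have jump0 (P : pred (R * event n)) g : \sum_(p <- Lx | P p) jump p.2 g = 0.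
  rewrite big1_seq // => p /andP[_ pL]; have := allP (observations_nonbead x) p pL.
  by rewrite /is_bead /jump; case: (p.2).
have occE tau : occ_at (occupation_of S) Lx tau = occupation_of S.
  by apply/funext => g; rewrite /occ_at jump0 addr0.
have -> : path_closed (occupation_of S) [seq p.2 | p <- Lx] =
    `[< occupation_event x (configuration_of_strings R (~: S)) >].
  rewrite (path_closed_at _ (pairwise_observations x) (perm_refl _)).
  rewrite [X in _ && X](_ : _ = true) ?andbT; last by apply/forallP => g; rewrite jump0.
  rewrite (perm_all _ (perm_observations x)) all_map.
  apply/allP/asboolP => [adm|[occ unocc] i _].
    split=> [i|u].
      have := adm (inl i) (mem_enum _ _); rewrite /= occE /occupation_of => iS.
      by split; [exact: x01|rewrite inE; case: (_ \in _) iS].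
    have := adm (inr u) (mem_enum _ _); rewrite /= occE /occupation_of => uS [_].
    by rewrite inE; case: (_ \in _) uS.
  case: i => i /=; rewrite occE /occupation_of.
    by have [_] := occ i; rewrite inE => ->.
  have := unocc i; rewrite /occupied /=; case: (boolP (_ \in S)) => //= iS [].
  by split; [exact: x01|rewrite inE].
by case: asboolP => _ /=; rewrite ?expr0 ?mulr1 ?mulr0 ?mul0r ?mulr0 ?mulrA.
Qed.

Lemma weighted_integral_series Z :
  weighted_integral theta lambda T Z (event_count x h A) =
  prefactor / Z * word_weight 0 + limn (fun K : nat => \sum_(1 <= k < K)
     prefactor / Z * (T ^+ (n * k) / (n * k)`!%:R * word_weight (n * k))).
Proof.
rewrite /weighted_integral empty_term; congr (_ + limn _); apply/funext => K.
rewrite !big_nat; apply: eq_bigr => k /andP[k0 _]; exact: bead_term.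
Qed.

(** In each block of [n] consecutive numbers of beads only the multiple of [n] contributes. *)
Lemma sum_word_weight_multiples K : (0 < K)%N ->
  \sum_(N < n * K) T ^+ N / N`!%:R * word_weight N =
  word_weight 0 + \sum_(1 <= k < K) T ^+ (n * k) / (n * k)`!%:R * word_weight (n * k).
Proof.
have block k : \sum_(n * k <= N < n * k.+1) T ^+ N / N`!%:R * word_weight N =
    T ^+ (n * k) / (n * k)`!%:R * word_weight (n * k).
  have lt_nk : (n * k < n * k.+1)%N by rewrite ltn_pmul2l.
  rewrite big_ltn // big_nat big1 ?addr0 // => N /andP[N1 N2].
  rewrite word_weight_ndvd ?mulr0 //; apply/negP => /dvdnP[m NE].
  by move: N1 N2; rewrite NE (mulnC m) !ltn_pmul2l // ltnS => N1; rewrite leqNgt N1.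
rewrite -(big_mkord predT (fun N => T ^+ N / N`!%:R * word_weight N)).
case: K => // K _; elim: K => [|K IH].
  by rewrite -[X in index_iota X](muln0 n) block muln0 big_nil fact0 expr0 divr1 mul1r addr0.
by rewrite (big_cat_nat (n := n * K.+1)) //= ?leq_mul2l ?leqnSn ?orbT // IH block [in RHS]big_nat_recr //= addrA.
Qed.
End WeightSeries.

(** * Convergence of the series *)

Section CubeBounds.
Variables (R : realType) (m : nat).
Local Notation RR := (measurableTypeR R).
Implicit Types (f g : m.-tuple RR -> R).

Lemma cube_integral_cst c : cube_integral (fun _ : m.-tuple RR => c) = c.
Proof.
have mC : measurable (@unit_cube R m) by exact: measurable_cube.
rewrite /cube_integral Rintegral_cst //.
by have := lebesgue_tuple_cube R m => /= ->; rewrite mulr1.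
Qed.

Lemma cube_integral_le f g : bmeasurable f -> bmeasurable g ->
  (forall s, @unit_cube R m s -> f s <= g s) -> cube_integral f <= cube_integral g.
Proof.
move=> bf bg fg; apply: le_Rintegral => //; first exact: measurable_cube;
  by apply: bmeasurable_integrable => //; exact: measurable_cube.
Qed.

Lemma cube_integral_norm f c : bmeasurable f -> (forall s, `|f s| <= c) -> `|cube_integral f| <= c.
Proof.
move=> bf fc; rewrite ler_norml -[- c]cube_integral_cst -[X in _ && (_ <= X)]cube_integral_cst.
apply/andP; split; apply: cube_integral_le => //; try exact: bmeasurable_cst;
  by move=> s _; have := fc s; rewrite ler_norml => /andP[].
Qed.

Lemma cube_integral_dominated (f_ : nat -> m.-tuple RR -> R) f c :
  (forall k, measurable_fun setT (f_ k)) -> (forall k s, `|f_ k s| <= c) ->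
  (forall s, f_ k s @[k --> \oo] --> f s) ->
  bmeasurable f /\ cube_integral (f_ k) @[k --> \oo] --> cube_integral f.
Proof.
move=> mf_ f_c f_f; have mC : measurable (@unit_cube R m) by exact: measurable_cube.
have mf : measurable_fun setT f by apply: (measurable_fun_cvg mf_) => s _; exact: f_f.
have bf : bmeasurable f.
  split=> //; exists c => s; apply: (ler_cvg_to (cvg_norm (f_f s)) (cvg_cst c)).
  by apply: nearW => k; exact: f_c.
split=> //; apply: fine_cvg; rewrite fineK; last first.
  by apply: integrable_fin_num => //; exact: bmeasurable_integrable.
apply: (@dominated_cvg _ _ _ _ _ mC _ _ (cst c%:E)) => //.
- by move=> k; apply/measurable_EFinP; exact: measurable_funTS.
- by move=> s _; apply: cvg_EFin; [exact: nearW|exact: f_f].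
- exact: (bmeasurable_integrable (bmeasurable_cst _ c) mC).
- by move=> k s _; rewrite lee_fin.
Qed.
End CubeBounds.

Section ExpSeries.
Variable R : realType.

Lemma exp_series_le (y : R) M : 0 <= y -> \sum_(r < M) y ^+ r / r`!%:R <= expR y.
Proof.
move=> y0; have [->|yN0] := eqVneq y 0.
  rewrite expR0; case: M => [|M]; first by rewrite big_ord0 ler01.
  rewrite big_ord_recl big1 ?addr0 ?expr0 ?fact0 ?divr1 // => i _.
  by rewrite expr0n /= mul0r.
have y_gt0 : 0 < y by rewrite lt_neqAle eq_sym yN0.
have := nondecreasing_cvgn_le _ (is_cvg_series_exp_coeff_pos y_gt0) M.
rewrite /series /= big_mkord; apply.
apply/nondecreasing_seqP => k; rewrite big_nat_recr //= lerDl.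
by rewrite /exp_coeff /= mulr_ge0 ?exprn_ge0 ?invr_ge0.
Qed.
End ExpSeries.

Section SeriesLimit.
Variables (R : realType) (n : nat) (theta : bool * bool) (lambda T : R).
Variables (O U B : finType) (x : O + U -> R * 'I_n) (h : B -> 'I_n).
Local Notation b := (#|B|).
Local Notation RR := (measurableTypeR R).
Local Notation hh := (fun j : 'I_b => h (enum_val j)).
Local Notation Lx := (observations x).
Local Notation q := (hole_weight theta lambda).
Local Notation eps := (wrap_weight R theta).
Variable (A : set (b.-tuple RR)).
Hypothesis mA : measurable A.
Hypothesis A_cube : A `<=` @unit_cube R b.
Hypothesis n_gt0 : (0 < n)%N.
Hypothesis x01 : forall i, torus (x i).
Variables (z : 'I_n -> R[i]) (P P' : 'M[R[i]]_n).
Hypothesis PP' : P *m P' = 1%:M.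
Hypothesis P'P : P' *m P = 1%:M.
Hypothesis sum_beads :
  \sum_h ev_mx eps%:C (inr h) = P *m diag_mx (\row_j z j) *m P'.

Definition weight_bound : R := \sum_(S : {set 'I_n}) `|q| ^+ #|~: S|.

Lemma weight_bound_ge0 : 0 <= weight_bound.
Proof. by apply: sumr_ge0 => S _; exact: exprn_ge0. Qed.

Lemma list_weight_bound (L : seq (R * event n)) : `|list_weight q eps L| <= weight_bound.
Proof.
apply: (le_trans (ler_norm_sum _ _ _)); apply: ler_sum => S _.
rewrite normrM normrX ler_piMr ?exprn_ge0 //; case: ifP => _; last by rewrite normr0 ler01.
by rewrite /wrap_weight normrX normrM !normrX normrN1 !expr1n mulr1 expr1n.
Qed.

Lemma bead_average_bound (L : seq (R * event n)) r :
  `|bead_average q eps L r| <= weight_bound * n%:R ^+ r.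
Proof.
apply: (le_trans (ler_norm_sum _ _ _)).
apply: (@le_trans _ _ (\sum_(w : {ffun 'I_r -> 'I_n}) weight_bound)).
  apply: ler_sum => w _; apply: cube_integral_norm; first exact: bmeasurable_with_beads.
  by move=> s; exact: list_weight_bound.
by rewrite sumr_const card_ffun !card_ord -natrX mulr_natr.
Qed.

Local Notation Ls s := (with_beads Lx s hh).

Lemma bmeasurable_bead_average r : bmeasurable (fun s : b.-tuple RR => bead_average q eps (Ls s) r).
Proof.
apply: bmeasurable_sum => w.
pose ext : 'I_(b + r) -> 'I_n := fun i => match fintype.split i with inl j => hh j | inr j => w j end.
rewrite (_ : (fun _ => _) = fun s : b.-tuple RR => cube_integral (fun t : r.-tuple RR =>
    list_weight q eps (with_beads Lx (cat_pair s t) ext))).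
  by apply: (@bmeasurable_cat R b r (fun u : (b + r).-tuple RR => list_weight q eps (with_beads Lx u ext))); exact: bmeasurable_with_beads.
apply/funext => s; congr cube_integral; apply/funext => t; rewrite with_beads_cat.
have -> : (fun j => ext (lshift r j)) = hh.
  by apply/funext => j; rewrite /ext (unsplitK (inl j)).
by have -> : (fun j => ext (rshift b j)) = w by apply/funext => j; rewrite /ext (unsplitK (inr j)).
Qed.

Definition exp_weight (s : b.-tuple R) : R[i] :=
  evolution_trace eps%:C z P P' q%:C (fun x => cexp (T%:C * x)) (Ls s).

Definition density (s : b.-tuple RR) : R := \1_A s * complex.Re (exp_weight s).

Lemma timed_from_with_beads (s : b.-tuple R) : @unit_cube R b s -> timed_from 0 (Ls s).
Proof.
move=> s01; apply: timed_from_insert_all => [|j].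
  apply: timed_from_insert_all => //=; rewrite ?ler01 // => j.
  have /mapP[i _ ->] := mem_tnth j (in_tuple [seq observation x i | i <- enum {: O + U}]).
  by have /= /andP[x0 x1] := x01 i; case: i x0 x1 => i /= -> /ltW ->.
have /mapP[i _ ->] := mem_tnth j (in_tuple (bead_seq s hh)).
by have /= /andP[-> /ltW ->] := s01 i.
Qed.

(** The partial sums are real averages, so their limit, the trace of the flow, is real. *)
Lemma bead_average_cvg s : @unit_cube R b s ->
  (\sum_(r < M) T ^+ r / r`!%:R * bead_average q eps (Ls s) r) @[M --> \oo]
    --> complex.Re (exp_weight s) /\ complex.Im (exp_weight s) = 0.
Proof.
move=> s01; have [re im] := evolution_trace_exp_series eps%:C z P P' q%:C T (Ls s).
have E M : \sum_(r < M) (T ^+ r / r`!%:R)%:C *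
      evolution_trace eps%:C z P P' q%:C (fun x => x ^+ r) (Ls s) =
    (\sum_(r < M) T ^+ r / r`!%:R * bead_average q eps (Ls s) r)%:C.
  rewrite rmorph_sum; apply: eq_bigr => r _; rewrite [RHS]rmorphM; congr (_ * _).
  by rewrite -(bead_average_trace q PP' P'P sum_beads) //; exact: timed_from_with_beads.
split.
  rewrite (_ : (fun M => _) = (fun M => complex.Re (\sum_(r < M) (T ^+ r / r`!%:R)%:C *
      evolution_trace eps%:C z P P' q%:C (fun x => x ^+ r) (Ls s)))); first exact: re.
  by apply/funext => M; rewrite E.
have <- := cvg_lim (@norm_hausdorff _ _) im.
rewrite (_ : (fun M => _) = fun=> 0); last by apply/funext => M; rewrite E.
by apply: cvg_lim; [exact: norm_hausdorff|exact: cvg_cst].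
Qed.

Lemma family_integral_cvg : bmeasurable density /\
  (\sum_(r < M) T ^+ r / r`!%:R * family_integral r q eps A hh Lx) @[M --> \oo]
    --> cube_integral density.
Proof.
pose f_ M (s : b.-tuple RR) := \1_A s * \sum_(r < M) T ^+ r / r`!%:R * bead_average q eps (Ls s) r.
have bf1 M (r : 'I_M) : bmeasurable (fun s : b.-tuple RR => T ^+ r / r`!%:R * bead_average q eps (Ls s) r).
  by apply: bmeasurableM; [exact: bmeasurable_cst|exact: bmeasurable_bead_average].
have bf M : bmeasurable (f_ M).
  apply: bmeasurableM; first exact: bmeasurable_indic.
  exact: (bmeasurable_sum _ (bf1 M)).
have intE M : cube_integral (f_ M) = \sum_(r < M) T ^+ r / r`!%:R * family_integral r q eps A hh Lx.
  rewrite (_ : f_ M = fun s => \sum_(r < M) T ^+ r / r`!%:R * (\1_A s * bead_average q eps (Ls s) r)).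
    have bA r : bmeasurable (fun s : b.-tuple RR => \1_A s * bead_average q eps (Ls s) r).
      by apply: bmeasurableM; [exact: bmeasurable_indic|exact: bmeasurable_bead_average].
    rewrite cube_integral_sum => [|r]; last by apply: bmeasurableM; first exact: bmeasurable_cst.
    by apply: eq_bigr => r _; rewrite cube_integralZ.
  by apply/funext => s; rewrite /f_ mulr_sumr; apply: eq_bigr => r _; rewrite mulrCA.
under eq_fun do rewrite -intE.
(* The [r] free beads have [n ^ r] words, each of weight at most [weight_bound], so the exponential
   series at [|T| n] dominates. *)
apply: (@cube_integral_dominated _ _ _ _ (weight_bound * expR (`|T| * n%:R))).
- by move=> M; have [] := bf M.
- move=> M s; rewrite /f_ normrM.
  apply: (@le_trans _ _ (\sum_(r < M) `|T| ^+ r / r`!%:R * (weight_bound * n%:R ^+ r))).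
    apply: (@le_trans _ _ (1 * `|\sum_(r < M) T ^+ r / r`!%:R * bead_average q eps (Ls s) r|)).
      by rewrite ler_wpM2r // indicE; case: (_ \in _); rewrite ?normr1 ?normr0.
    rewrite mul1r; apply: (le_trans (ler_norm_sum _ _ _)); apply: ler_sum => r _.
    rewrite normrM; have -> : `|T ^+ r / r`!%:R| = `|T| ^+ r / r`!%:R.
      by rewrite normrM normrX normfV normr_nat.
    apply: ler_wpM2l; last exact: bead_average_bound.
    by apply: mulr_ge0; [exact: exprn_ge0|rewrite invr_ge0].
  rewrite (eq_bigr (fun r : 'I_M => weight_bound * ((`|T| * n%:R) ^+ r / r`!%:R))) => [|r _].
    rewrite -mulr_sumr ler_wpM2l ?weight_bound_ge0 //; apply: exp_series_le.
    by rewrite mulr_ge0.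
  by rewrite exprMn; ring.
move=> s; rewrite /density /f_; have [sA|sA] := boolP (s \in A); last first.
  rewrite indicE (negPf sA) mul0r; under eq_fun do rewrite mul0r; exact: cvg_cst.
apply: cvgM; first exact: cvg_cst.
by have [] := bead_average_cvg (A_cube (set_mem sA)).
Qed.

(** For [N = b + r] the factor [T^N / N!] meets [N! / r!] injections of the marked beads; this
    leaves [T^b] times the series in [r] that was just summed. *)
Lemma weighted_integral_density Z :
  weighted_integral theta lambda T Z (event_count x h A) =
  prefactor R n theta / Z * (T ^+ b * cube_integral density).
Proof.
have [_ cvgJ] := family_integral_cvg.
pose a N := T ^+ N / N`!%:R * word_weight theta lambda x h A N.
have aE r : a (b + r)%N = T ^+ b * (T ^+ r / r`!%:R * family_integral r q eps A hh Lx).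
  rewrite /a word_weight_average // exprD.
  have := ffact_fact (leq_addr r b); rewrite addKn => <-; rewrite natrM.
  have f0 : ((b + r) ^_ b)%:R != 0 :> R by rewrite pnatr_eq0 -lt0n ffact_gt0 leq_addr.
  have r0 : r`!%:R != 0 :> R by rewrite pnatr_eq0 -lt0n fact_gt0.
  by field; rewrite f0 r0.
have cvgS : (\sum_(N < M) a N) @[M --> \oo] --> T ^+ b * cube_integral density.
  rewrite -(cvg_shiftn b) (_ : [sequence _]_M = fun M => T ^+ b *
      \sum_(r < M) T ^+ r / r`!%:R * family_integral r q eps A hh Lx).
    by apply: cvgM; [exact: cvg_cst|exact: cvgJ].
  apply/funext => M /=; rewrite addnC big_split_ord /= big1 ?add0r.
    by rewrite mulr_sumr; apply: eq_bigr => r _; rewrite aE.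
  by move=> i _; rewrite /a word_weight_short ?mulr0.
(* Passing to multiples of [n] takes a subsequence of the partial sums. *)
have cvgn : (\sum_(N < n * K) a N) @[K --> \oo] --> T ^+ b * cube_integral density.
  apply: (@cvg_comp _ _ _ (fun K => n * K)%N (fun M => \sum_(N < M) a N) _ \oo) => //.
  move=> V [N _ NV]; exists N => // K /= NK; apply: NV => /=.
  by rewrite (leq_trans NK) // leq_pmull.
rewrite weighted_integral_series //; set c := prefactor R n theta / Z.
have -> : limn (fun K : nat => \sum_(1 <= k < K) c * (T ^+ (n * k) / (n * k)`!%:R *
    word_weight theta lambda x h A (n * k))) =
    c * (T ^+ b * cube_integral density - word_weight theta lambda x h A 0).
  apply/cvg_lim => //; rewrite -cvg_shiftS.
  rewrite (_ : [sequence _]_K = fun K => c * (\sum_(N < n * K.+1) a N - word_weight theta lambda x h A 0)).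
    apply: cvgM; first exact: cvg_cst.
    apply: cvgB; last exact: cvg_cst.
    by move: cvgn; rewrite -cvg_shiftS.
  apply/funext => K /=; rewrite sum_word_weight_multiples // -mulr_sumr; congr (_ * _).
  by rewrite addrAC subrr add0r.
by rewrite -mulrDr addrCA subrr addr0.
Qed.
End SeriesLimit.

(** * Absolute convergence *)

Section Integrability.
Variables (R : realType) (n : nat) (theta : bool * bool) (lambda T : R).
Variables (O U B : finType) (x : O + U -> R * 'I_n) (h : B -> 'I_n).
Local Notation b := (#|B|).
Local Notation RR := (measurableTypeR R).
Local Notation hh := (fun j : 'I_b => h (enum_val j)).
Variable (A : set (b.-tuple RR)).
Hypothesis mA : measurable A.
Hypothesis n_gt0 : (0 < n)%N.
Hypothesis x01 : forall i, torus (x i).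

Lemma bin_le_exp2 N i : ('C(N, i) <= 2 ^ N)%N.
Proof.
have [iN|iN] := leqP i N; last by rewrite bin_small.
by rewrite -[2%N]/(1 + 1)%N Pascal (bigD1 (Ordinal (iN : (i < N.+1)%N))) //= !exp1n !muln1 leq_addr.
Qed.

Lemma count_families_le N (t : N.-tuple R) (w : 'I_N -> 'I_n) :
  (count_families A hh t w <= 2 ^ N * b`!)%N.
Proof.
apply: (@leq_trans (N ^_ b)); last by rewrite -bin_ffact leq_mul2r bin_le_exp2 orbT.
have := card_inj_ffuns 'I_b 'I_N; rewrite !card_ord => <-.
by apply/subset_leq_card/fintype.subsetP => psi; rewrite !inE => /andP[].
Qed.

(** At generic times the [N!] rearrangements of an array reduce to at most one non-zero term per
    word. With [n ^ N] words instead of [N!] orders, the factor [1 / N!] survives and makes the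
    bounds summable for every [T]. *)
Lemma array_integral_le k c D : (0 < k)%N -> (forall l, (l < n.+1)%N -> 0 <= c l <= D) ->
  (n * k)`!%:R * cube_integral (array_integrand x h A c : (n * k).-tuple RR -> R) <=
  D * (2 ^ (n * k) * b`!)%:R * n%:R ^+ (n * k).
Proof.
move=> k0 cD; set N := (n * k)%N; have D0 : 0 <= D by have /andP[/le_trans] := cD 0%N isT; apply.
have bG := bmeasurable_array_integrand k x h mA c.
have bGp (sg : 'S_N) : bmeasurable (fun t => array_integrand x h A c (tuple_perm sg t) : R).
  by apply: (bmeasurable_comp bG); exact: measurable_tuple_perm.
have G_le (s : N.-tuple R) : 0 <= array_integrand x h A c s <= D * (2 ^ N * b`!)%:R.
  have gn : (gt_count (array_of_tuple s) < n.+1)%N.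
    by rewrite ltnS -[X in (_ <= X)%N]card_ord; exact: max_card.
  have /andP[c0 c1] := cD _ gn.
  have cnt := count_families_le s (@string_of n k).
  rewrite /array_integrand; case: (bead_array _) => /=; last by rewrite !mul0r lexx mulr_ge0.
  case: (observed _ _) => /=; last by rewrite mulr0 !mul0r lexx mulr_ge0.
  by rewrite !mul1r mulr_ge0 //= ler_pM // ler_nat.
have -> : N`!%:R * cube_integral (array_integrand x h A c : N.-tuple RR -> R) =
    cube_integral (fun t : N.-tuple RR => \sum_(sg : 'S_N) array_integrand x h A c (tuple_perm sg t)).
  rewrite cube_integral_sum // (eq_bigr (fun=> cube_integral (array_integrand x h A c : N.-tuple RR -> R))).
    by rewrite sumr_const card_Sn mulr_natl.
  by move=> sg _; rewrite cube_integral_perm.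
have mD : measurable (~` @degenerate R [::] N) by apply: measurableC; exact: measurable_degenerate.
have bS : bmeasurable (fun t : N.-tuple RR => \sum_(sg : 'S_N) array_integrand x h A c (tuple_perm sg t)).
  exact: bmeasurable_sum.
(* The pointwise bound holds at distinct times; multiplying by the indicator of these makes it hold
   on the whole cube without changing the integral. *)
rewrite (@cube_integral_generic _ _ [::] _ (fun t : N.-tuple RR => \1_(~` @degenerate R [::] N) t *
    \sum_(sg : 'S_N) array_integrand x h A c (tuple_perm sg t))) //; last 2 first.
- by apply: bmeasurableM => //; exact: bmeasurable_indic.
- by move=> s _ sU; rewrite indicE mem_set ?mul1r //= /degenerate /=; apply/negP; rewrite negbK.
rewrite -[leRHS](@cube_integral_cst _ N); apply: cube_integral_le.
- by apply: bmeasurableM => //; exact: bmeasurable_indic.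
- exact: bmeasurable_cst.
move=> t t01; rewrite indicE; have [tU|_] := boolP (t \in _); last first.
  by rewrite mul0r mulr_ge0 ?exprn_ge0 // mulr_ge0.
have {}tU : uniq t by move/set_mem: tU => /negP; rewrite negbK cats0.
(* The value at a word is that of its sorted array, and zero when no permutation sorts it. *)
pose Psi (w : {ffun 'I_N -> 'I_n}) : R :=
  if [pick sg | sorting t w sg] is Some sg then array_integrand x h A c (tuple_perm sg t) else 0.
rewrite mul1r (@sum_sorting _ _ _ t (array_integrand x h A c) Psi) //; last first.
- move=> w nw; rewrite /Psi; case: pickP => // sg /sorting_equidistributed.
  by rewrite (negPf nw).
- move=> w sg sgS; rewrite /Psi; case: pickP => [sg' sgS'|/(_ sg)]; last by rewrite sgS.
  by rewrite (sorting_unique tU sgS sgS').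
- by move=> s ns; rewrite /array_integrand /bead_array (negPf ns) !mul0r.
apply: (@le_trans _ _ (\sum_(w : {ffun 'I_N -> 'I_n}) D * (2 ^ N * b`!)%:R)).
  apply: ler_sum => w _; rewrite /Psi; case: pickP => [sg _|_]; last by rewrite mulr_ge0.
  by have /andP[] := G_le (tuple_perm sg t).
by rewrite sumr_const card_ffun !card_ord -[_ *+ _]mulr_natr natrX.
Qed.

Lemma signed_density_le Z k l : (l < n.+1)%N ->
  `|signed_density n theta lambda T Z k l| <= `|Z|^-1 * expR (`|lambda| * n%:R) * `|T| ^+ (n * k).
Proof.
move=> ln; rewrite /signed_density !normrM !normfV !normrX normrN1 expr1n mulr1.
rewrite (gtr0_norm (expR_gt0 _)) (ger0_norm (ler0n _ 2)).
have e1 : expR (- (lambda * l%:R)) <= expR (`|lambda| * n%:R).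
  rewrite ler_expR (le_trans (ler_norm _)) // normrN normrM normr_nat ler_wpM2l // ler_nat.
  by rewrite -ltnS.
have z0 : 0 <= `|T| ^+ (n * k) / `|Z| by rewrite mulr_ge0 ?exprn_ge0 ?invr_ge0.
rewrite [leRHS](_ : _ = `|T| ^+ (n * k) / `|Z| * expR (`|lambda| * n%:R)); last by ring.
have half_le : `|T| ^+ (n * k) / `|Z| * 2^-1 <= `|T| ^+ (n * k) / `|Z|.
  by rewrite ler_piMr // invf_le1 ?ler1n.
by apply: ler_pM; rewrite ?expR_ge0 // mulr_ge0 ?invr_ge0.
Qed.

Lemma event_count_ge0 (c : configuration R n) : 0 <= event_count x h A c.
Proof. by rewrite /event_count mulr_ge0. Qed.

Lemma sum_multiples_le (g : nat -> R) K : (forall N, 0 <= g N) ->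
  \sum_(1 <= k < K) g (n * k)%N <= \sum_(N < n * K) g N.
Proof.
move=> g0; rewrite -(big_mkord predT g); elim: K => [|K IH].
  by rewrite [leLHS]big_geq //; apply: sumr_ge0.
case: K IH => [|K] IH; first by rewrite [leLHS]big_geq //; apply: sumr_ge0.
have le_nK : (n * K.+1 <= n * K.+2)%N by rewrite leq_mul2l leqnSn orbT.
have -> : \sum_(0 <= N < n * K.+2) g N =
    \sum_(0 <= N < n * K.+1) g N + \sum_(n * K.+1 <= N < n * K.+2) g N.
  by rewrite -big_cat_nat.
rewrite [leLHS]big_nat_recr //=; apply: lerD => //.
by rewrite big_ltn ?ltn_pmul2l // lerDl; apply: sumr_ge0.
Qed.

Lemma event_count_bead_integrable : bead_integrable theta lambda T (event_count x h A).
Proof.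
split=> [k l k0|]; first exact: event_count_integrable.
set Z := partition_function _ _ _ _.
pose D := `|Z|^-1 * expR (`|lambda| * n%:R).
(* The three factors come from the families of marked beads (at most [2 ^ N * b!]), the density and
   the [n ^ N] words. *)
pose y : R := 2 * `|T| * n%:R.
have y0 : 0 <= y by rewrite !mulr_ge0.
have D0 : 0 <= D by rewrite mulr_ge0 ?invr_ge0 ?expR_ge0.
pose F k l := (\int[lebesgue_tuple R (n * k)]_(s in @nkl_configurations R n k l)
  `|event_count x h A (configuration_of_tuple s)|%:E)%E.
have F0 k l : (0 <= F k l)%E by apply: integral_ge0 => s _; rewrite lee_fin.
have term_le k : (0 < k)%N -> (\sum_(l < n.+1) `|signed_density n theta lambda T Z k l|%:E * F k l <=
    (D * b`!%:R * (y ^+ (n * k) / (n * k)`!%:R))%:E)%E.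
  move=> k0; have FE l : F k l = (\int[lebesgue_tuple R (n * k)]_(s in @nkl_configurations R n k l)
      event_count x h A (configuration_of_tuple s))%:E.
    rewrite /Rintegral fineK; last first.
      apply: integrable_fin_num; first exact: (measurable_nkl_configurations x n_gt0 k0).
      exact: event_count_integrable.
    by apply: eq_integral => s _; rewrite ger0_norm // event_count_ge0.
  rewrite (eq_bigr (fun l : 'I_n.+1 => (`|signed_density n theta lambda T Z k l| *
      \int[lebesgue_tuple R (n * k)]_(s in @nkl_configurations R n k l)
        event_count x h A (configuration_of_tuple s))%:E)) => [|l _]; last by rewrite FE EFinM.
  rewrite sumEFin lee_fin (@sum_event_count _ _ _ _ _ _ x h A mA n_gt0 k0 x01 (fun l => `|signed_density n theta lambda T Z k l|)).
  have f0 : 0 < (n * k)`!%:R :> R by rewrite ltr0n fact_gt0.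
  rewrite -(ler_pM2l f0).
  have := @array_integral_le k (fun l => `|signed_density n theta lambda T Z k l|) (D * `|T| ^+ (n * k)) k0.
  move=> /(_ _)/le_trans; apply; first by move=> l ln; rewrite normr_ge0 signed_density_le.
  rewrite le_eqVlt; apply/orP; left; apply/eqP; rewrite /y !exprMn natrM natrX.
  by field; rewrite gt_eqF.
apply: (@le_lt_trans _ _ (D * b`!%:R * expR y)%:E); last exact: ltry.
have cvgS : cvgn (fun K => \sum_(1 <= k < K) \sum_(l < n.+1)
    `|signed_density n theta lambda T Z k l|%:E * F k l)%E.
  apply: is_cvg_nneseries => k _ _; apply: sume_ge0 => l _; exact: mule_ge0.
apply: (lime_le cvgS).
apply: nearW => K.
apply: (@le_trans _ _ (\sum_(1 <= k < K) (D * b`!%:R * (y ^+ (n * k) / (n * k)`!%:R))%:E)%E).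
  by rewrite !big_nat; apply: lee_sum => k /andP[k0 _]; exact: term_le.
rewrite sumEFin lee_fin -mulr_sumr ler_wpM2l ?mulr_ge0 //.
apply: le_trans (exp_series_le (n * K) y0).
by apply: (@sum_multiples_le (fun N => y ^+ N / N`!%:R)) => N; rewrite mulr_ge0 ?exprn_ge0 ?invr_ge0.
Qed.
End Integrability.

(** * Spectrum of the twisted shift *)

Section Roots.
Variables (R : realType) (n : nat) (theta : bool * bool).
Local Notation C := R[i].
Local Notation eps := (wrap_weight R theta).
Hypothesis n_gt0 : (0 < n)%N.

Let n_neq0 : n%:R != 0 :> C.
Proof. by rewrite pnatr_eq0 -lt0n. Qed.

Let eps_neq0 : eps%:C != 0 :> C.
Proof. by rewrite fmorph_eq0 /wrap_weight expf_neq0 // oppr_eq0 oner_eq0. Qed.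

Lemma twisted_roots_enum : exists r : n.-tuple C, uniq r /\
  forall w, (w \in r) = (w ^+ n == eps%:C).
Proof.
pose p : {poly C} := 'X^n - (eps%:C)%:P.
have [r rE] := closed_field_poly_normal p.
have monp : lead_coef p = 1 by exact/monicP/monicXnsubC.
rewrite monp scale1r in rE.
have szr : size r == n.
  by have := size_XnsubC (eps%:C) n_gt0; rewrite -/p rE size_prod_XsubC => -[->].
have ur : uniq r.
  rewrite -separable_prod_XsubC -rE separable_poly.unlock; apply/Bezout_coprimepP.
  (* Bezout coefficients for the polynomial and its derivative: [n (X^n - eps) - X (n X^(n-1))] is
     the non-zero constant [- n eps], so the roots are simple. *)
  exists (n%:R%:P, - 'X) => /=; rewrite /p derivB derivXn derivC subr0.
  have -> : n%:R%:P * ('X^n - (eps%:C)%:P) + - 'X * ('X^(n.-1) *+ n) = (- (n%:R * eps%:C))%:P :> {poly C}.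
    have -> : 'X^n = 'X * 'X^(n.-1) :> {poly C} by rewrite -exprS prednK.
    by rewrite polyCN polyCM polyC_natr -[_ *+ n]mulr_natl; ring.
  by rewrite polyC_eqp1 ?oppr_eq0 ?mulf_neq0.
exists (Tuple szr); split => // w.
rewrite -[w \in _]/(w \in r) -root_prod_XsubC -rE /root /p !hornerE.
by rewrite subr_eq0.
Qed.
End Roots.

Section Spectral.
Variables (R : realType) (n : nat) (theta : bool * bool).
Local Notation C := R[i].
Local Notation eps := (wrap_weight R theta).
Hypothesis n_gt0 : (0 < n)%N.
Variable r : n.-tuple C.
Hypothesis r_uniq : uniq r.
Hypothesis rP : forall w, (w \in r) = (w ^+ n == eps%:C).

Local Notation z := (tnth r).

Let n_neq0 : n%:R != 0 :> C.
Proof. by rewrite pnatr_eq0 -lt0n. Qed.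

Lemma root_exp j : z j ^+ n = eps%:C.
Proof. by apply/eqP; rewrite -rP mem_tnth. Qed.

Lemma root_neq0 j : z j != 0.
Proof.
have : z j ^+ n != 0.
  by rewrite root_exp fmorph_eq0 /wrap_weight expf_neq0 // oppr_eq0 oner_eq0.
by rewrite expf_eq0 n_gt0.
Qed.

(** Column [j] is the eigenvector [h -> z_j^(-h)] of the twisted shift; the inverse comes from the
    vanishing of geometric sums of [n]-th roots of unity. *)
Definition root_mx : 'M[C]_n := \matrix_(h < n, j < n) (z j)^-1 ^+ h.
Definition root_inv_mx : 'M[C]_n := \matrix_(j < n, h < n) (z j ^+ h / n%:R).

Lemma root_inv_mxK : root_inv_mx *m root_mx = 1%:M.
Proof.
apply/matrixP => i j; rewrite !mxE.
transitivity ((\sum_(h < n) (z i / z j) ^+ h) / n%:R).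
  by rewrite mulr_suml; apply: eq_bigr => h _; rewrite !mxE exprMn mulrAC.
have [->|ij] := eqVneq i j.
  rewrite divff ?root_neq0 // (eq_bigr (fun=> 1)) => [|h _]; last by rewrite expr1n.
  by rewrite sumr_const card_ord divff.
have w1 : z i / z j - 1 != 0.
  rewrite subr_eq0; apply: contra ij => /eqP w; apply/eqP.
  have /tuple_uniqP := r_uniq; apply.
  by rewrite -[LHS](divfK (root_neq0 j)) w mul1r.
have := subrX1 (z i / z j) n; rewrite expr_div_n !root_exp divff; last first.
  by rewrite -(root_exp i) expf_neq0 // root_neq0.
rewrite subrr => /esym/eqP; rewrite mulf_eq0 (negPf w1) /= => /eqP ->.
by rewrite mul0r.
Qed.

Lemma root_mxK : root_mx *m root_inv_mx = 1%:M.
Proof. exact: mulmx1C root_inv_mxK. Qed.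

(** The eigenvector equation is immediate away from the cut; there the twist [eps] is compensated by
    [z_j^n = eps]. *)
Lemma sum_bead_mx : \sum_h ev_mx eps%:C (inr h) =
  root_mx *m diag_mx (\row_j z j) *m root_inv_mx.
Proof.
rewrite -[LHS]mulmx1 -root_mxK mulmxA; congr (_ *m _); apply/matrixP => g j.
have -> : (root_mx *m diag_mx (\row_j z j)) g j = (z j)^-1 ^+ g * z j.
  by rewrite mul_mx_diag !mxE.
have sumE i : (\sum_h ev_mx eps%:C (inr h) : 'M[C]_n) g i = twist eps%:C i * (g == ordS i)%:R.
  rewrite summxE (bigD1 i) //= big1 ?addr0 => [|h hi]; first by rewrite !mxE eqxx andbT.
  by rewrite !mxE [i == h]eq_sym (negPf hi) andbF mulr0.
rewrite mxE (eq_bigr _ (fun i _ => congr1 (fun c => c * root_mx i j) (sumE i))).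
rewrite (bigD1 (ord_pred g)) //= big1 ?addr0 => [|i ig]; last first.
  case: eqP => [gE|_]; last by rewrite mulr0 mul0r.
  by case/eqP: ig; rewrite gE ordSK.
rewrite ord_predK eqxx mulr1 mxE; set h := ord_pred g; have gE : g = ordS h by rewrite ord_predK.
clearbody h; rewrite {}gE /twist; have [hn|hn] := eqVneq h.+1 n.
  have -> : (ordS h : nat) = 0%N by rewrite /= hn modnn.
  have expK m (c : C) : c != 0 -> c ^+ m.+1 * c^-1 ^+ m = c.
    by move=> c0; rewrite exprS -mulrA -exprMn divff // expr1n mulr1.
  by rewrite expr0 mul1r -(root_exp j) -[RHS](expK h _ (root_neq0 j)) hn.
have hlt : (h.+1 < n)%N by rewrite ltn_neqAle hn ltn_ord.
by rewrite mul1r /= modn_small // exprSr -mulrA mulVf ?root_neq0 // mulr1.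
Qed.

Lemma sum_twisted_roots (F : C -> C) :
  \sum_(w \in @twisted_roots R n theta) F w = \sum_j F (z j).
Proof.
have -> : @twisted_roots R n theta = [set` r].
  apply/seteqP; split => w; rewrite /= rP /twisted_roots /= /wrap_weight.
    by move=> ->; rewrite rmorphXn rmorphN1.
  by move/eqP ->; rewrite rmorphXn rmorphN1.
by rewrite -fsbig_seq // big_tuple.
Qed.

Definition spec_mx (d : 'I_n -> C) : 'M[C]_n :=
  root_mx *m diag_mx (\row_j d j) *m root_inv_mx.

(** The exponent is column minus row, whereas the kernels use first minus second argument: this is
    why the kernels appear transposed later. *)
Lemma spec_mxE d g h : spec_mx d g h = n%:R^-1 * \sum_j d j * z j ^ ((h : nat)%:Z - (g : nat)%:Z).
Proof.
rewrite mulr_sumr mxE; apply: eq_bigr => j _.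
rewrite mxE (bigD1 j) //= big1 ?addr0 => [|i ij]; last by rewrite !mxE (negPf ij) mulr0n mulr0.
rewrite !mxE eqxx mulr1n expfzDr ?root_neq0 // exprVn -exprnN -exprnP; ring.
Qed.

Lemma spec_mxM d d' : spec_mx d *m spec_mx d' = spec_mx (fun j => d j * d' j).
Proof.
rewrite /spec_mx -!mulmxA; congr (_ *m _).
rewrite (mulmxA root_inv_mx) root_inv_mxK mul1mx mulmxA; congr (_ *m _).
apply/matrixP => i j; rewrite mul_diag_mx !mxE; case: eqP => [->|_]; rewrite ?mulr0n ?mulr0 //.
Qed.

Lemma spec_mx_cst c : spec_mx (fun=> c) = c%:M.
Proof.
rewrite /spec_mx (_ : diag_mx _ = c%:M).
  by rewrite mul_mx_scalar -scalemxAl root_mxK scalemx1.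
by apply/matrixP => i j; rewrite !mxE.
Qed.

Lemma spec_mxD d d' : spec_mx d + spec_mx d' = spec_mx (fun j => d j + d' j).
Proof.
apply/matrixP => g h; rewrite mxE !spec_mxE -mulrDr -big_split; congr (_ * _).
by apply: eq_bigr => j _; rewrite mulrDl.
Qed.

Lemma det_spec_mx d : \det (spec_mx d) = \prod_j d j.
Proof.
rewrite /spec_mx !det_mulmx det_diag mulrAC -det_mulmx root_mxK det1 mul1r.
by apply: eq_bigr => j _; rewrite mxE.
Qed.
End Spectral.

Section FockTraceNil.
Variables (R : realType) (K : fieldType) (n : nat) (U : R -> 'M[K]_n).

Lemma fock_trace_nil q : fock_trace U q [::] = \det (q%:M + U 1).
Proof.
rewrite det_scalar_add; apply: eq_bigr => S _; congr (_ * _).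
rewrite (@asym_fock_chain R K n U #|S| 0 [::] _ _ isT) asym_tpow /= subr0.
by congr (\det _); apply/matrixP => i j; rewrite !mxE !ffunE.
Qed.
End FockTraceNil.

(** * From resolvents to the kernels *)

Section KernelMatch.
Variables (R : realType) (n : nat) (theta : bool * bool) (lambda T : R).
Local Notation C := R[i].
Local Notation q := (hole_weight theta lambda).
Local Notation eps := (wrap_weight R theta).
Hypothesis n_gt0 : (0 < n)%N.
Variable r : n.-tuple C.
Hypothesis r_uniq : uniq r.
Hypothesis rP : forall w, (w \in r) = (w ^+ n == eps%:C).
Local Notation z := (tnth r).

Let specM d d' : spec_mx r d *m spec_mx r d' = spec_mx r (fun j => d j * d' j).
Proof. by apply: (@spec_mxM R n theta). Qed.

Let specD d d' : spec_mx r d + spec_mx r d' = spec_mx r (fun j => d j + d' j).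
Proof. by apply: (@spec_mxD R n theta). Qed.

Let spec_cst c : spec_mx r (fun=> c) = c%:M.
Proof. by apply: (@spec_mx_cst R n theta). Qed.

Let specE d g h : spec_mx r d g h = n%:R^-1 * \sum_j d j * z j ^ ((h : nat)%:Z - (g : nat)%:Z).
Proof. by apply: (@spec_mxE R n theta). Qed.

Let det_spec d : \det (spec_mx r d) = \prod_j d j.
Proof. by apply: (@det_spec_mx R n theta). Qed.

Definition flow (t : R) : 'M[C]_n :=
  spectral_mx z (root_mx r) (root_inv_mx r) (fun x => cexp (T%:C * x)) t.

Definition growth (t : R) (j : 'I_n) : C := cexp ((T * t)%:C * z j).

Lemma flowE t : flow t = spec_mx r (growth t).
Proof.
rewrite /flow /spectral_mx /spec_mx; congr (_ *m diag_mx _ *m _).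
by apply/rowP => j; rewrite !mxE /growth rmorphM mulrA.
Qed.

Lemma growthD s t j : growth (s + t) j = growth s j * growth t j.
Proof. by rewrite /growth -cexpD mulrDr rmorphD mulrDl. Qed.

Lemma growth0 j : growth 0 j = 1.
Proof. by rewrite /growth mulr0 mul0r cexp0. Qed.

Lemma growth_neq0 t j : growth t j != 0.
Proof.
apply/negP => /eqP g0; have := growthD t (- t) j.
by rewrite subrr growth0 g0 mul0r => /eqP; rewrite oner_eq0.
Qed.

Lemma flowD s t : flow (s + t) = flow s *m flow t.
Proof.
rewrite !flowE specM; congr spec_mx; apply/funext => j; exact: growthD.
Qed.

Lemma flow0 : flow 0 = 1%:M.
Proof.
rewrite flowE (_ : growth 0 = fun=> 1); first exact: spec_cst.
by apply/funext => j; exact: growth0.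
Qed.

Hypothesis unit_flow : q%:C%:M + flow 1 \in unitmx.

Lemma flow_denom_neq0 j : q%:C + growth 1 j != 0.
Proof.
move: unit_flow; rewrite unitmxE unitfE flowE -(spec_cst) specD det_spec.
by move/prodf_neq0; apply.
Qed.

Lemma flow_invmx : invmx (q%:C%:M + flow 1) = spec_mx r (fun j => (q%:C + growth 1 j)^-1).
Proof.
apply: (can_inj (mulKmx unit_flow)); rewrite mulmxV //.
rewrite flowE -(spec_cst q%:C) specD specM.
rewrite -(spec_cst 1); congr spec_mx; apply/funext => j.
by rewrite divff // flow_denom_neq0.
Qed.

Definition rate : C := lambda +i* (theta.1%:R * pi).

Lemma cexp_rate : cexp (- rate) = - q%:C.
Proof.
rewrite /rate /cexp /hole_weight /=; apply/eqP; rewrite eq_complex /=.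
by case: (theta.1); rewrite ?mul1r ?mul0r ?oppr0 ?cosN ?sinN ?cospi ?sinpi ?cos0 ?sin0 /= ?addn1 ?expr1 ?expr2;
  apply/andP; split; apply/eqP; ring.
Qed.

Lemma cexp_exponent w (s : R) :
  cexp (- (exponent theta lambda T w * s%:C)) = cexp (- (rate * s%:C)) * cexp ((T * - s)%:C * w).
Proof. by rewrite -cexpD; congr cexp; rewrite /exponent /rate rmorphM rmorphN; ring. Qed.

Lemma exponent_denom j :
  1 - cexp (- exponent theta lambda T (z j)) = (q%:C + growth 1 j) / growth 1 j.
Proof.
have := cexp_exponent (z j) 1; rewrite !mulr1 => ->; rewrite cexp_rate mulNr opprK.
rewrite -[cexp (_ * z j)]/(growth (-1) j).
have g1 : growth (-1) j = (growth 1 j)^-1.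
  apply: (mulIf (growth_neq0 1 j)); rewrite -growthD addNr growth0 mulVf //; exact: growth_neq0.
by rewrite g1 mulrDl divff ?growth_neq0 // addrC.
Qed.

(* Subtracting the free propagator turns 1/(1 - u), u = exp(- exponent), into u/(1 - u). *)
Lemma propagator_entry (ti tj : R) (a : bool) (g h : 'I_n) :
  (flow (1 - ti) *m invmx (q%:C%:M + flow 1) *m flow tj) g h - a%:R * flow (tj - ti) g h =
  n%:R^-1 * cexp (rate * (ti - tj)%:C) * \sum_j z j ^ ((h : nat)%:Z - (g : nat)%:Z) *
    (cexp (- (exponent theta lambda T (z j) * (ti - tj + a%:R)%:C)) /
     (1 - cexp (- exponent theta lambda T (z j)))).
Proof.
rewrite flow_invmx !flowE !specM !specE mulrCA -mulrBr -mulrA; congr (_ * _).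
rewrite mulr_sumr mulr_sumr -sumrB; apply: eq_bigr => j _.
rewrite exponent_denom cexp_exponent.
have rate_split : cexp (- (rate * (ti - tj + a%:R)%:C)) =
    cexp (- (rate * (ti - tj)%:C)) * (if a then - q%:C else 1).
  case: a; last by rewrite addr0 mulr1.
  by rewrite -cexp_rate -cexpD; congr cexp; rewrite rmorphD /=; ring.
have rate_cancel : cexp (rate * (ti - tj)%:C) * cexp (- (rate * (ti - tj)%:C)) = 1.
  by rewrite -cexpD subrr cexp0.
have growth_split : cexp ((T * - (ti - tj + a%:R))%:C * z j) =
    growth (tj - ti) j * (if a then (growth 1 j)^-1 else 1).
  have -> : T * - (ti - tj + a%:R) = T * (tj - ti - a%:R) by ring.
  rewrite -[cexp _]/(growth (tj - ti - a%:R) j).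
  clear rate_split; case: a; last by rewrite subr0 mulr1.
  apply: (mulIf (growth_neq0 1 j)); rewrite -growthD subrK -mulrA mulVf ?mulr1 //.
  exact: growth_neq0.
have growth_ti : growth (1 - ti) j * growth tj j = growth 1 j * growth (tj - ti) j.
  rewrite -!growthD; have -> : 1 - ti + tj = 1 + (tj - ti) by ring.
  by [].
have d0 := flow_denom_neq0 j; have g0 := growth_neq0 1 j; have t0 := growth_neq0 tj j.
have growth_tiE : growth (1 - ti) j = growth 1 j * growth (tj - ti) j / growth tj j.
  by rewrite -growth_ti mulfK.
have rate0 : cexp (rate * (ti - tj)%:C) != 0.
  by apply/eqP => e; move: rate_cancel; rewrite e mul0r => /eqP; rewrite eq_sym oner_eq0.
have rateV : cexp (- (rate * (ti - tj)%:C)) = (cexp (rate * (ti - tj)%:C))^-1.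
  by apply: (mulfI rate0); rewrite rate_cancel divff.
rewrite growth_split rate_split rateV growth_tiE.
move: (z j ^ _) (cexp (rate * _)) (growth 1 j) (growth tj j) (growth (tj - ti) j) q%:C rate0 d0 g0 t0.
move=> zz X g1 gt gd qq X0 d0 g0 t0.
by case: a {rate_split growth_split} => /=; field; rewrite ?d0 ?g0 ?t0 ?X0.
Qed.
End KernelMatch.

Section InsertByPerm.
Variables (E : eqType) (lt : rel E).
Implicit Types (e : E) (s r : seq E).

Lemma perm_insert_by e s : perm_eq (insert_by lt e s) (e :: s).
Proof.
elim: s => //= e' s IH; case: ifP => // _.
by rewrite (perm_trans (y := e' :: e :: s)) ?perm_cons // -cat1s -(cat1s e) perm_catCA.
Qed.

Lemma perm_insert_all_by s r : perm_eq (insert_all_by lt s r) (r ++ s).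
Proof.
rewrite /insert_all_by; elim: r s => //= e r IH s; apply: (perm_trans (IH _)).
rewrite (perm_trans (y := r ++ e :: s)) ?perm_cat2l ?perm_insert_by //.
by rewrite -cat1s perm_catCA.
Qed.
End InsertByPerm.

(** * Matching the determinants in time order *)

Section DetMatch.
Variables (R : realType) (n : nat) (theta : bool * bool) (lambda T : R).
Local Notation C := R[i].
Local Notation q := (hole_weight theta lambda).
Local Notation eps := (wrap_weight R theta).
Hypothesis n_gt0 : (0 < n)%N.
Variable r : n.-tuple C.
Hypothesis r_uniq : uniq r.
Hypothesis rP : forall w, (w \in r) = (w ^+ n == eps%:C).
Local Notation z := (tnth r).
Local Notation U := (flow T r).
Hypothesis unit_flow : q%:C%:M + U 1 \in unitmx.
Variables (O V B : finType) (x : O + V -> R * 'I_n) (h : B -> 'I_n).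
Local Notation b := (#|B|).
Local Notation hh := (fun j : 'I_b => h (enum_val j)).
Local Notation I := (O + V + B)%type.
Hypothesis x_inj : injective x.
Variable s : b.-tuple R.
Hypothesis s_uniq : uniq (s ++ undup [seq p.1 | p <- observations x]).

Definition mark (i : I) : R * event n :=
  match i with
  | inl j => observation x j
  | inr c => (tnth s (enum_rank c), inr (h c))
  end.

(** The points are listed in the order of the insertions, so that the two matrices differ by a
    relabelling of the indices. *)
Definition marks : seq I :=
  insert_all_by (fun e e' => (mark e).1 < (mark e').1)
    (insert_all_by (fun e e' => (mark e).1 < (mark e').1) [::] [seq inl i | i <- enum {: O + V}])
    [seq inr (enum_val j) | j <- enum 'I_b].

Lemma map_mark_marks : [seq mark e | e <- marks] = with_beads (observations x) s hh.
Proof.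
rewrite /marks !map_insert_all_by /with_beads /observations; congr (insert_all (insert_all _ _) _).
  by rewrite -[LHS]map_comp.
rewrite /bead_seq -[LHS]map_comp; apply: eq_map => j /=.
by rewrite enum_valK.
Qed.

Lemma mem_marks i : i \in marks.
Proof.
rewrite (perm_mem (perm_insert_all_by _ _ _)) mem_cat (perm_mem (perm_insert_all_by _ _ _)) cats0.
case: i => [j|c].
  by apply/orP; right; apply/mapP; exists j; rewrite ?mem_enum.
by apply/orP; left; apply/mapP; exists (enum_rank c); rewrite ?mem_enum // enum_rankK.
Qed.

Lemma size_marks : size marks = #|{: I}|.
Proof.
rewrite (perm_size (perm_insert_all_by _ _ _)) size_cat (perm_size (perm_insert_all_by _ _ _)).
by rewrite cats0 size_map size_enum_ord size_map -cardE [in RHS]card_sum addnC.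
Qed.

Lemma uniq_marks : uniq marks.
Proof.
apply: (leq_size_uniq (enum_uniq {: I})) => [i _|]; first exact: mem_marks.
by rewrite size_marks -cardE.
Qed.

Definition mark_at (i : 'I_(size marks)) : I := tnth (in_tuple marks) i.

Lemma mark_at_inj : injective mark_at.
Proof. by apply/tuple_uniqP; exact: uniq_marks. Qed.

Local Notation pt := (all_points x h s).

Lemma mark1 i : (mark i).1 = (pt i).1.
Proof. by case: i => [[]|]. Qed.

Definition is_mark_bead (i : I) : bool := if i is inr _ then true else false.

Lemma mark_bead i : is_bead (mark i).2 = is_mark_bead i.
Proof. by case: i => [[]|]. Qed.

Lemma mark_at_lt (i j : 'I_(size marks)) : (i < j)%N -> generic_le (mark (mark_at i)) (mark (mark_at j)).
Proof.
move=> ij; have := pairwise_with_beads hh (pairwise_observations x) s_uniq.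
have nthE (k : 'I_(size marks)) : nth (mark (mark_at i)) [seq mark e | e <- marks] k = mark (mark_at k).
  by rewrite (nth_map (mark_at k)) ?ltn_ord //; congr mark; rewrite [RHS](tnth_nth (mark_at k)).
rewrite -map_mark_marks => /(pairwiseP (mark (mark_at i)))/(_ i j).
by rewrite !inE size_map !ltn_ord !nthE => /(_ isT isT ij).
Qed.

Let time i := (pt (mark_at i)).1.
Let strg i := (pt (mark_at i)).2.

Lemma mark_at_time (i j : 'I_(size marks)) : time i != time j -> (time i <= time j) = (i < j)%N.
Proof.
move=> ne; have [ij|ji|ij] := ltngtP i j.
- by have := generic_leW (mark_at_lt ij); rewrite !mark1.
- have := generic_leW (mark_at_lt ji); rewrite !mark1 -/(time i) -/(time j) => le.
  by apply/negbTE; rewrite -ltNge lt_neqAle eq_sym ne.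
by move: ne; rewrite /time (ord_inj ij) eqxx.
Qed.

Lemma mark_at_tie (i j : 'I_(size marks)) : time i = time j -> i != j -> ~~ is_mark_bead (mark_at i) && ~~ is_mark_bead (mark_at j).
Proof.
move=> tij ne; wlog ij : i j tij ne / (i < j)%N.
  move=> H; have [ij|ji|ij] := ltngtP i j; first exact: H.
    by rewrite andbC; apply: H; rewrite 1?eq_sym.
  by case/eqP: ne; exact: ord_inj.
have := mark_at_lt ij; rewrite /generic_le !mark_bead !mark1 -/(time i) -/(time j) tij ltxx.
by case: (is_mark_bead _); case: (is_mark_bead _).
Qed.

(** The kernel compares times, the chain compares positions in the list. They disagree on the
    diagonal or for two tied observations; the latter are on different strings, where [U 0 = 1] has
    entry zero. What remains is the Kronecker delta. *)
Lemma flow_tie (i j : 'I_(size marks)) : ~~ is_mark_bead (mark_at j) ->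
  ((time i <= time j)%R%:R - (i < j)%N%:R) * U (time j - time i) (strg i) (strg j) = (i == j)%:R :> C.
Proof.
move=> nb; have [<-|ij] := eqVneq i j.
  by rewrite lexx ltnn subr0 mul1r subrr (flow0 T n_gt0 r_uniq rP) mxE eqxx.
have [tij|tij] := eqVneq (time i) (time j); last by rewrite mark_at_time // subrr mul0r.
have /andP[nbi _] := mark_at_tie tij ij.
rewrite tij subrr (flow0 T n_gt0 r_uniq rP) mxE (negPf (_ : strg i != strg j)) ?mulr0 //.
apply: contra ij => /eqP sij; apply/eqP/mark_at_inj; move: nbi nb tij sij.
rewrite /time /strg; case: (mark_at i) => // xi _; case: (mark_at j) => // xj _ /= tij sij.
by congr inl; apply: x_inj; rewrite (surjective_pairing (x xi)) tij sij -surjective_pairing.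
Qed.

(** Apart from the indicator in the cyclic distance, the factor [exp (- rate [t' - t])] of the
    kernels is a quotient of values at the two points, hence a diagonal conjugation that leaves the
    determinant unchanged. *)
Definition gauge i : C := cexp (rate theta lambda * (time i)%:C).

Lemma gauge_neq0 i : gauge i != 0.
Proof.
apply/eqP => g0; have : gauge i * cexp (- (rate theta lambda * (time i)%:C)) = 1.
  by rewrite -cexpD subrr cexp0.
by rewrite g0 mul0r => /eqP; rewrite eq_sym oner_eq0.
Qed.

Lemma gauge_div (i j : 'I_(size marks)) : cexp (rate theta lambda * (time i - time j)%:C) = gauge i / gauge j.
Proof.
apply: (mulIf (gauge_neq0 j)); rewrite divfK ?gauge_neq0 // -cexpD -mulrDr -rmorphD.
by rewrite subrK.
Qed.

Local Notation resolvent i j g := ((U (1 - time i) *m invmx (q%:C%:M + U 1) *m U (time j)) (strg i) g).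

Lemma Kker_entry (i j : 'I_(size marks)) :
  Kker theta lambda T (pt (mark_at j)) (pt (mark_at i)) =
  - (gauge j / gauge i * (resolvent i j (strg j) -
      (time i <= time j)%R%:R * U (time j - time i) (strg i) (strg j))).
Proof.
rewrite propagator_entry // gauge_div /Kker (sum_twisted_roots r_uniq rP).
rewrite fmorphV rmorph_nat /cyclic_dist -/(time i) -/(time j) -/(strg i) -/(strg j).
have -> : time i - time j + (time i < time j)%R%:R + (time i == time j)%:R =
    time i - time j + (time i <= time j)%R%:R.
  by rewrite -addrA; congr (_ + _); case: ltgtP => _; rewrite ?addr0 ?add0r.
have gi := gauge_neq0 i; have gj := gauge_neq0 j.
set S1 := \sum_j _; set S2 := \sum_j _; have -> : S1 = S2.
  by apply: eq_bigr => k _; symmetry; exact: mulrA.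
by field; rewrite gi gj pnatr_eq0 -lt0n n_gt0.
Qed.

(** The boundary twist makes up for the reduction of [h + 1] modulo [n], since [z^n = eps]; so the
    exponent in [Hker] is left unreduced. *)
Lemma twist_exp (g j : 'I_n) : twist eps%:C g * z j ^ ((ordS g : nat)%:Z) = z j ^ ((g : nat)%:Z + 1).
Proof.
rewrite addrC -intS -!exprnP /twist; have [gn|gn] := eqVneq g.+1 n.
  have -> : (ordS g : nat) = 0%N by rewrite /= gn modnn.
  by rewrite expr0 mulr1 -(root_exp rP j) gn.
have glt : (g.+1 < n)%N by rewrite ltn_neqAle gn ltn_ord.
by rewrite mul1r /= modn_small.
Qed.

Lemma Hker_entry (i j : 'I_(size marks)) : (time i < time j)%R = (i < j)%N ->
  Hker theta lambda T (pt (mark_at j)) (pt (mark_at i)) =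
  T%:C * (gauge j / gauge i * (twist eps%:C (strg j) * (resolvent i j (ordS (strg j)) -
      (i < j)%N%:R * U (time j - time i) (strg i) (ordS (strg j))))).
Proof.
move=> tij; rewrite -tij propagator_entry // gauge_div /Hker (sum_twisted_roots r_uniq rP).
rewrite rmorphM fmorphV rmorph_nat /cyclic_dist -/(time i) -/(time j) -/(strg i) -/(strg j).
have gi := gauge_neq0 i; have gj := gauge_neq0 j.
set S1 := \sum_j _; set S2 := \sum_j _; have <- : twist eps%:C (strg j) * S2 = S1.
  rewrite mulr_sumr; apply: eq_bigr => k _; rewrite mulrA; congr (_ * _).
  rewrite !expfzDr ?(root_neq0 n_gt0 rP) // mulrA twist_exp expfzDr ?(root_neq0 n_gt0 rP) //.
  by rewrite (mulrC (z k ^ 1)).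
by field; rewrite gi gj pnatr_eq0 -lt0n n_gt0.
Qed.

Definition bead_scale (i : I) : C := if is_mark_bead i then T%:C else 1.

Local Notation insertions := [seq (p.1, event_insertion eps%:C p.2) | p <- with_beads (observations x) s hh].

(** The delta supplied by [flow_tie] cancels the constant [1] of an occupied observation, and
    becomes the [delta_ij] of an unoccupied one, whose constant is [0]. A bead brings the factor [T]
    of [Hker]. *)
Lemma Kstar_entry d (i j : 'I_(size marks)) :
  Kstar theta lambda T pt (mark_at j) (mark_at i) =
  (gauge i)^-1 * insertion_entry U d insertions q%:C i j * (bead_scale (mark_at j) * gauge j).
Proof.
have nthE (k : 'I_(size marks)) : nth d insertions k =
    ((mark (mark_at k)).1, event_insertion eps%:C (mark (mark_at k)).2).
  rewrite -map_mark_marks -map_comp (nth_map (mark_at k)) ?ltn_ord //.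
  by have <- : mark_at k = nth (mark_at k) marks k := tnth_nth _ (in_tuple marks) k.
have colE k : ins_col (event_insertion eps%:C (mark (mark_at k)).2) = strg k.
  by rewrite /strg; case: (mark_at k) => [[]|].
rewrite /insertion_entry !nthE /= colE !mark1 -/(time i) -/(time j).
have gi := gauge_neq0 i; have gj := gauge_neq0 j.
have tie := @flow_tie i j; have Kij := Kker_entry i j; have Hij := @Hker_entry i j.
have tE := @mark_at_time i j; have tieE := @mark_at_tie i j.
have jE : (mark_at j == mark_at i) = (i == j).
  by rewrite (inj_eq mark_at_inj) eq_sym.
have gij : gauge j / gauge i * (i == j)%:R = (i == j)%:R.
  by have [->|_] := eqVneq i j; rewrite ?mulr0 // mulr1 divff ?gauge_neq0.
have strgj : strg j = (pt (mark_at j)).2 by [].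
rewrite /Kstar /bead_scale in tie Kij Hij tE tieE *.
case mj : (mark_at j) => [[i0|u]|c] /= in tie Kij Hij tieE jE strgj *.
- rewrite -strgj Kij -val_eqE /= in gij *; move: (tie isT) gij.
  set a := (_ <= _)%R%:R; set l := (_ < _)%N%:R; set F := U _ _ _; set G := (_ *m _) _ _.
  rewrite -val_eqE /=; set dl := (_ == _)%:R => tieij gij.
  have -> : l * F = a * F - dl by rewrite -tieij; ring.
  transitivity (- (gauge j / gauge i * (G - a * F)) + (gauge j / gauge i * dl - gauge j / gauge i * dl)); first by ring.
  by field; rewrite gi.
- rewrite -strgj jE Kij -val_eqE /= in gij *; move: (tie isT) gij.
  set a := (_ <= _)%R%:R; set l := (_ < _)%N%:R; set F := U _ _ _; set G := (_ *m _) _ _.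
  rewrite -val_eqE /=; set dl := (_ == _)%:R => tieij gij.
  have -> : l * F = a * F - dl by rewrite -tieij; ring.
  by rewrite -[in LHS]gij; field; rewrite gi.
(* A bead ties with no other point, so comparing times agrees with comparing positions. *)
rewrite -strgj Hij; last first.
  have [tij|tij] := eqVneq (time i) (time j); last by rewrite -tE // lt_neqAle tij.
  have [->|ij] := eqVneq i j; first by rewrite ltxx ltnn.
  by have := tieE tij ij; rewrite andbF.
by field; rewrite gi.
Qed.

(** After transposition and relabelling, the matrices differ by diagonal factors on both sides. The
    gauges cancel in the product of these, and each bead leaves one factor [T]. *)
Lemma det_Kstar_match d :
  det_Kstar theta lambda T pt =
  T%:C ^+ b * \det (insertion_nth_mx U d (size insertions) insertions q%:C).
Proof.
have szL : size insertions = size marks by rewrite size_map -map_mark_marks size_map.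
rewrite szL /det_Kstar -det_tr.
pose g (i : 'I_(size marks)) : 'I_(#|{: I}|) := enum_rank (mark_at i).
have g_inj : injective g by move=> i j /enum_rank_inj/mark_at_inj.
have g_bij : bijective g.
  by apply: inj_card_bij g_inj _; rewrite !card_ord size_marks.
rewrite -(det_mxsub_bij _ g_bij).
have -> : mxsub g g (\matrix_(i < #|{: I}|, j < #|{: I}|) Kstar theta lambda T pt (enum_val i) (enum_val j))^T =
    diag_mx (\row_i (gauge i)^-1) *m insertion_nth_mx U d (size marks) insertions q%:C *m
    diag_mx (\row_j (bead_scale (mark_at j) * gauge j)).
  apply/matrixP => i j; rewrite mul_mx_diag mul_diag_mx !mxE /g !enum_rankK.
  exact: Kstar_entry.
rewrite !det_mulmx !det_diag mulrAC; congr (_ * _).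
rewrite -big_split /= (eq_bigr (fun i => bead_scale (mark_at i))) => [|i _]; last first.
  by rewrite !mxE mulrCA mulVf ?mulr1 ?gauge_neq0.
transitivity (\prod_(i : I) bead_scale i).
  rewrite [RHS](reindex mark_at) //; apply: onW_bij.
  by apply: inj_card_bij mark_at_inj _; rewrite card_ord size_marks.
rewrite (bigID is_mark_bead) /= (eq_bigr (fun=> T%:C)) => [|i ib]; last by rewrite /bead_scale ib.
rewrite [X in _ * X]big1 ?mulr1 => [|i /negPf ib]; last by rewrite /bead_scale ib.
rewrite prodr_const; congr (_ ^+ _); rewrite -(fintype.card_image (f := @inr (O + V)%type B)) => [|c c' [] //].
apply: eq_card => -[j|c]; apply/idP/fintype.imageP.
- by move=> ib; move: (ib : is_mark_bead (inl j)).
- by case.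
- by move=> _; exists c.
- by [].
Qed.
End DetMatch.

(** * Measurability of the kernel determinant *)

Section ComplexMeasurable.
Variables (R : realType) (m : nat).
Local Notation C := R[i].
Local Notation S := (m.-tuple (measurableTypeR R)).
Implicit Types (f g : S -> C) (u v : S -> R).

Definition cmeasurable f : Prop :=
  measurable_fun setT (fun s => complex.Re (f s)) /\
  measurable_fun setT (fun s => complex.Im (f s)).

Lemma cmeasurable_cst c : cmeasurable (fun=> c).
Proof. by split; exact: measurable_cst. Qed.

Lemma cmeasurable_real u : measurable_fun setT u -> cmeasurable (fun s => (u s)%:C).
Proof. by split => //=; exact: measurable_cst. Qed.

Lemma cmeasurableD f g : cmeasurable f -> cmeasurable g -> cmeasurable (fun s => f s + g s).
Proof.
move=> [fr fi] [gr gi]; split.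
  rewrite (_ : (fun _ => _) = fun s => complex.Re (f s) + complex.Re (g s)); first exact: measurable_funD.
  by apply/funext => s; rewrite raddfD.
rewrite (_ : (fun _ => _) = fun s => complex.Im (f s) + complex.Im (g s)); first exact: measurable_funD.
by apply/funext => s; rewrite raddfD.
Qed.

Lemma cmeasurableM f g : cmeasurable f -> cmeasurable g -> cmeasurable (fun s => f s * g s).
Proof.
move=> [fr fi] [gr gi]; split.
  rewrite (_ : (fun _ => _) = fun s => complex.Re (f s) * complex.Re (g s) - complex.Im (f s) * complex.Im (g s)).
    by apply: measurable_funB; exact: measurable_funM.
  by apply/funext => s; case: (f s) (g s) => [? ?] [? ?].
rewrite (_ : (fun _ => _) = fun s => complex.Re (f s) * complex.Im (g s) + complex.Im (f s) * complex.Re (g s)).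
  by apply: measurable_funD; exact: measurable_funM.
by apply/funext => s; case: (f s) (g s) => [? ?] [? ?].
Qed.

Lemma cmeasurable_sum (I : Type) (r : seq I) (f : I -> S -> C) :
  (forall i, cmeasurable (f i)) -> cmeasurable (fun s => \sum_(i <- r) f i s).
Proof.
move=> mf; elim: r => [|i r IH].
  rewrite (_ : (fun _ => _) = fun=> 0); first exact: cmeasurable_cst.
  by apply/funext => s; rewrite big_nil.
rewrite (_ : (fun _ => _) = fun s => f i s + \sum_(j <- r) f j s); first exact: cmeasurableD.
by apply/funext => s; rewrite big_cons.
Qed.

Lemma cmeasurable_prod (I : Type) (r : seq I) (f : I -> S -> C) :
  (forall i, cmeasurable (f i)) -> cmeasurable (fun s => \prod_(i <- r) f i s).
Proof.
move=> mf; elim: r => [|i r IH].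
  rewrite (_ : (fun _ => _) = fun=> 1); first exact: cmeasurable_cst.
  by apply/funext => s; rewrite big_nil.
rewrite (_ : (fun _ => _) = fun s => f i s * \prod_(j <- r) f j s); first exact: cmeasurableM.
by apply/funext => s; rewrite big_cons.
Qed.

Lemma cmeasurable_exp f : cmeasurable f -> cmeasurable (fun s => cexp (f s)).
Proof.
move=> [fr fi].
have me : measurable_fun setT (fun s => expR (complex.Re (f s))).
  by apply: (measurableT_comp _ fr); exact: measurable_expR.
have mcos : measurable_fun setT (@cos R) by apply: continuous_measurable_fun; exact: continuous_cos.
have msin : measurable_fun setT (@sin R) by apply: continuous_measurable_fun; exact: continuous_sin.
have mc : measurable_fun setT (fun s => cos (complex.Im (f s))).
  exact: (measurableT_comp mcos fi).
have ms : measurable_fun setT (fun s => sin (complex.Im (f s))).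
  exact: (measurableT_comp msin fi).
apply: cmeasurableM; first exact: cmeasurable_real.
by split.
Qed.

Lemma measurable_lt_indicator u v : measurable_fun setT u -> measurable_fun setT v ->
  measurable_fun setT (fun s => (u s < v s)%R%:R : R).
Proof.
move=> mu mv; apply: (@pattern_measurable_fun _ _ unit (fun _ s => u s < v s)) => [_|s s' /(_ tt) ->//].
exact: measurable_fun_ltr.
Qed.

Lemma measurable_eq_indicator u v : measurable_fun setT u -> measurable_fun setT v ->
  measurable_fun setT (fun s => (u s == v s)%:R : R).
Proof.
move=> mu mv; apply: (@pattern_measurable_fun _ _ bool (fun b s => if b then u s < v s else v s < u s)).
  by case; exact: measurable_fun_ltr.
move=> s s' e; have := e true; have := e false; rewrite /=.
by case: ltgtP => _; case: ltgtP.
Qed.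

(** Degenerate tuples are negligible, so integrability of [f] comes from the bound on [g]. The
    kernel determinant is integrated in this way through the trace, with which it agrees at generic
    times. *)
Lemma generic_integral F (A : set S) (f g : S -> R) : uniq F ->
  measurable A -> A `<=` @unit_cube R m -> measurable_fun setT f -> bmeasurable g ->
  (forall s, A s -> uniq ((s : seq R) ++ F) -> f s = g s) ->
  (lebesgue_tuple R m).-integrable A (EFin \o f) /\
  \int[lebesgue_tuple R m]_(s in A) f s = \int[lebesgue_tuple R m]_(s in A) g s.
Proof.
move=> uF mA A_cube mf bg fg.
have mN := @measurable_degenerate R F m; have N0 := lebesgue_tuple_degenerate m uF.
have intg := bmeasurable_integrable bg mA A_cube.
have mD : measurable (A `\` @degenerate R F m) by exact: measurableD.
have fgD s : s \in A `\` @degenerate R F m -> (EFin \o g) s = (EFin \o f) s.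
  move=> /set_mem[sA sN] /=; rewrite fg //.
  by apply: contrapT => /negP sN'; apply: sN.
have intf : (lebesgue_tuple R m).-integrable A (EFin \o f).
  apply/(negligible_integrable mN mA _ N0); first by apply/measurable_EFinP; exact: measurable_funTS.
  by apply: (eq_integrable mD _ _ fgD); apply: integrableS intg => // s [].
split=> //; rewrite /Rintegral (negligible_integral mN mA intf N0).
rewrite [in RHS](negligible_integral mN mA intg N0); congr fine.
by apply: eq_integral => s sD; rewrite -fgD.
Qed.
End ComplexMeasurable.

Section MeasurableKernel.
Variables (R : realType) (n : nat) (theta : bool * bool) (lambda T : R).
Local Notation C := R[i].
Variable r : n.-tuple C.
Hypothesis r_uniq : uniq r.
Hypothesis rP : forall w, (w \in r) = (w ^+ n == (wrap_weight R theta)%:C).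
Variables (O U B : finType) (x : O + U -> R * 'I_n) (h : B -> 'I_n).
Local Notation b := (#|B|).
Local Notation S := (b.-tuple (measurableTypeR R)).

Lemma measurable_point_time i : measurable_fun setT (fun s : S => (all_points x h s i).1).
Proof. by case: i => [j|c] /=; [exact: measurable_cst|exact: measurable_tnth]. Qed.

Lemma measurable_cyclic_dist i j : measurable_fun setT (fun s : S =>
  cyclic_dist (all_points x h s i).1 (all_points x h s j).1).
Proof.
have mi := measurable_point_time i; have mj := measurable_point_time j.
apply: measurable_funD; first exact: measurable_funB.
exact: measurable_lt_indicator.
Qed.

Lemma cmeasurable_exp_dist w (u : S -> R) : measurable_fun setT u ->
  cmeasurable (fun s => cexp (- (exponent theta lambda T w * (u s)%:C))).
Proof.
move=> mu; apply: cmeasurable_exp.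
rewrite (_ : (fun _ => _) = fun s => - exponent theta lambda T w * (u s)%:C).
  by apply: cmeasurableM; [exact: cmeasurable_cst|exact: cmeasurable_real].
by apply/funext => s; rewrite mulNr.
Qed.

Lemma cmeasurable_Kker i j : cmeasurable (fun s : S =>
  Kker theta lambda T (all_points x h s i) (all_points x h s j)).
Proof.
have mi := measurable_point_time i; have mj := measurable_point_time j.
have s_indep k (s s' : S) : (all_points x h s k).2 = (all_points x h s' k).2 by case: k.
pose s0 : S := [tuple 0 | _ < b].
rewrite (_ : (fun _ => _) = fun s : S => - (n%:R^-1)%:C * \sum_(k <- index_enum 'I_n)
    ((tnth r k ^ (((all_points x h s0 i).2 : nat)%:Z - ((all_points x h s0 j).2 : nat)%:Z)) *
     cexp (- (exponent theta lambda T (tnth r k) * (cyclic_dist (all_points x h s i).1 (all_points x h s j).1 +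
       ((all_points x h s j).1 == (all_points x h s i).1)%:R)%:C)) /
     (1 - cexp (- exponent theta lambda T (tnth r k))))).
  apply: cmeasurableM; first exact: cmeasurable_cst.
  apply: cmeasurable_sum => k; apply: cmeasurableM; last exact: cmeasurable_cst.
  apply: cmeasurableM; first exact: cmeasurable_cst.
  apply: cmeasurable_exp_dist; apply: measurable_funD; first exact: measurable_cyclic_dist.
  exact: measurable_eq_indicator.
apply/funext => s; rewrite /Kker (sum_twisted_roots r_uniq rP).
by rewrite (s_indep i s s0) (s_indep j s s0).
Qed.

Lemma cmeasurable_Hker i j : cmeasurable (fun s : S =>
  Hker theta lambda T (all_points x h s i) (all_points x h s j)).
Proof.
have mi := measurable_point_time i; have mj := measurable_point_time j.
have s_indep k (s s' : S) : (all_points x h s k).2 = (all_points x h s' k).2 by case: k.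
pose s0 : S := [tuple 0 | _ < b].
rewrite (_ : (fun _ => _) = fun s : S => (T / n%:R)%:C * \sum_(k <- index_enum 'I_n)
    ((tnth r k ^ (1 + ((all_points x h s0 i).2 : nat)%:Z - ((all_points x h s0 j).2 : nat)%:Z)) *
     (cexp (- (exponent theta lambda T (tnth r k) * (cyclic_dist (all_points x h s i).1 (all_points x h s j).1)%:C)) /
     (1 - cexp (- exponent theta lambda T (tnth r k)))))).
  apply: cmeasurableM; first exact: cmeasurable_cst.
  apply: cmeasurable_sum => k; apply: cmeasurableM; first exact: cmeasurable_cst.
  apply: cmeasurableM; last exact: cmeasurable_cst.
  by apply: cmeasurable_exp_dist; exact: measurable_cyclic_dist.
apply/funext => s; rewrite /Hker (sum_twisted_roots r_uniq rP).
by rewrite (s_indep i s s0) (s_indep j s s0).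
Qed.

Lemma cmeasurable_det_Kstar :
  cmeasurable (fun s : S => det_Kstar theta lambda T (all_points x h s)).
Proof.
rewrite /det_Kstar /determinant; apply: cmeasurable_sum => sg.
apply: cmeasurableM; first exact: cmeasurable_cst.
apply: cmeasurable_prod => i.
rewrite (_ : (fun _ => _) = fun s : S => Kstar theta lambda T (all_points x h s) (enum_val i) (enum_val (sg i))); last first.
  by apply/funext => s; rewrite mxE.
rewrite /Kstar; case: (enum_val i) => [[i0|u]|c].
- exact: cmeasurable_Kker.
- rewrite (_ : (fun _ => _) = fun s : S => (inl (inr u) == enum_val (sg i))%:R +
      -1 * Kker theta lambda T (all_points x h s (inl (inr u))) (all_points x h s (enum_val (sg i)))).
    apply: cmeasurableD; first exact: cmeasurable_cst.
    by apply: cmeasurableM; [exact: cmeasurable_cst|exact: cmeasurable_Kker].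
  by apply/funext => s; rewrite mulN1r.
exact: cmeasurable_Hker.
Qed.
End MeasurableKernel.

(** * Normalisation and conclusion *)

Section Normalisation.
Variables (R : realType) (n : nat) (theta : bool * bool) (lambda T : R).
Local Notation C := R[i].
Local Notation q := (hole_weight theta lambda).
Local Notation eps := (wrap_weight R theta).
Hypothesis n_gt0 : (0 < n)%N.
Variable r : n.-tuple C.
Hypothesis r_uniq : uniq r.
Hypothesis rP : forall w, (w \in r) = (w ^+ n == eps%:C).

Let PP' : root_mx r *m root_inv_mx r = 1%:M.
Proof. by apply: (@root_mxK R n theta). Qed.
Let P'P : root_inv_mx r *m root_mx r = 1%:M.
Proof. by apply: (@root_inv_mxK R n theta). Qed.
Let sum_beads : \sum_h ev_mx eps%:C (inr h) =
  root_mx r *m diag_mx (\row_j tnth r j) *m root_inv_mx r.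
Proof. by apply: sum_bead_mx. Qed.

Lemma evolution_trace_fock L :
  evolution_trace eps%:C (tnth r) (root_mx r) (root_inv_mx r) q%:C (fun x => cexp (T%:C * x)) L =
  fock_trace (flow T r) q%:C [seq (p.1, event_insertion eps%:C p.2) | p <- L].
Proof.
rewrite evolution_trace_mult //; first by move=> ? ?; rewrite mulrDr cexpD.
by rewrite mulr0 cexp0.
Qed.

Let x0 (i : void + void) : R * 'I_n := match i with inl v => of_void _ v | inr v => of_void _ v end.
Let h0 : void -> 'I_n := of_void _.

(** With no observed points and no marked beads the event is certain, so the density formula
    computes the partition function; the trace without insertions is [det (q + U 1)], and it is real
    as a limit of real sums. *)
Lemma partition_function_det :
  \det (q%:C%:M + flow T r 1) = (complex.Re (\det (q%:C%:M + flow T r 1)))%:C /\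
  partition_function n theta lambda T =
    prefactor R n theta * complex.Re (\det (q%:C%:M + flow T r 1)).
Proof.
have void0 : #|{: void}| = 0%N := card_void.
have x01 i : torus (x0 i) by case: i => -[].
have mT : measurable ([set: #|{: void}|.-tuple (measurableTypeR R)]) by exact: measurableT.
have void_ord (j : 'I_#|{: void}|) : False by case: (enum_val j).
have T_cube : [set: #|{: void}|.-tuple (measurableTypeR R)] `<=` @unit_cube R #|{: void}|.
  by move=> s _ j; case: (void_ord j).
have Lx0 : observations x0 = [::].
  apply: size0nil; rewrite (perm_size (perm_observations x0)) size_map -cardE.
  by rewrite card_sum !void0.
have L0 s : with_beads (observations x0) s (fun j : 'I_#|{: void}| => h0 (enum_val j)) = [::].
  apply: size0nil; rewrite (perm_size (perm_insert_all _ _)) Lx0 size_cat size_map size_enum_ord.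
  by rewrite void0.
have expE s : exp_weight theta lambda T x0 h0 (tnth r) (root_mx r) (root_inv_mx r) s =
    \det (q%:C%:M + flow T r 1).
  by rewrite /exp_weight L0 evolution_trace_fock /= fock_trace_nil.
have s0 : #|{: void}|.-tuple (measurableTypeR R).
  by apply: mktuple => j; case: (void_ord j).
have [_ im0] := bead_average_cvg lambda T h0 x01 PP' P'P sum_beads (T_cube s0 Logic.I).
rewrite expE in im0; split.
  by move: im0; case: (\det _) => a b /= ->.
have countE : event_count x0 h0 setT = cst 1.
  apply/funext => c; rewrite /event_count /=.
  have -> : bead_families h0 setT c = [set s0].
    apply/seteqP; split => s /=.
      by move=> _; apply: eq_from_tnth => j; case: (void_ord j).
    by move=> ->; split => // -[].
  rewrite fset_set1 cardfs1 mul1r; case: asboolP => // nocc; case: nocc.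
  by split => -[].
rewrite /partition_function -countE (weighted_integral_density lambda T h0 mT T_cube n_gt0 x01 PP' P'P sum_beads).
have densE : density theta lambda T x0 h0 setT (tnth r) (root_mx r) (root_inv_mx r) =
    fun=> complex.Re (\det (q%:C%:M + flow T r 1)).
  by apply/funext => s; rewrite /density expE indicT mul1r.
by rewrite densE cube_integral_cst divr1 void0 expr0 mul1r.
Qed.
End Normalisation.

Theorem theorem1p4 (R : realType) (n : nat) (theta : bool * bool)
    (lambda T : R) (O U B : finType) (x : O + U -> R * 'I_n) (h : B -> 'I_n) :
  (0 < n)%N ->
  partition_function n theta lambda T != 0 ->
  (forall i, torus (x i)) ->
  injective x ->
  cintegrable (@unit_cube R #|B|)
    (fun s => det_Kstar theta lambda T (all_points x h s)) /\
  forall A : set (#|B|.-tuple (measurableTypeR R)),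
    measurable A -> A `<=` @unit_cube R #|B| ->
    bead_integrable theta lambda T (event_count x h A) /\
    (bead_integral theta lambda T (event_count x h A))%:C =
      cintegral A (fun s => det_Kstar theta lambda T (all_points x h s)).
Proof.
move=> n_gt0 Z0 x01 x_inj.
have [r [r_uniq rP]] := twisted_roots_enum R theta n_gt0.
have PP' : root_mx r *m root_inv_mx r = 1%:M by apply: (@root_mxK R n theta).
have P'P : root_inv_mx r *m root_mx r = 1%:M by apply: (@root_inv_mxK R n theta).
have sum_beads : \sum_h ev_mx (wrap_weight R theta)%:C (inr h) =
    root_mx r *m diag_mx (\row_j tnth r j) *m root_inv_mx r by exact: (sum_bead_mx n_gt0 r_uniq rP).
have [detC ZE] := partition_function_det lambda T n_gt0 r_uniq rP.
set D := \det _ in detC ZE; set Dr := complex.Re D in detC ZE.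
(* A non-zero partition function makes [q + U 1] invertible, which is the same as non-zero
   denominators in the kernels. *)
have [k0 Dr0] : prefactor R n theta != 0 /\ Dr != 0.
  by move: Z0; rewrite ZE mulf_eq0 negb_or => /andP[].
have unitU : (hole_weight theta lambda)%:C%:M + flow T r 1 \in unitmx.
  by rewrite unitmxE unitfE -/D detC fmorph_eq0.
set f := fun s => det_Kstar theta lambda T (all_points x h s).
pose V := exp_weight theta lambda T x h (tnth r) (root_mx r) (root_inv_mx r).
pose F := undup [seq p.1 | p <- observations x].
have [mRe mIm] : cmeasurable f := cmeasurable_det_Kstar lambda T r_uniq rP x h.
have [C_meas uF] : measurable (@unit_cube R #|B|) /\ uniq F.
  by split; [exact: measurable_cube|exact: undup_uniq].
(* At generic times the determinant of [Kstar] is [T^b] times the insertion determinant, and the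
   trace [V s] is [D] times the same determinant. *)
have fE s : @unit_cube R #|B| s -> uniq ((s : seq R) ++ F) ->
    f s = (T ^+ #|B| / Dr * complex.Re (V s))%:C.
  move=> s01 sF; have [_ im0] := bead_average_cvg lambda T h x01 PP' P'P sum_beads s01.
  have VE : V s = (complex.Re (V s))%:C by move: im0; rewrite -/V; case: (V s) => a c /= ->.
  pose d : R * insertion R[i] n := (0, Insertion 0 0 (Ordinal n_gt0) (Ordinal n_gt0)).
  have := det_Kstar_match n_gt0 r_uniq rP unitU h x_inj sF d.
  rewrite -/(f s) => ->.
  have : V s = D * \det (insertion_nth_mx (flow T r) d (size [seq (p.1, event_insertion (wrap_weight R theta)%:C p.2) | p <- with_beads (observations x) s (fun j => h (enum_val j))])
      [seq (p.1, event_insertion (wrap_weight R theta)%:C p.2) | p <- with_beads (observations x) s (fun j => h (enum_val j))] (hole_weight theta lambda)%:C).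
    rewrite /V /exp_weight evolution_trace_fock //.
    by rewrite /D; apply: fock_trace_det; [exact: (flowD T n_gt0 r_uniq rP)|exact: unitU].
  have CM (u v : R) : (u * v)%:C = u%:C * v%:C :> R[i] by apply: rmorphM.
  have CX : (T ^+ #|B|)%:C = T%:C ^+ #|B| :> R[i] by apply: rmorphXn.
  have CV : (Dr^-1)%:C * Dr%:C = 1 :> R[i] by rewrite -CM mulVf.
  rewrite VE detC => VD; rewrite -mulrA (CM (T ^+ #|B|)) (CM Dr^-1) CX VD.
  by rewrite (mulrA (Dr^-1)%:C) CV mul1r.
have dens A (mA : measurable A) (A_cube : A `<=` @unit_cube R #|B|) :=
  family_integral_cvg lambda T h mA A_cube x01 PP' P'P sum_beads.
pose g A (s : #|B|.-tuple (measurableTypeR R)) : R :=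
  T ^+ #|B| / Dr * density theta lambda T x h A (tnth r) (root_mx r) (root_inv_mx r) s.
have bg A : measurable A -> A `<=` @unit_cube R #|B| -> bmeasurable (g A).
  by move=> mA AC; apply: bmeasurableM; [exact: bmeasurable_cst|have [] := dens A mA AC].
have ReE A : A `<=` @unit_cube R #|B| -> forall s, A s -> uniq ((s : seq R) ++ F) -> complex.Re (f s) = g A s.
  by move=> AC s sA sF; rewrite (fE s (AC s sA) sF) /g /density indicE mem_set // mul1r.
have ImE A : A `<=` @unit_cube R #|B| -> forall s, A s -> uniq ((s : seq R) ++ F) -> complex.Im (f s) = 0.
  by move=> AC s sA sF; rewrite (fE s (AC s sA) sF).
split.
  have [intRe _] := generic_integral uF C_meas (fun s Cs => Cs) mRe (bg _ C_meas (fun s Cs => Cs)) (ReE _ (fun s Cs => Cs)).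
  have [intIm _] := generic_integral uF C_meas (fun s Cs => Cs) mIm (bmeasurable_cst _ 0) (ImE _ (fun s Cs => Cs)).
  by split.
move=> A mA A_cube; split; first exact: event_count_bead_integrable.
rewrite /cintegral.
have [_ ->] := generic_integral uF mA A_cube mRe (bg _ mA A_cube) (ReE _ A_cube).
have [_ ->] := generic_integral uF mA A_cube mIm (bmeasurable_cst _ 0) (ImE _ A_cube).
have -> : \int[lebesgue_tuple R #|B|]_(s in A) (0 : R) = 0.
  by rewrite Rintegral_cst // mul0r.
have -> : \int[lebesgue_tuple R #|B|]_(s in A) g A s = cube_integral (g A).
  rewrite /cube_integral /Rintegral; congr fine.
  rewrite -[X in (\int[_]_(_ in X) _)%E](setIidr A_cube) integral_mkcondr.
  apply: eq_integral => s _; rewrite patchE; case: ifPn => // sA.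
  by rewrite /= /g /density indicE (negPf sA) mul0r mulr0.
rewrite /bead_integral (weighted_integral_density lambda T h mA A_cube n_gt0 x01 PP' P'P sum_beads) ZE.
rewrite /g cube_integralZ; last by have [] := dens A mA A_cube.
by congr (_ +i* _); field; rewrite ?k0 ?Dr0.
Qed.
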